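(* Let $X$ be a real random variable with $E(X)=0$, $E(X^2)=1$ and $E|X|^n<\infty$ for every integer $n\geq 3$, let $\{X_{ij}: i,j\geq 1\}$ be a collection of i.i.d. copies of $X$ defined on a common probability space $(\Omega,\mathscr{F},P)$, and for every integer $n\geq 1$ let $X_n=\{X_{ij}/\sqrt n : i,j=1,\dots,n\}$ be the associated $n\times n$ random matrix. Fix $m\geq 1$ and integers $k_m>\ldots>k_1\geq 1$. Let $Z_{k_1},\dots,Z_{k_m}$ be independent real centered Gaussian random variables with $E(Z_{k_j}^2)=k_j$ for $j=1,\dots,m$. Then, almost surely with respect to $P$, $$\frac{1}{\log N}\sum_{n=1}^N\frac1n\,\varphi\Big(\mathrm{Tr}(X_n^{k_1})-E[\mathrm{Tr}(X_n^{k_1})],\ldots,\mathrm{Tr}(X_n^{k_m})-E[\mathrm{Tr}(X_n^{k_m})]\Big)\longrightarrow E\big[\varphi(Z_{k_1},\ldots,Z_{k_m})\big]$$ as $N\to\infty$, for every continuous and bounded function $\varphi:\mathbb{R}^m\to\mathbb{R}$.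
   Context: $\mathrm{Tr}(\cdot)$ is the usual trace of a square matrix and $X_n^k$ denotes the $k$th power of the matrix $X_n$. All matrices $X_n$, $n\geq1$, are built from the same infinite array $\{X_{ij}\}$. *)

(* Defs.v *)
From HB Require Import structures.
From mathcomp Require Import all_boot all_order all_algebra.
From mathcomp Require Import all_classical all_reals all_analysis.
Set Implicit Arguments.
Unset Strict Implicit.
Unset Printing Implicit Defensive.
Import Order.TTheory GRing.Theory Num.Theory.
Import numFieldNormedType.Exports.
Local Open Scope classical_set_scope.
Local Open Scope ring_scope.

Definition mutually_independent (d : measure_display) (T : measurableType d)
    (R : realType) (P : probability T R) (I : eqType)
    (X : I -> {RV P >-> R}) : Prop :=
  forall (J : seq I) (A : I -> set R),
    uniq J -> (forall i, measurable (A i)) ->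
    P (\bigcap_(i in [set` J]) (X i @^-1` A i)) =
    (\prod_(i <- J) P (X i @^-1` A i))%E.

(* The laws are compared on measurable sets only: the functions [distribution]
   are defined on all subsets of R but meaningful only there. *)
Definition same_law (d d' : measure_display) (T : measurableType d)
    (T' : measurableType d') (R : realType) (P : probability T R)
    (P' : probability T' R) (X : {RV P >-> R}) (Y : {RV P' >-> R}) : Prop :=
  forall A : set R, measurable A -> distribution P X A = distribution P' Y A.

(* [normal_prob] takes the standard deviation as its second argument. *)
Definition centered_gaussian (d : measure_display) (T : measurableType d)
    (R : realType) (P : probability T R) (v : R) (Z : {RV P >-> R}) : Prop :=
  forall A : set R, measurable A ->
    distribution P Z A = normal_prob 0 (Num.sqrt v) A.

Section RandomMatrix.
Context (d : measure_display) (T : measurableType d) (R : realType)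
  (P : probability T R) (X : nat -> nat -> {RV P >-> R}).

(* The array is indexed from 0: [X i j] stands for X_{i+1, j+1}. *)
Definition rmatrix (n : nat) (w : T) : 'M[R]_n :=
  \matrix_(i < n, j < n) (X i j w / Num.sqrt n%:R).

Definition tr_power (n k : nat) (w : T) : R := \tr (rmatrix n w ^+ k).

Definition centered_tr_power (n k : nat) (w : T) : R :=
  tr_power n k w - fine 'E_P[tr_power n k].

End RandomMatrix.

(* Main.v *)
(* The method of moments gives convergence in law of the vector W_n of centered
   traces: E[Tr(X_n^{k_1})...] is a sum over families of closed walks, an edge
   visited once kills the expectation, and a family visiting every edge at least
   twice with the maximal number of vertices glues each closed walk to another
   one of the same length by one of its k rotations.  This yields
   E[prod_{s} W] = k * (number of partners) * E[prod of the rest] + O(n^{-1/2}),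
   the recursion satisfied by the moments of independent Gaussians of variance k.
   Only trigonometric polynomials are needed as test functions, and Taylor's
   formula for cos reduces them to moments.

   For n <= l, the walks avoiding the corner [0, n[ x [0, n[ split W_l into a part
   independent of W_n and a remainder of second moment O(n/l).  Hence, for a
   bounded Lipschitz g, Cov(g(W_n), g(W_l)) = O(sqrt(n/l)), so the logarithmic
   average of g(W_n) - E g(W_n) up to N has variance O(1 / ln N); it tends to 0
   along N_j = 2^(j^2) by summability, and ln N_{j+1} / ln N_j -> 1 fills the gaps.

   A single null set serves all continuous bounded phi: Bernstein polynomials in
   (1 + sin (x_j / A)) / 2 form a countable family of trigonometric polynomials
   approximating phi uniformly on [-A, A]^m, the error elsewhere being controlled
   by the test function min(1, sum_j |x_j| / A). *)

Require Import Defs.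
From HB Require Import structures.
From mathcomp Require Import all_boot all_order all_algebra.
From mathcomp Require Import all_classical all_reals all_analysis.
From mathcomp Require Import measurable_realfun ring lra zify.
Set Implicit Arguments.
Unset Strict Implicit.
Unset Printing Implicit Defensive.
Import Order.TTheory GRing.Theory Num.Theory.
Import numFieldNormedType.Exports.
Local Open Scope classical_set_scope.
Local Open Scope ring_scope.

(** * Random variables with all moments *)

Section Moments.
Context {d : measure_display} {T : measurableType d} {R : realType}.
Variable P : probability T R.
Implicit Types (f g : T -> R) (B : nat -> R).

(** The threshold [#|V| <= 2 * #|codom f|] rules the moment computation. The normalization
    contributes [n] to the power [- #|V| / 2], so labellings with fewer than [#|V| / 2] labels lose
    at least a factor [n^(-1/2)], and the Wick identity is needed only for the others. For those it
    holds exactly, one labelling at a time: an edge visited once makes both sides vanish, and if all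
    edges are repeated every label occurs exactly twice, so a walk shares labels with at most one
    other walk. Two walks glued in this way have equal lengths, because following one of them for
    the period of the other forces divisibility both ways; hence distinct powers are uncorrelated in
    the limit. One moment bound [B] common to all entries makes every constant independent of [n]
    and of the labelling. The covariance estimate compares a test function at two nearby vectors,
    whence the Lipschitz condition. The tail function is Lipschitz but not trigonometric: only the
    fluctuation of its average is controlled by covariances, its mean being bounded by second
    moments. *)

Definition mean f : R := \int[P]_w f w.

Lemma fine_expectation f : fine 'E_P[f] = mean f.
Proof. by rewrite unlock. Qed.

(** The integrals are taken in the extended reals because [mean] sends an infinite one to 0, so that
    a bound on [mean] alone would say nothing. The explicit sequence [B], rather than mere
    finiteness, lets one bound serve every entry and every walk of a given length. *)
Definition moments_le B f : Prop := measurable_fun setT f /\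
  forall p, (\int[P]_w (`|f w| ^+ p)%:E <= (B p)%:E)%E.

Definition all_moments f : Prop := exists B, moments_le B f.

Lemma moments_le_measurable B f : moments_le B f -> measurable_fun setT f.
Proof. by case. Qed.

Lemma measurable_abs_pow f p : measurable_fun setT f ->
  measurable_fun setT (fun w => `|f w| ^+ p).
Proof. by move=> mf; apply: measurable_funX; apply: measurableT_comp. Qed.

Lemma moments_le_integrable_pow B f p : moments_le B f ->
  P.-integrable setT (EFin \o (fun w => `|f w| ^+ p)).
Proof.
move=> [mf /(_ p) Bf]; apply/integrableP; split.
  by apply/measurable_EFinP; exact: measurable_abs_pow.
under eq_integral => w _ do rewrite /= ger0_norm ?exprn_ge0//.
exact: le_lt_trans Bf (ltry _).
Qed.

Lemma moments_le_integrable B f : moments_le B f ->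
  P.-integrable setT (EFin \o f).
Proof.
move=> Bf; have := moments_le_integrable_pow 1 Bf.
apply: le_integrable => //.
  by apply/measurable_EFinP; exact: moments_le_measurable Bf.
by move=> w _ /=; rewrite expr1 normr_id.
Qed.

Lemma moments_le_mean_pow B f p : moments_le B f ->
  mean (fun w => `|f w| ^+ p) <= B p.
Proof.
move=> Bf; rewrite -lee_fin /mean /Rintegral fineK.
  by case: Bf => _; exact.
exact: integrable_fin_num (moments_le_integrable_pow p Bf).
Qed.

Lemma moments_le_ge0 B f p : moments_le B f -> 0 <= B p.
Proof.
move=> Bf; apply: le_trans (moments_le_mean_pow p Bf).
by apply: Rintegral_ge0 => w _; rewrite exprn_ge0.
Qed.

Lemma moments_leW B B' f : (forall p, B p <= B' p) ->
  moments_le B f -> moments_le B' f.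
Proof.
by move=> BB' [mf Bf]; split=> // p; rewrite (le_trans (Bf p))// lee_fin.
Qed.

Lemma moments_le_cst (c : R) : moments_le (fun p => `|c| ^+ p) (cst c).
Proof.
split=> // p; have := integral_cst P (@measurableT _ T) (`|c| ^+ p)%:E.
by rewrite /= probability_setT mule1 => ->.
Qed.

Definition boundD B1 B2 p : R := 2 ^+ p * (B1 p + B2 p).
Definition boundM B1 B2 p : R := B1 (p + p)%N + B2 (p + p)%N.

Lemma normD_pow_le (x y : R) p : `|x + y| ^+ p <= 2 ^+ p * (`|x| ^+ p + `|y| ^+ p).
Proof.
wlog xy : x y / `|x| <= `|y|.
  move=> H; have [/H//|/ltW yx] := leP `|x| `|y|.
  by rewrite addrC (addrC (`|x| ^+ p)); exact: H.
apply: (@le_trans _ _ ((2 * `|y|) ^+ p)).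
  rewrite lerXn2r ?nnegrE ?mulr_ge0//.
  by rewrite (le_trans (ler_normD _ _))// mulr_natl mulr2n lerD2r.
by rewrite exprMn ler_wpM2l ?exprn_ge0// lerDr exprn_ge0.
Qed.

(** An arithmetic-geometric bound in place of the Cauchy-Schwarz inequality: a product costs a
    doubling of the exponent, harmless when all moments are available. *)
Lemma normM_pow_le (x y : R) p :
  `|x * y| ^+ p <= `|x| ^+ (p + p) + `|y| ^+ (p + p).
Proof.
rewrite normrM exprMn !exprD -!expr2.
set a := `|x| ^+ p; set b := `|y| ^+ p.
have a0 : 0 <= a by rewrite exprn_ge0.
have b0 : 0 <= b by rewrite exprn_ge0.
nra.
Qed.

Lemma moments_leD B1 B2 f g : moments_le B1 f -> moments_le B2 g ->
  moments_le (boundD B1 B2) (fun w => f w + g w).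
Proof.
move=> [mf Bf] [mg Bg]; split=> [|p]; first exact: measurable_funD.
have mfp := measurable_abs_pow p mf; have mgp := measurable_abs_pow p mg.
apply: (@le_trans _ _ (\int[P]_w ((2 ^+ p)%:E * (`|f w| ^+ p + `|g w| ^+ p)%:E))%E).
  apply: ge0_le_integral => //.
  - apply/measurable_EFinP; apply: measurable_abs_pow.
    exact: measurable_funD.
  - by apply/measurable_EFinP; apply: measurable_funM => //; apply: measurable_funD.
  - by move=> w _; rewrite -EFinM lee_fin; exact: normD_pow_le.
rewrite ge0_integralZl//; last by apply/measurable_EFinP; exact: measurable_funD.
rewrite /boundD EFinM; apply: lee_wpmul2l; first by rewrite lee_fin exprn_ge0.
under eq_integral do rewrite EFinD.
rewrite ge0_integralD//; try exact/measurable_EFinP.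
by rewrite EFinD; exact: leeD.
Qed.

Lemma moments_leM B1 B2 f g : moments_le B1 f -> moments_le B2 g ->
  moments_le (boundM B1 B2) (fun w => f w * g w).
Proof.
move=> [mf Bf] [mg Bg]; split=> [|p]; first exact: measurable_funM.
have mfp := measurable_abs_pow (p + p) mf.
have mgp := measurable_abs_pow (p + p) mg.
apply: (@le_trans _ _ (\int[P]_w ((`|f w| ^+ (p + p))%:E + (`|g w| ^+ (p + p))%:E))%E).
  apply: ge0_le_integral => //.
  - by apply/measurable_EFinP; apply: measurable_abs_pow; exact: measurable_funM.
  - by apply/measurable_EFinP; exact: measurable_funD.
  - by move=> w _; rewrite -EFinD lee_fin; exact: normM_pow_le.
rewrite ge0_integralD//; try exact/measurable_EFinP.
by rewrite EFinD; exact: leeD.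
Qed.

Fixpoint bound_prod B (k : nat) : nat -> R :=
  if k is k'.+1 then boundM B (bound_prod B k') else fun p => 1.

Lemma moments_le_prod (I : Type) B (s : seq I) (F : I -> T -> R) :
  (forall i, moments_le B (F i)) ->
  moments_le (bound_prod B (size s)) (fun w => \prod_(i <- s) F i w).
Proof.
move=> BF; elim: s => [|i s IH] /=.
  have -> : (fun w => \prod_(i <- [::]) F i w) = cst 1.
    by apply/funext => w; rewrite big_nil.
  by apply: moments_leW (moments_le_cst 1) => p; rewrite normr1 expr1n.
have -> : (fun w => \prod_(j <- i :: s) F j w) =
    fun w => F i w * \prod_(j <- s) F j w.
  by apply/funext => w; rewrite big_cons.
exact: moments_leM.
Qed.

Lemma all_moments_measurable f : all_moments f -> measurable_fun setT f.
Proof. by case=> B; exact: moments_le_measurable. Qed.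

Lemma all_moments_integrable f : all_moments f -> P.-integrable setT (EFin \o f).
Proof. by case=> B; exact: moments_le_integrable. Qed.

Lemma all_moments_cst (c : R) : all_moments (cst c).
Proof. by eexists; exact: moments_le_cst. Qed.

Lemma all_momentsD f g : all_moments f -> all_moments g ->
  all_moments (fun w => f w + g w).
Proof. by move=> [B1 Bf] [B2 Bg]; exists (boundD B1 B2); exact: moments_leD. Qed.

Lemma all_momentsM f g : all_moments f -> all_moments g ->
  all_moments (fun w => f w * g w).
Proof. by move=> [B1 Bf] [B2 Bg]; exists (boundM B1 B2); exact: moments_leM. Qed.

Lemma all_momentsZ (c : R) f : all_moments f -> all_moments (fun w => c * f w).
Proof. by move=> ?; apply: all_momentsM => //; exact: all_moments_cst. Qed.

Lemma all_momentsN f : all_moments f -> all_moments (fun w => - f w).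
Proof.
move=> mf; rewrite (_ : (fun _ => _) = fun w => -1 * f w); first exact: all_momentsZ.
by apply/funext => w; rewrite mulN1r.
Qed.

Lemma all_momentsB f g : all_moments f -> all_moments g ->
  all_moments (fun w => f w - g w).
Proof. by move=> mf mg; apply: all_momentsD => //; exact: all_momentsN. Qed.

Lemma all_moments_sum (I : Type) (s : seq I) (Q : pred I) (F : I -> T -> R) :
  (forall i, Q i -> all_moments (F i)) ->
  all_moments (fun w => \sum_(i <- s | Q i) F i w).
Proof.
move=> mF; elim: s => [|i s IH].
  rewrite (_ : (fun _ => _) = cst 0); first exact: all_moments_cst.
  by apply/funext => w; rewrite big_nil.
case Qi : (Q i).
  rewrite (_ : (fun _ => _) = fun w => F i w + \sum_(j <- s | Q j) F j w).
    by apply: all_momentsD => //; exact: mF.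
  by apply/funext => w; rewrite big_cons Qi.
by under [X in all_moments X]funext => w do rewrite big_cons Qi.
Qed.

Lemma all_moments_prod (I : Type) (s : seq I) (Q : pred I) (F : I -> T -> R) :
  (forall i, Q i -> all_moments (F i)) ->
  all_moments (fun w => \prod_(i <- s | Q i) F i w).
Proof.
move=> mF; elim: s => [|i s IH].
  rewrite (_ : (fun _ => _) = cst 1); first exact: all_moments_cst.
  by apply/funext => w; rewrite big_nil.
case Qi : (Q i).
  rewrite (_ : (fun _ => _) = fun w => F i w * \prod_(j <- s | Q j) F j w).
    by apply: all_momentsM => //; exact: mF.
  by apply/funext => w; rewrite big_cons Qi.
by under [X in all_moments X]funext => w do rewrite big_cons Qi.
Qed.

Lemma all_momentsX f p : all_moments f -> all_moments (fun w => f w ^+ p).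
Proof.
move=> mf; rewrite (_ : (fun _ => _) = fun w => \prod_(i < p) f w).
  exact: all_moments_prod.
by apply/funext => w; rewrite prodr_const card_ord.
Qed.

Lemma all_moments_bounded f (C : R) : measurable_fun setT f ->
  (forall w, `|f w| <= C) -> all_moments f.
Proof.
move=> mf fC; exists (fun p => C ^+ p); split=> // p.
have C0 (w : T) : 0 <= C by exact: le_trans (fC w).
apply: (@le_trans _ _ (\int[P]_w (C ^+ p)%:E)%E).
  apply: ge0_le_integral => //.
  - by apply/measurable_EFinP; exact: measurable_abs_pow.
  - by move=> w _; rewrite lee_fin lerXn2r ?nnegrE ?(C0 w).
have := integral_cst P (@measurableT _ T) (C ^+ p)%:E.
by rewrite /= probability_setT mule1 => ->.
Qed.

Lemma all_moments_abs f : all_moments f -> all_moments (fun w => `|f w|).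
Proof.
move=> [B [mf Bf]]; exists B; split=> [|p]; first exact: measurableT_comp.
by under eq_integral do rewrite normr_id.
Qed.

Lemma mean_cst (c : R) : mean (cst c) = c.
Proof. by rewrite /mean Rintegral_cst//= probability_setT mulr1. Qed.

Lemma meanD f g : all_moments f -> all_moments g ->
  mean (fun w => f w + g w) = mean f + mean g.
Proof.
by move=> ? ?; rewrite /mean RintegralD//; exact: all_moments_integrable.
Qed.

Lemma meanB f g : all_moments f -> all_moments g ->
  mean (fun w => f w - g w) = mean f - mean g.
Proof.
by move=> ? ?; rewrite /mean RintegralB//; exact: all_moments_integrable.
Qed.

Lemma meanZ (c : R) f : all_moments f -> mean (fun w => c * f w) = c * mean f.
Proof.
by move=> ?; rewrite /mean RintegralZl//; exact: all_moments_integrable.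
Qed.

Lemma mean_sum (I : Type) (s : seq I) (Q : pred I) (F : I -> T -> R) :
  (forall i, Q i -> all_moments (F i)) ->
  mean (fun w => \sum_(i <- s | Q i) F i w) = \sum_(i <- s | Q i) mean (F i).
Proof.
move=> mF; elim: s => [|i s IH].
  under [X in mean X]funext => w do rewrite big_nil.
  by rewrite big_nil; exact: mean_cst.
rewrite big_cons; case Qi : (Q i); last first.
  by under [X in mean X]funext => w do rewrite big_cons Qi.
under [X in mean X]funext => w do rewrite big_cons Qi.
rewrite meanD ?IH//; first exact: mF.
exact: all_moments_sum.
Qed.

Lemma le_mean f g : all_moments f -> all_moments g ->
  (forall w, f w <= g w) -> mean f <= mean g.
Proof.
by move=> mf mg fg; apply: le_Rintegral => //; exact: all_moments_integrable.
Qed.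

Lemma mean_ge0 f : (forall w, 0 <= f w) -> 0 <= mean f.
Proof. by move=> f0; apply: Rintegral_ge0. Qed.

Lemma normr_mean f : all_moments f -> `|mean f| <= mean (fun w => `|f w|).
Proof.
by move=> mf; apply: le_normr_Rintegral => //; exact: all_moments_integrable.
Qed.

Lemma normr_mean_le B f : moments_le B f -> `|mean f| <= B 1%N.
Proof.
move=> Bf; rewrite (le_trans (normr_mean _))//; first by exists B.
by rewrite (le_trans _ (moments_le_mean_pow 1 Bf)).
Qed.

End Moments.

(** * Independence *)

Section Independence.
Context {d : measure_display} {T : measurableType d} {R : realType}.
Context {P : probability T R} {I : eqType}.
Variable X : I -> {RV P >-> R}.
Implicit Types (E : seq I) (F G : T -> R).

Definition cylinders E : set (set T) :=
  [set C | exists2 A : I -> set R, (forall i, measurable (A i)) &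
     C = \bigcap_(i in [set` E]) (X i @^-1` A i)].

(** Measurability for the sigma-algebra generated by the [X i] with [i] in [E]. Stability under
    sums, products and compositions is then that of measurable functions, and [F] never has to be
    written as a function of a vector of entries. *)
Definition depends_on E F : Prop :=
  @measurable_fun _ _ (g_sigma_algebraType (cylinders E)) R setT F.

Lemma cylinders_measurable E : cylinders E `<=` measurable.
Proof.
move=> _ [A mA ->]; apply: fin_bigcap_measurable => [|i _]; last exact: measurable_funPTI.
exact: finite_seq.
Qed.

Lemma setI_closed_cylinders E : setI_closed (cylinders E).
Proof.
move=> _ _ [A mA ->] [B mB ->]; exists (fun i => A i `&` B i).
  by move=> i; exact: measurableI.
apply/seteqP; split=> [w [Aw Bw] i iE|w ABw]; first by split; [exact: Aw|exact: Bw].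
by split=> i iE; have [] := ABw i iE.
Qed.

Lemma cylindersT E : cylinders E setT.
Proof.
exists (fun=> setT) => //; apply/seteqP; split=> //.
Qed.

Lemma sigma_cylinders_measurable E C : <<s cylinders E >> C -> measurable C.
Proof.
by apply: smallest_sub; [exact: sigma_algebra_measurable|exact: cylinders_measurable].
Qed.

Lemma depends_on_cst E (c : R) : depends_on E (cst c).
Proof. exact: measurable_cst. Qed.

Lemma depends_on_X E i : i \in E -> depends_on E (X i).
Proof.
move=> iE _ A mA; apply: sub_sigma_algebra; rewrite setTI.
exists (fun j => if j == i then A else setT) => [j|]; first by case: ifP.
apply/seteqP; split=> w /=; first by move=> Aw j /= _; case: eqP => [->|].
by move=> /(_ i iE); rewrite /= eqxx.
Qed.

Lemma depends_onD E F G : depends_on E F -> depends_on E G ->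
  depends_on E (fun w => F w + G w).
Proof. exact: measurable_funD. Qed.

Lemma depends_onM E F G : depends_on E F -> depends_on E G ->
  depends_on E (fun w => F w * G w).
Proof. exact: measurable_funM. Qed.

Lemma depends_on_comp E F (h : R -> R) : measurable_fun setT h ->
  depends_on E F -> depends_on E (h \o F).
Proof. by move=> mh mF; apply: measurableT_comp. Qed.

Lemma depends_on_sum E (J : Type) (s : seq J) (Q : pred J) (F : J -> T -> R) :
  (forall j, Q j -> depends_on E (F j)) ->
  depends_on E (fun w => \sum_(j <- s | Q j) F j w).
Proof.
move=> mF; elim: s => [|j s IH].
  rewrite (_ : (fun _ => _) = cst 0); first exact: depends_on_cst.
  by apply/funext => w; rewrite big_nil.
case Qj : (Q j).
  rewrite (_ : (fun _ => _) = fun w => F j w + \sum_(i <- s | Q i) F i w).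
    by apply: depends_onD => //; exact: mF.
  by apply/funext => w; rewrite big_cons Qj.
by under [X in depends_on _ X]funext => w do rewrite big_cons Qj.
Qed.

Lemma depends_on_prod E (J : Type) (s : seq J) (Q : pred J) (F : J -> T -> R) :
  (forall j, Q j -> depends_on E (F j)) ->
  depends_on E (fun w => \prod_(j <- s | Q j) F j w).
Proof.
move=> mF; elim: s => [|j s IH].
  rewrite (_ : (fun _ => _) = cst 1); first exact: depends_on_cst.
  by apply/funext => w; rewrite big_nil.
case Qj : (Q j).
  rewrite (_ : (fun _ => _) = fun w => F j w * \prod_(i <- s | Q i) F i w).
    by apply: depends_onM => //; exact: mF.
  by apply/funext => w; rewrite big_cons Qj.
by under [X in depends_on _ X]funext => w do rewrite big_cons Qj.
Qed.

Hypothesis X_indep : mutually_independent X.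

Lemma probability_cylinders E1 E2 C D : uniq E1 -> uniq E2 ->
  {in E1, forall i, i \notin E2} -> cylinders E1 C -> cylinders E2 D ->
  P (C `&` D) = (P C * P D)%E.
Proof.
move=> u1 u2 dis [A mA ->] [B mB ->].
pose AB i := if i \in E1 then A i else B i.
have mAB i : measurable (AB i) by rewrite /AB; case: ifP.
have u12 : uniq (E1 ++ E2).
  rewrite cat_uniq u1 u2 andbT; apply/hasPn => i iE2; apply/negP => iE1.
  by move: (dis i iE1); rewrite iE2.
rewrite (X_indep u1 mA) (X_indep u2 mB).
have := X_indep u12 mAB; rewrite big_cat /= => H.
transitivity (P (\bigcap_(i in [set` E1 ++ E2]) (X i @^-1` AB i))).
  congr (P _); apply/seteqP; split=> w.
    move=> [Aw Bw] i /=; rewrite mem_cat /AB; case: ifP => [iE1 _|_ /= iE2].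
      exact: Aw.
    exact: Bw.
  move=> ABw; split=> i /= iE.
    by have := ABw i; rewrite /AB /= mem_cat iE => /(_ isT).
  have := ABw i; rewrite /AB /= mem_cat iE orbT => /(_ isT).
  by case: ifP => // /dis; rewrite iE.
rewrite H; congr (_ * _)%E; apply: eq_big_seq => i iE; rewrite /AB ?iE//.
by case: ifP => // /dis; rewrite iE.
Qed.

(** Dynkin's argument, applied to each event in turn: when one event is fixed, both sides are finite
    measures of the other, and they agree on the cylinders, which are stable under intersection and
    contain [setT]. *)
Lemma probability_sigma_cylinders E1 E2 C D : uniq E1 -> uniq E2 ->
  {in E1, forall i, i \notin E2} ->
  <<s cylinders E1 >> C -> <<s cylinders E2 >> D ->
  P (C `&` D) = (P C * P D)%E.
Proof.
move=> u1 u2 dis.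
have step (G : set (set T)) (D' : set T) : G `<=` measurable -> setI_closed G -> G setT ->
    measurable D' -> (forall C', G C' -> P (C' `&` D') = (P C' * P D')%E) ->
    forall C', <<s G >> C' -> P (C' `&` D') = (P C' * P D')%E.
  move=> Gm IG GT mD GD C' sC.
  have PD0 : 0 <= fine (P D') by rewrite fine_ge0.
  have PDE : P D' = (fine (P D'))%:E by rewrite fineK// fin_num_measure.
  have mE A : mscale (NngNum PD0) P A = (P A * P D')%E.
    by rewrite /mscale /= PDE muleC.
  transitivity (mscale (NngNum PD0) P C'); last exact: mE.
  apply: (@g_sigma_algebra_measure_unique _ _ _ G Gm (fun=> setT) (fun=> GT) _
    (mrestr P mD) (mscale (NngNum PD0) P) IG _ _ C' sC).
  - by rewrite bigcup_const.
  - by move=> A GA; apply: etrans (GD _ GA) _; apply/esym/mE.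
  - move=> _; have : (P (setT `&` D') < +oo)%E.
      by rewrite (le_lt_trans (probability_le1 _ _)) ?ltry//; exact: measurableI.
    exact.
move=> sC sD; have mC := sigma_cylinders_measurable sC.
apply: (step (cylinders E1)) => //; [exact: cylinders_measurable|
  exact: setI_closed_cylinders|exact: cylindersT|exact: sigma_cylinders_measurable sD|].
move=> C' C'1; rewrite setIC muleC.
apply: (step (cylinders E2)) => //; [exact: cylinders_measurable|
  exact: setI_closed_cylinders|exact: cylindersT|exact: cylinders_measurable C'1|].
by move=> D' D'2; rewrite setIC muleC; exact: probability_cylinders C'1 D'2.
Qed.

End Independence.

(** * Expectation of a product of independent variables *)

Section IndependentProduct.
Context {d : measure_display} {T : measurableType d} {R : realType}.
Context {P : probability T R}.

(** The law of [(F, G)] coincides with the product of the two laws on rectangles, hence everywhere,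
    and Fubini's theorem splits the integral of [z.1 * z.2]. Integrability under the product law is
    inherited from the moments of [F * G]. *)
Lemma mean_indepM (F G : T -> R) :
  all_moments P F -> all_moments P G ->
  (forall A B : set R, measurable A -> measurable B ->
     P (F @^-1` A `&` G @^-1` B) = (P (F @^-1` A) * P (G @^-1` B))%E) ->
  mean P (fun w => F w * G w) = mean P F * mean P G.
Proof.
move=> mF mG FG.
have msF := all_moments_measurable mF; have msG := all_moments_measurable mG.
pose F' : {RV P >-> R} := mfun_Sub (mem_set msF).
pose G' : {RV P >-> R} := mfun_Sub (mem_set msG).
have msH : measurable_fun setT (fun w => (F w, G w)) by exact: measurable_fun_pair.
pose H' : {RV P >-> (R * R)%type} := mfun_Sub (mem_set msH).
pose m1 := distribution P F'; pose m2 := distribution P G'.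
pose h (z : R * R) : \bar R := (z.1 * z.2)%:E.
have mh : measurable_fun setT h.
  by apply/measurable_EFinP; apply: measurable_funM.
have iFG := all_moments_integrable (all_momentsM mF mG).
have law Z : measurable Z -> (m1 \x m2)%E Z = distribution P H' Z.
  apply: product_measure_unique => A B mA mB.
  exact: FG.
have ih : (m1 \x m2)%E.-integrable setT h.
  apply/integrableP; split=> //.
  rewrite (@eq_measure_integral _ _ _ _ (distribution P H')); last by move=> A mA _; exact: law.
  rewrite ge0_integral_distribution//; last exact: measurableT_comp.
  by case/integrableP : iFG.
have -> : mean P (fun w => F w * G w) = fine (\int[m1 \x m2]_z h z)%E.
  rewrite (@eq_measure_integral _ _ _ _ (distribution P H')); last by move=> A mA _; exact: law.
  by rewrite integral_distribution.
rewrite -integral12_prod_meas1//.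
have EG : (\int[m2]_y y%:E = (mean P G)%:E)%E.
  rewrite /m2 (@integral_distribution _ _ _ _ _ _ G' EFin)//; last exact: all_moments_integrable.
  rewrite /mean /Rintegral fineK//; exact: integrable_fin_num (all_moments_integrable mG).
have iG : m2.-integrable setT EFin.
  have := integrable_pushforward msG (@EFin_measurable R setT) (D := setT).
  by apply => //; rewrite preimage_setT; exact: all_moments_integrable.
under eq_integral => x _.
  rewrite /fubini_F /h /=.
  under eq_integral do rewrite EFinM.
  rewrite integralZl// EG -EFinM.
  over.
rewrite /m1 (@integral_distribution _ _ _ _ _ _ F' (fun x => (x * mean P G)%:E))//; last 2 first.
- by apply/measurable_EFinP; exact: measurable_funM.
- apply: all_moments_integrable; apply: all_momentsM => //; exact: all_moments_cst.
transitivity (mean P (fun w => mean P G * F w)); last by rewrite meanZ// mulrC.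
by congr fine; apply: eq_integral => w _ /=; rewrite mulrC.
Qed.

Lemma mean_depends_on_M {I : eqType} (X : I -> {RV P >-> R}) (E1 E2 : seq I)
    (F G : T -> R) :
  mutually_independent X -> {in E1, forall i, i \notin E2} ->
  depends_on X E1 F -> depends_on X E2 G -> all_moments P F -> all_moments P G ->
  mean P (fun w => F w * G w) = mean P F * mean P G.
Proof.
move=> X_indep dis dF dG mF mG; apply: mean_indepM => // A B mA mB.
(* Independence speaks of duplicate-free lists only, while the list of edges of a family of walks
   may repeat; the generated sigma-algebra does not see repetitions. *)
have undup_dep E H : depends_on X E H -> depends_on X (undup E) H.
  by rewrite /depends_on /cylinders; have -> : [set` undup E] = [set` E]
    by apply/seteqP; split=> i /=; rewrite mem_undup.
apply: (probability_sigma_cylinders X_indep (undup_uniq E1) (undup_uniq E2)).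
- by move=> i; rewrite !mem_undup; exact: dis.
- by rewrite -[_ @^-1` _]setTI; exact: (undup_dep _ _ dF).
- by rewrite -[_ @^-1` _]setTI; exact: (undup_dep _ _ dG).
Qed.

(** Each factor is independent of the product of the later ones. The function [h] will be the
    identity and the square. *)
Lemma mean_prod_distinct {I : eqType} (X : I -> {RV P >-> R}) (h : R -> R) (s : seq I) :
  mutually_independent X -> measurable_fun setT h ->
  (forall i, all_moments P (h \o X i)) -> uniq s ->
  mean P (fun w => \prod_(i <- s) h (X i w)) = \prod_(i <- s) mean P (h \o X i).
Proof.
move=> X_indep mh ah; elim: s => [_|i s IH /= /andP[iNs us]].
  rewrite big_nil -[RHS](mean_cst P 1); congr (mean P _).
  by apply/funext => w; rewrite big_nil.
rewrite big_cons -IH//.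
have dX j E : j \in E -> depends_on X E (h \o X j).
  by move=> jE; apply: depends_on_comp => //; exact: depends_on_X.
rewrite -(mean_depends_on_M (E1 := [:: i]) (E2 := s) X_indep)//.
- by congr (mean P _); apply/funext => w; rewrite big_cons.
- by move=> j; rewrite inE => /eqP ->.
- by apply: dX; rewrite inE.
- under [X in depends_on _ _ X]funext => w do rewrite big_seq.
  by apply: depends_on_prod => j js; exact: dX.
- by apply: all_moments_prod => j _; exact: ah.
Qed.

End IndependentProduct.

(** * Counting walk families *)

Section Counting.
Local Open Scope set_scope.

Lemma card_bigcup_le (I T : finType) (Q : pred I) (F : I -> {set T}) :
  (#|\bigcup_(i | Q i) F i| <= \sum_(i | Q i) #|F i|)%N.
Proof.
elim/big_rec2: _ => [|i A m _ IH]; first by rewrite cards0.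
by apply: leq_trans (leq_card_setU _ _) _; rewrite leq_add2l.
Qed.

Lemma card_ord_lt (l n : nat) : (#|[pred x : 'I_l | (x < n)%N]| <= n)%N.
Proof.
case: n => [|n]; first by rewrite leqn0; apply/eqP/eq_card0 => x; rewrite inE.
rewrite -[X in (_ <= X)%N](card_ord n.+1).
rewrite -(card_in_imset (f := fun x : 'I_l => inord x : 'I_n.+1)); first exact: max_card.
move=> x y; rewrite !inE => xn yn /(congr1 val) /=.
by rewrite !inordK// => /val_inj.
Qed.

(** Such an [f] factors through [r] slots: [r ^ #|V|] ways to send [V] to the slots, then [r]
    choices of a slot whose label is below [n], [n] choices of that label and [l ^ r.-1] of the
    others. The label below [n] later yields the factor [n / l]; for [n = l] it constrains nothing
    as soon as [V] is nonempty. *)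
Lemma card_ffun_small_image (V : finType) (l n r : nat) :
  (#|[set f : {ffun V -> 'I_l} | (#|codom f| <= r) && [exists u, (f u < n)%N]]|
     <= r ^ #|V| * (r * (n * l ^ r.-1)))%N.
Proof.
pose Gs := [set g : {ffun 'I_r -> 'I_l} | [exists i, (g i < n)%N]].
have cardGs : (#|Gs| <= r * (n * l ^ r.-1))%N.
  have -> : Gs = \bigcup_(i in [set: 'I_r]) [set g : {ffun 'I_r -> 'I_l} | (g i < n)%N].
    apply/finset.setP => g; rewrite inE; apply/existsP/finset.bigcupP => [[i gi]|[i _]].
      by exists i; rewrite ?inE.
    by rewrite inE => gi; exists i.
  apply: leq_trans (card_bigcup_le _ _) _.
  rewrite -[X in (_ <= X * _)%N]card_ord -sum_nat_const.
  rewrite (eq_bigl predT); last by move=> i; rewrite inE.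
  apply: leq_sum => i _.
  pose F (j : 'I_r) : pred 'I_l := if j == i then [pred x : 'I_l | (x < n)%N] else predT.
  have -> : #|[set g : {ffun 'I_r -> 'I_l} | (g i < n)%N]| = #|family F|.
    apply: eq_card => g; rewrite inE; apply/idP/familyP => [gi j|/(_ i)].
      by rewrite /F; case: eqP => [->|].
    by rewrite /F eqxx.
  rewrite card_family foldrE big_map big_enum /= (bigD1 i)//= /F eqxx.
  apply: leq_mul.
    exact: card_ord_lt.
  rewrite (eq_bigr (fun=> l)); last by move=> j /negbTE ->; rewrite card_ord.
  by rewrite prod_nat_const cardC1 card_ord.
pose comp (p : {ffun V -> 'I_r} * {ffun 'I_r -> 'I_l}) : {ffun V -> 'I_l} :=
  [ffun v => p.2 (p.1 v)].
apply: (@leq_trans #|comp @: finset.setX (finset.setTfor {ffun V -> 'I_r}) Gs|); last first.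
  apply: leq_trans (leq_imset_card _ _) _.
  by rewrite cardsX cardsT card_ffun card_ord leq_mul2l cardGs orbT.
apply/subset_leq_card/fintype.subsetP => f; rewrite inE => /andP[fr /existsP[u fu]].
pose s := enum (codom f).
have ss : size s = #|codom f| by rewrite -cardE.
have hlt v : (index (f v) s < r)%N.
  by apply: leq_trans fr; rewrite -ss index_mem mem_enum codom_f.
(* A label is encoded by its position in the list [s] of the values of [f]. Slots beyond the end of
   [s] receive the default [f u], a legitimate label that the composite never reads. *)
apply/imsetP; exists ([ffun v => Ordinal (hlt v)], [ffun i : 'I_r => nth (f u) s i]).
  rewrite finset.in_setX !inE /=; apply/existsP; exists (Ordinal (hlt u)).
  by rewrite ffunE /= nth_index// mem_enum codom_f.
by apply/ffunP => v; rewrite !ffunE /= nth_index// mem_enum codom_f.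
Qed.

Section Classes.
Variables (V L : finType) (f : V -> L).
Hypothesis f_twice : forall v, exists2 u, u != v & f u = f v.

Let card_class x : x \in codom f -> (2 <= #|[set v | f v == x]|)%N.
Proof.
move=> /codomP[v ->]; have [u uv fuv] := f_twice v.
rewrite (cardsD1 v) inE eqxx ltnS card_gt0; apply/finset.set0Pn; exists u.
by rewrite !inE uv fuv eqxx.
Qed.

Let card_classes : #|V| = (\sum_(x in codom f) #|[set v | f v == x]|)%N.
Proof.
rewrite -sum1_card (partition_big f (mem (codom f))) /=; last by move=> v _; exact: codom_f.
by apply: eq_bigr => x _; rewrite -sum1_card; apply: eq_bigl => v; rewrite !inE.
Qed.

Lemma codom_half : (2 * #|codom f| <= #|V|)%N.
Proof.
rewrite card_classes mulnC -sum_nat_const; apply: leq_sum => x; exact: card_class.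
Qed.

(** A class with three elements would push the sum of the class sizes strictly above
    [2 * #|codom f|], all other classes having at least two. *)
Lemma classes_pairs : (#|V| <= 2 * #|codom f|)%N ->
  forall v u w, u != v -> w != v -> f u = f v -> f w = f v -> u = w.
Proof.
move=> Vf v u w uv wv fu fw; apply/eqP/negPn/negP => uw.
suff : (2 * #|codom f| < #|V|)%N by rewrite ltnNge Vf.
rewrite card_classes (bigD1 (f v)) ?codom_f//=.
rewrite mulnC -sum_nat_const (bigD1 (f v)) ?codom_f//=.
rewrite -addSn; apply: leq_add; last by apply: leq_sum => x /andP[? _]; exact: card_class.
rewrite (cardsD1 v) inE eqxx (cardsD1 u) !inE uv fu eqxx (cardsD1 w) !inE.
by rewrite eq_sym uw wv fw eqxx.
Qed.

End Classes.

End Counting.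

(** * Traces of matrix powers as sums over closed walks *)

Section TraceExpansion.
Variable R : comPzRingType.

Definition fcons (T : Type) (k : nat) (x : T) (g : {ffun 'I_k -> T}) : {ffun 'I_k.+1 -> T} :=
  [ffun u => if unlift ord0 u is Some v then g v else x].

Lemma fcons0 (T : Type) k (x : T) (g : {ffun 'I_k -> T}) : fcons x g ord0 = x.
Proof. by rewrite ffunE unlift_none. Qed.

Lemma fconsS (T : Type) k (x : T) (g : {ffun 'I_k -> T}) u : fcons x g (lift ord0 u) = g u.
Proof. by rewrite ffunE liftK. Qed.

Lemma big_ffun_recl (T : finType) k (F : {ffun 'I_k.+1 -> T} -> R) :
  \sum_f F f = \sum_x \sum_(g : {ffun 'I_k -> T}) F (fcons x g).
Proof.
rewrite pair_big /=.
rewrite (reindex (fun p : T * {ffun 'I_k -> T} => fcons p.1 p.2)) //=.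
exists (fun f : {ffun 'I_k.+1 -> T} => (f ord0, [ffun u => f (lift ord0 u)])).
  by move=> [x g] _ /=; rewrite fcons0; congr pair; apply/ffunP => u; rewrite ffunE fconsS.
move=> f _; apply/ffunP => u; rewrite ffunE /=.
by case: unliftP => [v|] ->; rewrite ?ffunE.
Qed.

Lemma expmx_walks (n k : nat) (A : 'M[R]_n) (i j : 'I_n) :
  (A ^+ k.+1) i j = \sum_(f : {ffun 'I_k.+1 -> 'I_n} | f ord0 == i)
     (\prod_(u < k) A (f (inord u)) (f (inord u.+1))) * A (f (inord k)) j.
Proof.
elim: k i => [|k IH] i.
  rewrite expr1 big_mkcond big_ffun_recl (bigD1 i)//= [X in _ + X]big1 ?addr0; last first.
    by move=> x xi; rewrite big1// => g _; rewrite fcons0 (negbTE xi).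
  have z : inord 0 = ord0 :> 'I_1 by apply/val_inj; rewrite /= inordK.
  under eq_bigr do rewrite big_ord0 mul1r z fcons0 eqxx.
  by rewrite sumr_const card_ffun !card_ord expn0.
rewrite exprS -[_ * _]/(A *m (A ^+ k.+1)) mxE.
under eq_bigr => x _ do rewrite IH mulr_sumr big_mkcond.
rewrite [in RHS]big_mkcond [in RHS]big_ffun_recl [in RHS](bigD1 i)//= [X in _ + X]big1 ?addr0; last first.
  by move=> x xi; rewrite big1// => g _; rewrite fcons0 (negbTE xi).
rewrite exchange_big /=; apply: eq_bigr => g _.
rewrite (bigD1 (g ord0))//= eqxx [X in _ + X]big1 ?addr0; last first.
  by move=> x; rewrite eq_sym => /negbTE ->.
have z m : inord 0 = ord0 :> 'I_m.+1 by apply/val_inj; rewrite /= inordK.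
have s u : (u < k.+1)%N -> inord u.+1 = lift ord0 (inord u : 'I_k.+1) :> 'I_k.+2.
  by move=> uk; apply/val_inj; rewrite /= /bump /= !inordK.
rewrite fcons0 eqxx big_ord_recl /= mulrA z fcons0 s// fconsS z -!mulrA.
congr (_ * _); rewrite s// fconsS; congr (_ * _); apply: eq_bigr => u _.
have uk : (u < k.+1)%N by exact: ltn_trans (ltn_ord u) _.
by rewrite /bump /= add1n !s// ?ltnS// !fconsS.
Qed.

(** The cyclic successor [ordS] closes the walk. The power 0 is excluded: its trace is [n], while
    there is a single empty walk, of weight 1. *)
Lemma trace_expmx_walks (n k : nat) (A : 'M[R]_n) : (0 < k)%N ->
  \tr (A ^+ k) = \sum_(f : {ffun 'I_k -> 'I_n}) \prod_(u < k) A (f u) (f (ordS u)).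
Proof.
case: k => // k _; rewrite /mxtrace.
under eq_bigr do rewrite expmx_walks.
rewrite (exchange_big_dep predT) //=; apply: eq_bigr => f _.
rewrite (bigD1 (f ord0))//= [X in _ + X]big1 ?addr0; last first.
  by move=> i /andP[/eqP ->]; rewrite eqxx.
rewrite big_ord_recr /=; congr (_ * _); last first.
  congr (A (f _) (f _)); apply/val_inj; rewrite /= ?inordK//.
  by rewrite modnn.
apply: eq_bigr => u _; congr (A (f _) (f _)); apply/val_inj; rewrite /= inordK//.
- by rewrite ltnW// ltnS.
- by rewrite modn_small// ltnS.
- by rewrite ltnS.
Qed.

End TraceExpansion.

(** * Families of closed walks and their gluing *)

Section WalkFamilies.
Variables (J : finType) (l : J -> nat).

(** Disjoint union of cycles of lengths [l j]. A labelling of this single finite type is a family of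
    closed walks, one for each [j], and labels can be counted over the whole family at once. *)
Definition vertex : finType := {j : J & 'I_(l j)}.

Definition vnext (v : vertex) : vertex :=
  Tagged (fun j => 'I_(l j)) (ordS (tagged v)).

Definition walk_of (L : Type) (f : {ffun vertex -> L}) (j : J) : {ffun 'I_(l j) -> L} :=
  [ffun u => f (Tagged (fun j => 'I_(l j)) u)].

Lemma tag_iter_vnext i v : tag (iter i vnext v) = tag v.
Proof. by elim: i => //= i ->. Qed.

Lemma vnext_inj : injective vnext.
Proof.
move=> [j u] [j' u'] /eqP; rewrite -tag_eqE /tag_eq /= => /andP[/eqP jj'].
subst j'; rewrite tagged_asE => /eqP /(can_inj (@ordSK _)) /= -> //.
Qed.

Lemma iter_vnext_inj i : injective (iter i vnext).
Proof. by elim: i => // i IH u v /= /vnext_inj /IH. Qed.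

Lemma val_iter_ordS k i (u : 'I_k) : iter i (@ordS k) u = ((u + i) %% k)%N :> nat.
Proof.
elim: i => [|i IH] /=; first by rewrite addn0 modn_small.
by rewrite IH -addn1 modnDml addn1 addnS.
Qed.

Lemma iter_vnext i j (u : 'I_(l j)) :
  iter i vnext (Tagged (fun j => 'I_(l j)) u) =
  Tagged (fun j => 'I_(l j)) (iter i (@ordS _) u).
Proof. by elim: i => //= i ->. Qed.

Lemma vnext_transitive (v v' : vertex) : tag v = tag v' -> exists i, iter i vnext v = v'.
Proof.
case: v v' => j u [j' u'] /= E; subst j'.
(* [l j - u] steps complete the turn back to position 0, and [u'] more reach the target. *)
exists (l j - u + u')%N; rewrite iter_vnext; congr Tagged; apply/val_inj.
rewrite [LHS]val_iter_ordS addnA subnKC; last exact: ltnW.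
by rewrite modnDl modn_small.
Qed.

(** Distributivity when the walks of different lengths have different types: the choices of one walk
    for each [j] form a dependent product [fprod], in bijection with the labellings of [vertex]. *)
Lemma big_distr_walks (R : comPzRingType) (L : finType)
    (F : forall j, {ffun 'I_(l j) -> L} -> R) :
  \prod_j \sum_(g : {ffun 'I_(l j) -> L}) F j g =
  \sum_(f : {ffun vertex -> L}) \prod_j F j (walk_of f j).
Proof.
pose T_ j : finType := {ffun 'I_(l j) -> L}.
transitivity (\sum_(t : fprod T_) \prod_(j in J) [ffun g => F j g] (t j)).
  rewrite (@big_fprod _ _ _ _ _ J T_ (fun j => [ffun g => F j g])).
  rewrite -(bigA_distr_big_dep (fun j => mem (tagged_with T_ j))
    (fun j => untag 0 [ffun g : T_ j => F j g])).
  apply: eq_bigr => j _.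
  rewrite -(big_tag (fun j g => [ffun g => F j g] g) j).
  by apply: eq_bigr => g _; rewrite ffunE.
pose h (f : {ffun vertex -> L}) : fprod T_ := [fprod j => walk_of f j].
have hE f j : h f j = walk_of f j by rewrite fprodE.
rewrite (reindex h) /=; last first.
  exists (fun t : fprod T_ => [ffun v : vertex => (t (tag v) : {ffun _ -> L}) (tagged v)]).
    by move=> f _; apply/ffunP => -[j u]; rewrite ffunE /= hE ffunE.
  move=> t _; apply/fprodP => j; rewrite hE; apply/ffunP => u.
  by rewrite ffunE ffunE.
by apply: eq_bigr => f _; apply: eq_bigr => j _; rewrite ffunE hE.
Qed.

Section Partners.
Variables (L : finType) (f : {ffun vertex -> L}).

Definition edge (v : vertex) : L * L := (f v, f (vnext v)).

Hypothesis edge_twice : forall v, exists2 u, u != v & edge u = edge v.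
Hypothesis card_half : (#|vertex| <= 2 * #|codom f|)%N.

Lemma vertex_twice v : exists2 u, u != v & f u = f v.
Proof. by have [u uv [fuv _]] := edge_twice v; exists u. Qed.

Lemma vertex_pair v u w : u != v -> w != v -> f u = f v -> f w = f v -> u = w.
Proof. exact: (classes_pairs vertex_twice card_half). Qed.

(** Some vertex other than [v] has the same edge as [v], hence the same label; as no label occurs
    three times, it must be [u]. Thus a coincidence of labels propagates along both walks. *)
Lemma vertex_next u v : f u = f v -> f (vnext u) = f (vnext v).
Proof.
have [-> //|uv] := eqVneq u v; move=> fuv.
have [w wv [fwv fwv']] := edge_twice v.
by rewrite (vertex_pair uv wv fuv fwv).
Qed.

Lemma vertex_iter i u v : f u = f v -> f (iter i vnext u) = f (iter i vnext v).
Proof. by move=> fuv; elim: i => //= i IH; exact: vertex_next. Qed.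

(* The walk through [v0] is glued, position by position, to the walk through
   the only other occurrence [u0] of the label of [v0]. *)
Lemma partner_tag v0 u0 u v : u0 != v0 -> f u0 = f v0 ->
  tag v = tag v0 \/ tag v = tag u0 -> f u = f v -> tag u = tag v0 \/ tag u = tag u0.
Proof.
move=> uv0 fuv0.
have step v1 u1 : u1 != v1 -> f u1 = f v1 -> tag v = tag v1 -> f u = f v ->
    tag u = tag v1 \/ tag u = tag u1.
  move=> uv1 fuv1 tv fuv; have [i iv] := vnext_transitive (esym tv).
  have [uv|uv] := eqVneq u v; first by left; rewrite uv.
  have u1v : iter i vnext u1 != v.
    by rewrite -iv; apply: contra uv1 => /eqP /iter_vnext_inj ->.
  right; rewrite (vertex_pair uv u1v fuv) ?tag_iter_vnext//.
  by rewrite -iv; exact: vertex_iter.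
case=> tv fuv; first exact: step tv fuv.
by have [] := step u0 v0 _ _ tv fuv; rewrite 1?eq_sym//; [right|left].
Qed.

End Partners.
End WalkFamilies.

(** * Expectations of products of walks *)

Section RandomWalks.
Context {d : measure_display} {T : measurableType d} {R : realType}.
Variables (P : probability T R) (X : nat -> nat -> {RV P >-> R}).

Definition walk_weight n k (g : {ffun 'I_k -> 'I_n}) (w : T) : R :=
  \prod_(u < k) X (g u) (g (ordS u)) w.

Definition centered_weight n k (g : {ffun 'I_k -> 'I_n}) (w : T) : R :=
  walk_weight g w - mean P (walk_weight g).

Variable B : nat -> R.
Hypothesis X_moments : forall i j, moments_le P B (X i j).

Definition weight_bound k : nat -> R := bound_prod B (size (index_enum 'I_k)).

Definition centered_bound k : nat -> R :=
  boundD (weight_bound k) (fun p => weight_bound k 1 ^+ p).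

Lemma walk_weight_moments n k (g : {ffun 'I_k -> 'I_n}) :
  moments_le P (weight_bound k) (walk_weight g).
Proof. by apply: moments_le_prod => u; exact: X_moments. Qed.

Lemma centered_weight_moments n k (g : {ffun 'I_k -> 'I_n}) :
  moments_le P (centered_bound k) (centered_weight g).
Proof.
have Bg := walk_weight_moments g.
apply: (moments_leD Bg); apply: moments_leW (moments_le_cst P (- mean P (walk_weight g))).
move=> p; rewrite normrN lerXn2r ?nnegrE//; first exact: moments_le_ge0 Bg.
exact: normr_mean_le.
Qed.

Lemma all_moments_walk_weight n k (g : {ffun 'I_k -> 'I_n}) :
  all_moments P (walk_weight g).
Proof. by exists (weight_bound k); exact: walk_weight_moments. Qed.

Lemma all_moments_centered_weight n k (g : {ffun 'I_k -> 'I_n}) :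
  all_moments P (centered_weight g).
Proof. by exists (centered_bound k); exact: centered_weight_moments. Qed.

Lemma mean_centered_weight n k (g : {ffun 'I_k -> 'I_n}) :
  mean P (centered_weight g) = 0.
Proof.
rewrite /centered_weight meanB ?mean_cst ?subrr//; first exact: all_moments_walk_weight.
exact: all_moments_cst.
Qed.

Lemma tr_powerE n k w : (0 < k)%N ->
  tr_power X n k w =
  (Num.sqrt n%:R ^- k) * \sum_(g : {ffun 'I_k -> 'I_n}) walk_weight g w.
Proof.
move=> k0; rewrite /tr_power trace_expmx_walks// mulr_sumr; apply: eq_bigr => g _.
under eq_bigr do rewrite mxE.
by rewrite big_split /= mulrC prodr_const card_ord -exprVn.
Qed.

Lemma centered_tr_powerE n k w : (0 < k)%N ->
  centered_tr_power X n k w =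
  (Num.sqrt n%:R ^- k) * \sum_(g : {ffun 'I_k -> 'I_n}) centered_weight g w.
Proof.
move=> k0; rewrite /centered_tr_power fine_expectation tr_powerE//.
have -> : tr_power X n k = fun w => (Num.sqrt n%:R ^- k) *
    \sum_(g : {ffun 'I_k -> 'I_n}) walk_weight g w.
  by apply/funext => w'; exact: tr_powerE.
rewrite meanZ; last by apply: all_moments_sum => g _; exact: all_moments_walk_weight.
rewrite mean_sum; last by move=> g _; exact: all_moments_walk_weight.
by rewrite -mulrBr -sumrB.
Qed.

Lemma all_moments_centered_tr_power n k : (0 < k)%N ->
  all_moments P (centered_tr_power X n k).
Proof.
move=> k0.
have -> : centered_tr_power X n k = fun w => (Num.sqrt n%:R ^- k) *
    \sum_(g : {ffun 'I_k -> 'I_n}) centered_weight g w.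
  by apply/funext => w'; exact: centered_tr_powerE.
apply: all_momentsZ; apply: all_moments_sum => g _; exact: all_moments_centered_weight.
Qed.

Lemma depends_on_centered_weight (E : seq (nat * nat)) n k (g : {ffun 'I_k -> 'I_n}) :
  (forall u, (g u : nat, g (ordS u) : nat) \in E) ->
  depends_on (fun e : nat * nat => X e.1 e.2) E (centered_weight g).
Proof.
move=> gE; apply: depends_onD; last exact: depends_on_cst.
apply: depends_on_prod => u _.
exact: (@depends_on_X _ _ _ _ _ (fun e : nat * nat => X e.1 e.2) E _ (gE u)).
Qed.

Section Families.
Variables (J : finType) (l : J -> nat).
Notation V := (vertex l).

Definition family_weight n (S : pred J) (f : {ffun V -> 'I_n}) (w : T) : R :=
  \prod_(j | S j) centered_weight (walk_of f j) w.

(** The summand [1] covers the walks outside [S], replaced by the constant factor 1, so that one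
    bound serves all subfamilies. *)
Definition family_bound : nat -> R :=
  bound_prod (fun p => 1 + \sum_j centered_bound (l j) p) (size (index_enum J)).

Lemma family_weight_moments n S (f : {ffun V -> 'I_n}) :
  moments_le P family_bound (family_weight S f).
Proof.
have c0 j p : 0 <= centered_bound (l j) p.
  have [n0|n0] := posnP n; last first.
    case: n f n0 => // n f _.
    exact: moments_le_ge0 (centered_weight_moments [ffun=> ord0 : 'I_n.+1]).
  exact: moments_le_ge0 (centered_weight_moments [ffun=> ord0 : 'I_1]).
have -> : family_weight S f = fun w => \prod_j (if S j then centered_weight (walk_of f j) else cst 1) w.
  by apply/funext => w; rewrite /family_weight big_mkcond; apply: eq_bigr => j _; case: ifP.
apply: (@moments_le_prod _ _ _ P _ _ _ (fun j => if S j then centered_weight (walk_of f j) else cst 1)) => j.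
case: ifP => _.
  apply: moments_leW (centered_weight_moments _) => p.
  by rewrite (bigD1 j)//= addrCA lerDl addr_ge0// sumr_ge0.
apply: moments_leW (moments_le_cst P 1) => p.
by rewrite normr1 expr1n lerDl sumr_ge0.
Qed.

Lemma all_moments_family_weight n S (f : {ffun V -> 'I_n}) :
  all_moments P (family_weight S f).
Proof. by exists family_bound; exact: family_weight_moments. Qed.

Lemma mean_family_weight_le n S (f : {ffun V -> 'I_n}) :
  `|mean P (family_weight S f)| <= family_bound 1.
Proof. exact: normr_mean_le (family_weight_moments _ _). Qed.

Definition nat_edge n (f : {ffun V -> 'I_n}) (v : V) : nat * nat :=
  (f v : nat, f (vnext v) : nat).

Lemma nat_edgeE n (f : {ffun V -> 'I_n}) u v :
  nat_edge f u = nat_edge f v -> edge f u = edge f v.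
Proof. by move=> [/val_inj H1 /val_inj H2]; rewrite /edge H1 H2. Qed.

Lemma depends_on_family_weight (E : seq (nat * nat)) n (S : pred J) (f : {ffun V -> 'I_n}) :
  (forall v, S (tag v) -> nat_edge f v \in E) ->
  depends_on (fun e : nat * nat => X e.1 e.2) E (family_weight S f).
Proof.
move=> SE; apply: depends_on_prod => j Sj; apply: depends_on_centered_weight => u.
by have := SE (Tagged (fun j => 'I_(l j)) u) Sj; rewrite /nat_edge !ffunE.
Qed.

Hypothesis X_indep : mutually_independent (fun e : nat * nat => X e.1 e.2).

(** Subfamilies without a common edge involve disjoint sets of matrix entries. *)
Lemma mean_family_weightM n (S S' : pred J) (f : {ffun V -> 'I_n}) :
  (forall u v, S (tag u) -> S' (tag v) -> edge f u <> edge f v) ->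
  mean P (fun w => family_weight S f w * family_weight S' f w) =
  mean P (family_weight S f) * mean P (family_weight S' f).
Proof.
move=> dis.
pose ES (S : pred J) := [seq nat_edge f v | v <- enum V & S (tag v)].
have memES (Q : pred J) v : Q (tag v) -> nat_edge f v \in ES Q.
  by move=> Qv; apply: map_f; rewrite mem_filter Qv mem_enum.
apply: (mean_depends_on_M (E1 := ES S) (E2 := ES S') X_indep).
- move=> e /mapP[u]; rewrite mem_filter => /andP[Su _] ->.
  apply/negP => /mapP[v]; rewrite mem_filter => /andP[Sv _] /nat_edgeE.
  exact: dis.
- by apply: depends_on_family_weight => v; exact: memES.
- by apply: depends_on_family_weight => v; exact: memES.
- exact: all_moments_family_weight.
- exact: all_moments_family_weight.
Qed.

Hypothesis X_mean : forall i j, mean P (X i j) = 0.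

(** The entry on the lonely edge has mean 0 and is independent of all the other factors. Centering
    does not interfere: the weight of the walk through that edge already has mean 0, so its centered
    version is the same product and the entry factors out. *)
Lemma mean_family_weight_lonely_edge n (S : pred J) (f : {ffun V -> 'I_n}) v :
  S (tag v) -> (forall u, u != v -> edge f u <> edge f v) ->
  mean P (family_weight S f) = 0.
Proof.
case: v => j u /= Sj lonely.
pose v : V := Tagged (fun j => 'I_(l j)) u.
pose e := nat_edge f v.
pose E' := [seq nat_edge f v' | v' <- enum V & v' != v].
pose g := walk_of f j.
pose M w := \prod_(u' < l j | u' != u) X (g u') (g (ordS u')) w.
have memE' v' : v' != v -> nat_edge f v' \in E'.
  by move=> v'v; apply: map_f; rewrite mem_filter v'v mem_enum.
have disE : {in [:: e], forall i, i \notin E'}.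
  move=> i; rewrite inE => /eqP ->; apply/negP => /mapP[v'].
  rewrite mem_filter => /andP[v'v _] /nat_edgeE /esym; exact: lonely.
have dX : depends_on (fun e : nat * nat => X e.1 e.2) [:: e] (X e.1 e.2).
  by apply: (@depends_on_X _ _ _ _ _ (fun e : nat * nat => X e.1 e.2)); rewrite inE.
have aX : all_moments P (X e.1 e.2) by exists B; exact: X_moments.
have aM : all_moments P M.
  by apply: all_moments_prod => u' _; exists B; exact: X_moments.
have dM : depends_on (fun e : nat * nat => X e.1 e.2) E' M.
  apply: depends_on_prod => u' u'u.
  apply: (@depends_on_X _ _ _ _ _ (fun e : nat * nat => X e.1 e.2) E'
    (g u' : nat, g (ordS u') : nat)).
  have := memE' (Tagged (fun j => 'I_(l j)) u'); rewrite /nat_edge !ffunE; apply.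
  by apply: contra u'u; rewrite -tag_eqE /tag_eq /= eqxx tagged_asE.
have gE : walk_weight g = fun w => X e.1 e.2 w * M w.
  by apply/funext => w; rewrite /walk_weight (bigD1 u)//= /e /= /g !ffunE.
have g0 : mean P (walk_weight g) = 0.
  by rewrite gE (mean_depends_on_M X_indep disE)// X_mean mul0r.
pose Q w := \prod_(i | S i && (i != j)) centered_weight (walk_of f i) w.
have -> : family_weight S f = fun w => X e.1 e.2 w * (M w * Q w).
  apply/funext => w; rewrite /family_weight (bigD1 j)//= -/(Q w) mulrA.
  by rewrite /centered_weight -/g g0 subr0 gE.
rewrite (mean_depends_on_M X_indep disE) ?X_mean ?mul0r//.
- apply: depends_onM => //.
  apply: depends_on_family_weight => v' /andP[_ v'j]; apply: memE'.
  by apply: contra v'j => /eqP ->.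
- by apply: all_momentsM => //; exact: all_moments_family_weight.
Qed.

End Families.
End RandomWalks.

(** * Wick recursion for the mixed moments of traces *)

Section WickRecursion.
Context {d : measure_display} {T : measurableType d} {R : realType}.
Variables (P : probability T R) (X : nat -> nat -> {RV P >-> R}).
Variable B : nat -> R.
Hypothesis X_moments : forall i j, moments_le P B (X i j).
Hypothesis X_indep : mutually_independent (fun e : nat * nat => X e.1 e.2).
Hypothesis X_mean : forall i j, mean P (X i j) = 0.

Variables (J : finType) (l : J -> nat).
Hypothesis l_gt0 : forall j, (0 < l j)%N.
Notation V := (vertex l).
Notation Pi := (family_weight X).

Lemma mean_family_weight1 n (f : {ffun V -> 'I_n}) (S : pred J) j :
  S =1 pred1 j -> mean P (Pi S f) = 0.
Proof.
move=> Sj; rewrite (_ : Pi S f = centered_weight X (walk_of f j)).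
  exact: (mean_centered_weight X_moments).
by apply/funext => w; rewrite /family_weight (eq_bigl _ _ Sj) big_pred1_eq.
Qed.

Lemma mean_pair_disjoint n (f : {ffun V -> 'I_n}) j0 j : j != j0 ->
  (forall u v, tag u = j0 -> tag v = j -> f u <> f v) ->
  mean P (Pi (pred2 j0 j) f) = 0.
Proof.
move=> jj0 dis.
have -> : Pi (pred2 j0 j) f = fun w => Pi (pred1 j0) f w * Pi (pred1 j) f w.
  apply/funext => w; rewrite /family_weight (bigD1 j0)/= ?eqxx// !big_pred1_eq.
  congr (_ * _); rewrite (eq_bigl (pred1 j)) ?big_pred1_eq// => i /=.
  have [->|_] := eqVneq i j0; last by rewrite andbT.
  by rewrite andbF [j0 == j]eq_sym (negbTE jj0).
rewrite (mean_family_weightM X_moments X_indep).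
  by rewrite (@mean_family_weight1 _ f _ j0)// mul0r.
by move=> u v /eqP tu /eqP tv [/(dis u v tu tv)].
Qed.

Lemma edge_dichotomy n (f : {ffun V -> 'I_n}) :
  (exists v, forall u, u != v -> edge f u <> edge f v) \/
  (forall v, exists2 u, u != v & edge f u = edge f v).
Proof.
have [|none] := pselect (exists v, forall u, u != v -> edge f u <> edge f v); first by left.
right=> v; apply: contrapT => nv; apply: none; exists v => u uv euv; apply: nv; exists u => //.
Qed.

(** Either some edge is lonely; it stays lonely inside whichever subfamily contains it, and all
    terms vanish. Or all edges are repeated, and [j0] shares labels with at most one other walk
    [j1]: the pair splits off by independence, and for any other [j] the walks [j0] and [j] are
    independent and centered. *)
Lemma mean_family_weight_wick n (f : {ffun V -> 'I_n}) j0 :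
  (#|V| <= 2 * #|codom f|)%N ->
  mean P (Pi predT f) =
  \sum_(j | j != j0) mean P (Pi (pred2 j0 j) f) * mean P (Pi (predC (pred2 j0 j)) f).
Proof.
move=> half; have [[v lonely]|twice] := edge_dichotomy f.
  rewrite (mean_family_weight_lonely_edge X_moments X_indep X_mean (v := v))//.
  rewrite big1// => j jj0.
  have [Sv|Sv] := boolP (pred2 j0 j (tag v)).
    by rewrite (mean_family_weight_lonely_edge X_moments X_indep X_mean (v := v))// mul0r.
  by rewrite mulrC (mean_family_weight_lonely_edge X_moments X_indep X_mean (v := v))// mul0r.
pose v0 : V := Tagged (fun j => 'I_(l j)) (Ordinal (l_gt0 j0)).
have [u0 uv0 fuv0] := vertex_twice twice v0.
have close := partner_tag twice half uv0 fuv0.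
pose j1 := tag u0.
have split : mean P (Pi predT f) =
    mean P (Pi (pred2 j0 j1) f) * mean P (Pi (predC (pred2 j0 j1)) f).
  rewrite -(mean_family_weightM X_moments X_indep); last first.
    move=> u v Su Sv [fuv _].
    have tu : tag u = tag v0 \/ tag u = tag u0.
      by case/orP: Su => /eqP ->; [left|right].
    have [tv|tv] := close v u tu (esym fuv).
    - by move: Sv; rewrite /= tv eqxx.
    - by move: Sv; rewrite /= tv eqxx orbT.
  congr (mean P _); apply/funext => w; rewrite /family_weight.
  by rewrite (bigID (pred2 j0 j1)).
have zero j : j != j0 -> j != j1 -> mean P (Pi (pred2 j0 j) f) = 0.
  move=> jj0 jj1; apply: mean_pair_disjoint => // u v tu tv fuv.
  have [] := close v u (or_introl tu) (esym fuv); rewrite tv.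
    by move=> /eqP; rewrite (negbTE jj0).
  by move=> /eqP; rewrite (negbTE jj1).
(* A walk [j0] glued to itself shares no label with the others, so its vanishing mean kills both
   sides. *)
rewrite split; have [j10|j10] := eqVneq j1 j0.
  rewrite (@mean_family_weight1 _ f _ j0) ?mul0r; last by move=> i /=; rewrite j10 orbb.
  by rewrite big1// => j jj0; rewrite zero ?mul0r// j10.
by rewrite (bigD1 j1)//= big1 ?addr0// => j /andP[jj0 jj1]; rewrite zero ?mul0r.
Qed.

Lemma card_vertex : #|V| = (\sum_j l j)%N.
Proof. by rewrite card_tagged sumnE big_map big_enum; apply: eq_bigr => j _; rewrite card_ord. Qed.

(** With two sample points, a product of two expectations can be expanded over the same labellings
    [f] as a single expectation: the walks in [S] are read at [w1], the others at [w2], and each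
    point is integrated separately. *)
Lemma prod_tr_power_walks n (S : pred J) w1 w2 :
  \prod_(j | S j) centered_tr_power X n (l j) w1 *
  \prod_(j | ~~ S j) centered_tr_power X n (l j) w2 =
  Num.sqrt n%:R ^- #|V| *
  \sum_(f : {ffun V -> 'I_n}) Pi S f w1 * Pi (predC S) f w2.
Proof.
transitivity (\prod_j centered_tr_power X n (l j) (if S j then w1 else w2)).
  rewrite [RHS](bigID S) /=; congr (_ * _); apply: eq_bigr => j; first by move=> ->.
  by move=> /negbTE ->.
under eq_bigr do rewrite (centered_tr_powerE X_moments)//.
rewrite big_split /= card_vertex; congr (_ * _).
  rewrite -exprVn -prodrXr; apply: eq_bigr => j _; by rewrite exprVn.
rewrite (big_distr_walks (fun j (g : {ffun 'I_(l j) -> 'I_n}) =>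
  centered_weight X g (if S j then w1 else w2))).
apply: eq_bigr => f _; rewrite (bigID S) /=.
congr (_ * _); apply: eq_bigr => j; first by move=> ->.
by move=> /negbTE ->.
Qed.

(** For [S := predT] the second factor is 1, and this expands a single expectation. *)
Lemma mean_prod_tr_power_walks n (S : pred J) :
  mean P (fun w => \prod_(j | S j) centered_tr_power X n (l j) w) *
  mean P (fun w => \prod_(j | ~~ S j) centered_tr_power X n (l j) w) =
  Num.sqrt n%:R ^- #|V| *
  \sum_(f : {ffun V -> 'I_n}) mean P (Pi S f) * mean P (Pi (predC S) f).
Proof.
have aPi (S' : pred J) f := all_moments_family_weight (n := n) X_moments S' f.
have aW (S' : pred J) : all_moments P
    (fun w => \prod_(j | S' j) centered_tr_power X n (l j) w).
  by apply: all_moments_prod => j _; apply: (all_moments_centered_tr_power X_moments).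
have step w1 : \prod_(j | S j) centered_tr_power X n (l j) w1 *
    mean P (fun w => \prod_(j | ~~ S j) centered_tr_power X n (l j) w) =
    Num.sqrt n%:R ^- #|V| *
    \sum_(f : {ffun V -> 'I_n}) Pi S f w1 * mean P (Pi (predC S) f).
  rewrite -meanZ; last exact: (aW (fun j => ~~ S j)).
  have -> : (fun w => \prod_(j | S j) centered_tr_power X n (l j) w1 *
      \prod_(j | ~~ S j) centered_tr_power X n (l j) w) =
      fun w => Num.sqrt n%:R ^- #|V| *
      \sum_(f : {ffun V -> 'I_n}) Pi S f w1 * Pi (predC S) f w.
    by apply/funext => w; exact: prod_tr_power_walks.
  rewrite meanZ; last by apply: all_moments_sum => f _; exact: all_momentsZ.
  rewrite mean_sum; last by move=> f _; exact: all_momentsZ.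
  by congr (_ * _); apply: eq_bigr => f _; rewrite meanZ.
rewrite mulrC -meanZ//.
have -> : (fun w => mean P (fun w => \prod_(j | ~~ S j) centered_tr_power X n (l j) w) *
     \prod_(j | S j) centered_tr_power X n (l j) w) =
     fun w => Num.sqrt n%:R ^- #|V| *
    \sum_(f : {ffun V -> 'I_n}) mean P (Pi (predC S) f) * Pi S f w.
  apply/funext => w; rewrite mulrC step; congr (_ * _).
  by apply: eq_bigr => f _; rewrite mulrC.
rewrite meanZ; last by apply: all_moments_sum => f _; exact: all_momentsZ.
rewrite mean_sum; last by move=> f _; exact: all_momentsZ.
by congr (_ * _); apply: eq_bigr => f _; rewrite meanZ// mulrC.
Qed.

(** Only labellings with at most [r] labels contribute, where [r] is the largest integer with
    [2 * r < #|V|]. They number [O(n ^ r)], and the normalization leaves [n] to the power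
    [r - #|V| / 2], which is at most [-1/2]. *)
Lemma sum_small_image_le (C : R) n (D : {ffun V -> 'I_n} -> R) (j0 : J) :
  0 <= C -> (0 < n)%N -> (forall f, `|D f| <= C) ->
  (forall f : {ffun V -> 'I_n}, (#|V| <= 2 * #|codom f|)%N -> D f = 0) ->
  `|Num.sqrt n%:R ^- #|V| * \sum_f D f| <=
    C * (#|V| ^ #|V| * #|V|)%:R / Num.sqrt n%:R.
Proof.
move=> C0 n0 DC D0; have V0 : (0 < #|V|)%N.
  by rewrite card_vertex (bigD1 j0)//= ltn_addr.
set r := (#|V|.-1)./2.
have rV : (2 * r < #|V|)%N.
  rewrite /r; case: #|V| V0 => // N _ /=.
  by rewrite ltnS mul2n -[X in (_ <= X)%N]odd_double_half leq_addl.
have n0R : (0 : R) < n%:R by rewrite ltr0n.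
set s : R := Num.sqrt n%:R; have s0 : 0 < s by rewrite sqrtr_gt0.
have s1 : 1 <= s by rewrite -sqrtr1 ler_wsqrtr// ler1n.
have sumD : `|\sum_f D f| <= C * (#|V| ^ #|V| * #|V|)%:R * n%:R ^+ r.
  have small f : D f != 0 -> f \in
      finset (fun f : {ffun V -> 'I_n} => (#|codom f| <= r)%N && [exists u, (f u < n)%N]).
    move=> Df; rewrite inE; apply/andP; split; last first.
      have /card_gt0P[u _] := V0.
      by apply/existsP; exists u; exact: ltn_ord.
    have : (2 * #|codom f| < #|V|)%N by rewrite ltnNge; apply: contra Df => /D0 ->.
    rewrite /r; case: #|V| V0 => // N _; rewrite ltnS /= mul2n => H.
    by rewrite -[X in (X <= _)%N]doubleK; exact: half_leq.
  apply: le_trans (ler_norm_sum _ _ _) _.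
  apply: (@le_trans _ _ (\sum_(f in finset (fun f : {ffun V -> 'I_n} =>
      (#|codom f| <= r)%N && [exists u, (f u < n)%N])) C)).
    rewrite [leRHS]big_mkcond; apply: ler_sum => f _; case: ifP => // /negbT fn.
    by rewrite (_ : D f = 0) ?normr0//; apply/eqP; apply: contraNT fn => /small.
  rewrite sumr_const -[C *+ _]mulr_natr -mulrA ler_wpM2l// -natrX -natrM ler_nat.
  apply: leq_trans (card_ffun_small_image _ _ _ _) _.
  case: r rV small => [|r] rV small; first by rewrite mul0n muln0.
  have rV' : (r.+1 <= #|V|)%N by move: rV; move: #|V| => N; lia.
  rewrite -mulnA; apply: leq_mul => //=; first by rewrite leq_exp2r.
  by rewrite -expnS leq_mul.
rewrite normrM ger0_norm; last by rewrite invr_ge0 exprn_ge0// ltW.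
rewrite mulrC ler_pdivrMr ?exprn_gt0//; apply: le_trans sumD _.
rewrite -[leRHS]mulrA ler_wpM2l ?mulr_ge0//.
have -> : n%:R = s ^+ 2 :> R by rewrite sqr_sqrtr// ltW.
rewrite -exprM -(subnKC rV) addSn exprS mulKf ?gt_eqF// exprD.
by rewrite ler_peMr ?exprn_ge0 ?(ltW s0)// exprn_ege1.
Qed.

(** The moment and the products of moments expand over the same labellings with the same
    normalization, so the difference is a sum of defects of the Wick identity. These are bounded by
    [b + #|J| * b ^ 2] and vanish for labellings with many labels. *)
Lemma wick_recursion j0 : exists C : R, forall n, (0 < n)%N ->
  `|mean P (fun w => \prod_j centered_tr_power X n (l j) w) -
    \sum_(j | j != j0)
      mean P (fun w => centered_tr_power X n (l j0) w * centered_tr_power X n (l j) w) *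
      mean P (fun w => \prod_(i | (i != j0) && (i != j)) centered_tr_power X n (l i) w)|
  <= C / Num.sqrt n%:R.
Proof.
pose b := family_bound B l 1.
have b0 : 0 <= b.
  have f : {ffun V -> 'I_1} by exact: [ffun=> ord0].
  exact: moments_le_ge0 (family_weight_moments X_moments predT f).
exists ((b + #|J|%:R * (b * b)) * (#|V| ^ #|V| * #|V|)%:R) => n n0.
pose D (f : {ffun V -> 'I_n}) := mean P (Pi predT f) -
  \sum_(j | j != j0) mean P (Pi (pred2 j0 j) f) * mean P (Pi (predC (pred2 j0 j)) f).
apply: le_trans (sum_small_image_le j0 _ n0 (D := D) _ _); last 3 first.
- by rewrite addr_ge0// !mulr_ge0.
- move=> f; rewrite /D; apply: le_trans (ler_normB _ _) _.
  apply: lerD; first exact: mean_family_weight_le.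
  apply: le_trans (ler_norm_sum _ _ _) _.
  apply: (@le_trans _ _ (\sum_(j | j != j0) b * b)).
    apply: ler_sum => j _; rewrite normrM.
    by apply: ler_pM => //; exact: mean_family_weight_le.
  rewrite sumr_const -[b * b *+ _]mulr_natl ler_wpM2r ?mulr_ge0// ler_nat; exact: max_card.
- by move=> f half; rewrite /D (mean_family_weight_wick j0 half) subrr.
rewrite le_eqVlt; apply/orP; left; apply/eqP; congr `|_|.
rewrite /D sumrB mulrBr; congr (_ - _).
  transitivity (mean P (fun w => \prod_(j | predT j) centered_tr_power X n (l j) w) *
     mean P (fun w => \prod_(j | ~~ predT j) centered_tr_power X n (l j) w)).
    rewrite [X in _ = _ * X](_ : _ = 1) ?mulr1//.
    rewrite -[RHS](mean_cst P 1); congr (mean P _); apply/funext => w.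
    by rewrite big_pred0.
  rewrite mean_prod_tr_power_walks; congr (_ * _); apply: eq_bigr => f _.
  rewrite [X in _ * X](_ : _ = 1) ?mulr1//.
  rewrite -[RHS](mean_cst P 1); congr (mean P _); apply/funext => w.
  by rewrite /family_weight big_pred0.
rewrite exchange_big /= mulr_sumr; apply: eq_bigr => j jj0.
rewrite -mean_prod_tr_power_walks; congr (mean P _ * mean P _); apply/funext => w.
  rewrite [RHS](bigD1 j0) /= ?eqxx//; congr (_ * _).
  rewrite (eq_bigl (pred1 j)) ?big_pred1_eq// => i /=.
  have [->|_] := eqVneq i j0; last by rewrite andbT.
  by rewrite andbF [j0 == j]eq_sym (negbTE jj0).
by apply: eq_bigl => i /=; rewrite negb_or.
Qed.

End WickRecursion.

(** * Covariance of two traces *)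

Section Rotations.
Context {d : measure_display} {T : measurableType d} {R : realType}.
Variables (P : probability T R) (X : nat -> nat -> {RV P >-> R}).
Variable B : nat -> R.
Hypothesis X_moments : forall i j, moments_le P B (X i j).
Hypothesis X_indep : mutually_independent (fun e : nat * nat => X e.1 e.2).
Hypothesis X_mean : forall i j, mean P (X i j) = 0.
Hypothesis X_var : forall i j, mean P (fun w => X i j w ^+ 2) = 1.

(** Let [u1] and [v1] share a label, and make from [u1] as many steps as the walk of [v1] is long.
    The label is again that of [v1], and the vertex reached lies in another walk than [v1], so it is
    [u1] itself. Hence the length of the walk of [u1] divides that of [v1], and conversely by
    symmetry. *)
Lemma partner_size (J : finType) (l : J -> nat) (L : finType) (f : {ffun vertex l -> L})
    (u0 v0 : vertex l) :
  (forall v, exists2 u, u != v & edge f u = edge f v) ->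
  (#|vertex l| <= 2 * #|codom f|)%N -> tag u0 != tag v0 -> f u0 = f v0 ->
  l (tag u0) = l (tag v0).
Proof.
move=> twice half tuv fuv.
have dvd u1 v1 : tag u1 != tag v1 -> f u1 = f v1 -> (l (tag u1) %| l (tag v1))%N.
  move=> t1 f1.
  have Nuv : u1 != v1 by apply: contra t1 => /eqP ->.
  have per (v : vertex l) : iter (l (tag v)) (@vnext _ l) v = v.
    case: v => j u; rewrite iter_vnext /=; congr Tagged; apply/val_inj.
    by rewrite [LHS]val_iter_ordS modnDr modn_small.
  pose u2 := iter (l (tag v1)) (@vnext _ l) u1.
  have f2 : f u2 = f v1 by rewrite -(per v1); exact: vertex_iter.
  have u2v1 : u2 != v1.
    by apply: contra t1 => /eqP <-; rewrite tag_iter_vnext.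
  have := vertex_pair twice half u2v1 Nuv f2 f1; rewrite /u2.
  case: u1 {t1 f1 Nuv u2 f2 u2v1} => j u /=; rewrite iter_vnext => /eqP.
  rewrite -tag_eqE /tag_eq /= eqxx tagged_asE => /eqP /(congr1 val) /= H.
  have E := val_iter_ordS (l (tag v1)) u; rewrite H in E.
  have : (u + l (tag v1) == u + 0 %[mod l j])%N by rewrite addn0 -E modn_small.
  by rewrite eqn_modDl mod0n.
by apply/eqP; rewrite eqn_dvd !dvd// 1?eq_sym.
Qed.

Lemma mean_pair_neq (n k1 k2 : nat) (f : {ffun vertex (fun b : bool => if b then k1 else k2) -> 'I_n}) :
  (0 < k1)%N -> k1 != k2 ->
  (#|vertex (fun b : bool => if b then k1 else k2)| <= 2 * #|codom f|)%N ->
  mean P (family_weight X predT f) = 0.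
Proof.
move=> k10 k12 half; have [[v lonely]|twice] := edge_dichotomy f.
  exact: (mean_family_weight_lonely_edge X_moments X_indep X_mean (v := v)).
set l := (fun b : bool => _) in f half twice *.
rewrite (_ : family_weight X predT f = family_weight X (pred2 true false) f); last first.
  by apply/funext => w; apply: eq_bigl; case.
apply: (mean_pair_disjoint X_moments X_indep) => // u v tu tv fuv.
have := partner_size twice half _ fuv; rewrite tu tv => /(_ isT) /= E.
by move: k12; rewrite E eqxx.
Qed.

Definition rotate_walk (L : Type) k (r : nat) (g : {ffun 'I_k -> L}) : {ffun 'I_k -> L} :=
  [ffun u => g (iter r (@ordS k) u)].

Lemma injective_walk_edges n k (g : {ffun 'I_k -> 'I_n}) : injective g ->
  uniq [seq (g u : nat, g (ordS u) : nat) | u <- enum 'I_k].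
Proof. by move=> ig; rewrite map_inj_uniq ?enum_uniq// => u v [/val_inj /ig]. Qed.

Lemma mean_injective_weight n k (g : {ffun 'I_k -> 'I_n}) (h : R -> R) :
  injective g -> measurable_fun setT h -> (forall i j, all_moments P (h \o X i j)) ->
  mean P (fun w => \prod_(u < k) h (X (g u) (g (ordS u)) w)) =
  \prod_(u < k) mean P (h \o X (g u) (g (ordS u))).
Proof.
move=> ig mh ah.
have := mean_prod_distinct X_indep mh (fun e => ah e.1 e.2) (injective_walk_edges ig).
rewrite big_map big_enum /= => <-; congr (mean P _); apply/funext => w.
by rewrite big_map big_enum.
Qed.

(** A rotation runs through the same edges, so both weights are equal and their product is that of
    the squares of [k] distinct, hence independent, entries. *)
Lemma mean_rotated_pair n k (r : nat) (g : {ffun 'I_k -> 'I_n}) : (0 < k)%N ->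
  injective g ->
  mean P (fun w => centered_weight X g w * centered_weight X (rotate_walk r g) w) = 1.
Proof.
move=> k0 ig.
have aX i j : all_moments P (X i j) by exists B; exact: X_moments.
have wr w : walk_weight X (rotate_walk r g) w = walk_weight X g w.
  rewrite /walk_weight [RHS](reindex_inj (h := iter r (@ordS k))) /=; last first.
    by elim: r => // r IH u v /= /(can_inj (@ordSK _)) /IH.
  by apply: eq_bigr => u _; rewrite !ffunE -iterSr.
have g0 : mean P (walk_weight X g) = 0.
  rewrite /walk_weight (mean_injective_weight (h := id))//.
  rewrite (eq_bigr (fun=> 0)); last by move=> u _; exact: X_mean.
  by rewrite prodr_const card_ord expr0n gtn_eqF.
have gr0 : mean P (walk_weight X (rotate_walk r g)) = 0.
  by rewrite -g0; congr (mean P _); apply/funext => w.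
rewrite /centered_weight g0 gr0.
have -> : (fun w => (walk_weight X g w - 0) * (walk_weight X (rotate_walk r g) w - 0)) =
    fun w => \prod_(u < k) X (g u) (g (ordS u)) w ^+ 2.
  by apply/funext => w; rewrite !subr0 wr -expr2 -prodrXl.
rewrite (mean_injective_weight (h := fun x => x ^+ 2))//.
  by rewrite big1// => u _; exact: X_var.
by move=> i j; exact: all_momentsX.
Qed.

Section EqualLengths.
Variable k : nat.
Hypothesis k_gt0 : (0 < k)%N.
Let l (b : bool) := k.

Definition rotated_pair (L : finType) (f : {ffun vertex l -> L}) : bool :=
  injectiveb (walk_of f true) &&
  [exists r : 'I_k, walk_of f false == rotate_walk r (walk_of f true)].

Lemma family_weight_pair n (f : {ffun vertex l -> 'I_n}) :
  family_weight X predT f = fun w =>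
    centered_weight X (walk_of f true) w * centered_weight X (walk_of f false) w.
Proof. by apply/funext => w; rewrite /family_weight big_bool. Qed.

Lemma mean_rotated n (f : {ffun vertex l -> 'I_n}) : rotated_pair f ->
  mean P (family_weight X predT f) = 1.
Proof.
move=> /andP[/injectiveP fi /existsP[r /eqP fr]].
by rewrite family_weight_pair fr; exact: mean_rotated_pair.
Qed.

(** Two walks without a common label are independent and centered. If they share one while all edges
    are repeated and no label occurs three times, the gluing makes the pair rotated. *)
Lemma mean_not_rotated n (f : {ffun vertex l -> 'I_n}) :
  (#|vertex l| <= 2 * #|codom f|)%N -> ~~ rotated_pair f ->
  mean P (family_weight X predT f) = 0.
Proof.
move=> half; have [[v lonely]|twice] := edge_dichotomy f.
  by rewrite (mean_family_weight_lonely_edge X_moments X_indep X_mean (v := v)).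
move=> nrot.
rewrite (_ : family_weight X predT f = family_weight X (pred2 true false) f); last first.
  by apply/funext => w; apply: eq_bigl; case.
apply: (mean_pair_disjoint X_moments X_indep) => // u0 v0 tu tv fuv.
move/negP: nrot; apply; apply/andP; split.
  (* A label repeated inside the first walk would occur a third time in the second one, to which
     every position of the first is glued. *)
  apply/injectiveP => u v; rewrite !ffunE => uv; apply/eqP/negPn/negP => Nuv.
  pose tg w : vertex l := Tagged (fun=> 'I_k) (w : 'I_k).
  have tgN : tg true u != tg true v.
    by apply: contra Nuv; rewrite -tag_eqE /tag_eq /= tagged_asE.
  have [i iu] := @vnext_transitive _ l u0 (tg true v) tu.
  have Nw : iter i (@vnext _ l) v0 != tg true v.
    by apply/eqP => /(congr1 tag) /=; rewrite tag_iter_vnext tv.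
  have fw : f (iter i (@vnext _ l) v0) = f (tg true v).
    by rewrite -iu; apply: (vertex_iter twice half).
  have := vertex_pair twice half tgN Nw uv fw.
  by move=> /(congr1 tag); rewrite tag_iter_vnext tv.
(* The second walk starts at [z], and its label there is found in the first walk at the position [b]
   below; both walks then advance together, so [b] is the rotation. *)
pose z : 'I_k := Ordinal k_gt0.
have [i iv] := @vnext_transitive _ l v0 (Tagged (fun=> 'I_k) z : vertex l) tv.
have := tag_iter_vnext i u0; rewrite tu.
have := vertex_iter twice half i fuv; rewrite iv.
case: (iter i _ u0) => -[] //= b fb _.
apply/existsP; exists b; apply/eqP/ffunP => u; rewrite !ffunE.
have ub : iter u (@ordS k) b = iter b (@ordS k) u.
  by apply/val_inj; rewrite [LHS]val_iter_ordS [RHS]val_iter_ordS addnC.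
have uz : iter u (@ordS k) z = u.
  by apply/val_inj; rewrite [LHS]val_iter_ordS add0n modn_small.
have := vertex_iter twice half u fb.
by rewrite !iter_vnext ub uz => ->.
Qed.

(** The origin of the variance [k]: there are [n ^_ k] injective walks, and the [k] rotations of an
    injective walk are pairwise distinct. *)
Lemma card_rotated n : #|[pred f : {ffun vertex l -> 'I_n} | rotated_pair f]| = (k * n ^_ k)%N.
Proof.
pose h (p : {ffun 'I_k -> 'I_n} * 'I_k) : {ffun vertex l -> 'I_n} :=
  [ffun v : vertex l => if tag v then p.1 (tagged v) else rotate_walk p.2 p.1 (tagged v)].
have h1 p : walk_of (h p) true = p.1 by apply/ffunP => u; rewrite !ffunE.
have h2 p : walk_of (h p) false = rotate_walk p.2 p.1 by apply/ffunP => u; rewrite !ffunE.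
pose Inj := finset (fun g : {ffun 'I_k -> 'I_n} => injectiveb g).
have <- : #|finset.setX Inj (finset.setTfor 'I_k)| = (k * n ^_ k)%N.
  by rewrite cardsX cardsT card_ord card_inj_ffuns !card_ord mulnC.
rewrite -(card_in_imset (f := h)); last first.
  move=> [g r] [g' r'] /finset.setXP[] /=; rewrite inE => /injectiveP ig _ _ E.
  have gg' : g = g' by rewrite -[LHS](h1 (g, r)) E h1.
  congr pair => //; have := h2 (g, r); rewrite E h2 /= -gg'.
  move=> /ffunP/(_ (Ordinal k_gt0)); rewrite !ffunE => /ig /(congr1 val).
  move=> /= H; apply/val_inj => /=.
  have := val_iter_ordS r (Ordinal k_gt0); have := val_iter_ordS r' (Ordinal k_gt0).
  by rewrite H => -> /=; rewrite !add0n !modn_small.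
apply: eq_card => f; rewrite inE; apply/idP/imsetP.
  move=> /andP[fi /existsP[r /eqP fr]]; exists (walk_of f true, r).
    by rewrite !inE /= fi.
  apply/ffunP => -[[] u]; rewrite ffunE /=; first by rewrite ffunE.
  by rewrite -fr ffunE.
move=> [[g r]]; rewrite !inE /= andbT => gi ->.
rewrite /rotated_pair h1 gi h2; apply/existsP; exists r; exact: eqxx.
Qed.

(** The difference counts the maps that are not injective; they take at most [k.-1] values, so they
    number [O(n ^ k.-1)]. *)
Lemma ffact_near_exp : exists C : R, forall n, (0 < n)%N ->
  `|(n ^_ k)%:R - n%:R ^+ k| <= C * n%:R ^+ k.-1 :> R.
Proof.
exists (k.-1 ^ k * k.-1)%:R => n n0.
pose Inj := finset (fun g : {ffun 'I_k -> 'I_n} => injectiveb g).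
have cI : #|Inj| = (n ^_ k)%N by rewrite card_inj_ffuns !card_ord.
have cT : (#|Inj| + #|finset.setC Inj| = n ^ k)%N.
  by rewrite cardsC card_ffun !card_ord.
rewrite -natrX -cT natrD cI opprD addNKr normrN normr_nat -natrX -natrM ler_nat.
have cC : (#|finset.setC Inj| <= k.-1 ^ k * (k.-1 * (n * n ^ k.-2)))%N.
  rewrite -[X in (_ <= _ ^ X * _)%N](card_ord k).
  apply: leq_trans (card_ffun_small_image _ _ _ _).
  apply/subset_leq_card/fintype.subsetP => g; rewrite !inE => ng; apply/andP; split.
    rewrite -ltnS prednK// ltnNge; apply: contra ng => kg.
    have : #|codom g| == #|'I_k|.
      by rewrite eqn_leq leq_image_card card_ord.
    by move=> /fintype.image_injP ig; apply/injectiveP => u v; exact: ig.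
  by apply/existsP; exists (Ordinal k_gt0); exact: ltn_ord.
apply: leq_trans cC _; rewrite -mulnA leq_mul2l; apply/orP; right.
by case: k k_gt0 => // -[|k'] _ //=; rewrite -expnS.
Qed.

Lemma variance_tr_power : exists C : R, forall n, (0 < n)%N ->
  `|mean P (fun w => centered_tr_power X n k w * centered_tr_power X n k w) - k%:R|
  <= C / Num.sqrt n%:R.
Proof.
have [C1 C1P] := ffact_near_exp.
pose b := family_bound B l 1.
have b0 : 0 <= b.
  exact: moments_le_ge0 (family_weight_moments X_moments predT ([ffun=> ord0] : {ffun vertex l -> 'I_1})).
exists ((b + 1) * (#|vertex l| ^ #|vertex l| * #|vertex l|)%:R + k%:R * C1) => n n0.
(* Subtracting the indicator of rotated pairs makes the defect vanish on all labellings with at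
   least [k] labels. The rotated pairs contribute [k * n ^_ k], to be divided by [n ^ k]. *)
pose D (f : {ffun vertex l -> 'I_n}) :=
  mean P (family_weight X predT f) - (rotated_pair f)%:R.
have cV : #|vertex l| = (k + k)%N by rewrite card_vertex big_bool.
have n0R : (0 : R) < n%:R by rewrite ltr0n.
set s : R := Num.sqrt n%:R; have s0 : 0 < s by rewrite sqrtr_gt0.
have s1 : 1 <= s by rewrite -sqrtr1 ler_wsqrtr// ler1n.
have s2 : s ^+ 2 = n%:R by rewrite sqr_sqrtr// ltW.
have DE : mean P (fun w => centered_tr_power X n k w * centered_tr_power X n k w) - k%:R =
    s ^- #|vertex l| * \sum_f D f + k%:R * (((n ^_ k)%:R - n%:R ^+ k) / n%:R ^+ k).
  have -> : mean P (fun w => centered_tr_power X n k w * centered_tr_power X n k w) =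
      s ^- #|vertex l| * \sum_(f : {ffun vertex l -> 'I_n}) mean P (family_weight X predT f).
    transitivity (mean P (fun w => \prod_(j | predT j) centered_tr_power X n (l j) w) *
       mean P (fun w => \prod_(j | ~~ predT j) centered_tr_power X n (l j) w)).
      rewrite [X in _ = _ * X](_ : _ = 1) ?mulr1.
        by congr (mean P _); apply/funext => w; rewrite big_bool.
      rewrite -[RHS](mean_cst P 1); congr (mean P _); apply/funext => w.
      by rewrite big_pred0.
    rewrite (mean_prod_tr_power_walks X_moments) //.
    congr (_ * _); apply: eq_bigr => f _.
    rewrite [X in _ * X](_ : _ = 1) ?mulr1//.
    rewrite -[RHS](mean_cst P 1); congr (mean P _); apply/funext => w.
    by rewrite /family_weight big_pred0.
  have sV : s ^+ #|vertex l| = n%:R ^+ k by rewrite cV addnn -mul2n exprM s2.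
  have nk0 : n%:R ^+ k != 0 :> R by rewrite expf_neq0// gt_eqF.
  have rot : \sum_(f : {ffun vertex l -> 'I_n}) (rotated_pair f)%:R = (k * n ^_ k)%:R :> R.
    rewrite -card_rotated -sum1_card natr_sum [RHS]big_mkcond /=.
    by apply: eq_bigr => f _; rewrite inE; case: (rotated_pair f).
  rewrite /D sumrB mulrBr sV rot natrM; field.
  by rewrite nk0.
rewrite DE [leRHS]mulrDl; apply: le_trans (ler_normD _ _) _; apply: lerD.
  apply: (sum_small_image_le _ true) => //; first by rewrite addr_ge0.
    move=> f; rewrite /D (le_trans (ler_normB _ _))// lerD//.
      exact: mean_family_weight_le.
    by case: (rotated_pair f); rewrite ?normr1 ?normr0.
  move=> f half; rewrite /D; have [rf|rf] := boolP (rotated_pair f).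
    by rewrite mean_rotated// subrr.
  by rewrite mean_not_rotated// subrr.
rewrite normrM normr_nat -mulrA ler_wpM2l// normrM normfV [`|n%:R ^+ k|]ger0_norm ?exprn_ge0//.
rewrite ler_pdivrMr ?exprn_gt0//; apply: le_trans (C1P n n0) _.
have C10 : 0 <= C1.
  by have := C1P 1%N isT; rewrite !expr1n mulr1; apply: le_trans.
rewrite -[leRHS]mulrA ler_wpM2l//.
rewrite -[in leRHS](prednK k_gt0) exprS mulrA ler_peMl ?exprn_ge0//.
by rewrite -s2 expr2 mulKf ?gt_eqF.
Qed.

End EqualLengths.

Lemma covariance_tr_power k1 k2 : (0 < k1)%N -> (0 < k2)%N ->
  exists C : R, forall n, (0 < n)%N ->
  `|mean P (fun w => centered_tr_power X n k1 w * centered_tr_power X n k2 w) -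
    (k1 * (k1 == k2))%:R| <= C / Num.sqrt n%:R.
Proof.
move=> k10 k20; have [<-|k12] := eqVneq k1 k2.
  by rewrite muln1; exact: variance_tr_power.
pose l (b : bool) := if b then k1 else k2.
have l0 j : (0 < l j)%N by case: j.
pose b := family_bound B l 1.
have b0 : 0 <= b.
  exact: moments_le_ge0 (family_weight_moments X_moments predT ([ffun=> ord0] : {ffun vertex l -> 'I_1})).
exists (b * (#|vertex l| ^ #|vertex l| * #|vertex l|)%:R) => n n0.
have -> : mean P (fun w => centered_tr_power X n k1 w * centered_tr_power X n k2 w) -
   (k1 * false)%:R = Num.sqrt n%:R ^- #|vertex l| *
   \sum_(f : {ffun vertex l -> 'I_n}) mean P (family_weight X predT f).
  rewrite muln0 subr0.
  transitivity (mean P (fun w => \prod_(j | predT j) centered_tr_power X n (l j) w) *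
     mean P (fun w => \prod_(j | ~~ predT j) centered_tr_power X n (l j) w)).
    rewrite [X in _ = _ * X](_ : _ = 1) ?mulr1.
      by congr (mean P _); apply/funext => w; rewrite big_bool.
    rewrite -[RHS](mean_cst P 1); congr (mean P _); apply/funext => w.
    by rewrite big_pred0.
  rewrite (mean_prod_tr_power_walks X_moments) //.
  congr (_ * _); apply: eq_bigr => f _.
  rewrite [X in _ * X](_ : _ = 1) ?mulr1//.
  rewrite -[RHS](mean_cst P 1); congr (mean P _); apply/funext => w.
  by rewrite /family_weight big_pred0.
apply: (sum_small_image_le _ true) => //.
  by move=> f; exact: mean_family_weight_le.
by move=> f half; exact: mean_pair_neq.
Qed.

End Rotations.

(** * Gaussian moments *)

Section NormalMoments.
Context {R : realType}.
Variable s : R.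
Hypothesis s_gt0 : 0 < s.
Notation mu := (@lebesgue_measure R).

Let s0 : s != 0. Proof. by rewrite gt_eqF. Qed.

(** The Radon-Nikodym derivative of [normal_prob] and the function [normal_pdf] have the same
    integral over every measurable set, hence agree almost everywhere. *)
Lemma ge0_integral_normal_prob (m : R) (f : R -> \bar R) :
  measurable_fun setT f -> (forall x, 0 <= f x)%E ->
  (\int[normal_prob m s]_x f x = \int[mu]_x (f x * (normal_pdf m s x)%:E))%E.
Proof.
move=> mf f0; have dom := normal_prob_dominates m s.
rewrite -(Radon_Nikodym_SigmaFinite.change_of_variables dom)//.
apply: ge0_ae_eq_integral => //.
- apply: emeasurable_funM => //; apply: (measurable_int mu).
  exact: Radon_Nikodym_SigmaFinite.f_integrable.
- apply: emeasurable_funM => //; apply/measurable_EFinP; exact: measurable_normal_pdf.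
- by move=> x _; rewrite mule_ge0// Radon_Nikodym_SigmaFinite.f_ge0.
- by move=> x _; rewrite mule_ge0// lee_fin normal_pdf_ge0.
- apply: ae_eqe_mul2l; apply: integral_ae_eq => //.
  + exact: Radon_Nikodym_SigmaFinite.f_integrable.
  + by apply/measurable_EFinP; exact: measurable_normal_pdf.
  + by move=> E _ mE; rewrite -Radon_Nikodym_SigmaFinite.f_integral.
Qed.

Lemma normal_pdf_shift (a x : R) :
  expR (a * x) * normal_pdf 0 s x = expR (a ^+ 2 * s ^+ 2 / 2) * normal_pdf (a * s ^+ 2) s x.
Proof.
rewrite !normal_pdfE// /normal_fun !subr0 mulrCA [RHS]mulrCA -!expRD; congr (_ * expR _).
by field.
Qed.

(** Completing the square in the density reduces the integral to the total mass of a shifted normal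
    law. The formula serves to bound all moments and, later, to compute the first one. *)
Lemma normal_mgf (a : R) :
  (\int[normal_prob 0 s]_x (expR (a * x))%:E = (expR (a ^+ 2 * s ^+ 2 / 2))%:E)%E.
Proof.
have me : measurable_fun setT (fun x : R => (expR (a * x))%:E).
  by apply/measurable_EFinP; apply: measurableT_comp => //; exact: mulrl_measurable.
rewrite ge0_integral_normal_prob//.
under eq_integral do rewrite -EFinM normal_pdf_shift EFinM.
rewrite ge0_integralZl//.
- by rewrite integral_normal_pdf mule1.
- by apply/measurable_EFinP; exact: measurable_normal_pdf.
- by move=> x _; rewrite lee_fin normal_pdf_ge0.
Qed.

Lemma abs_pow_le_expR (x : R) p : `|x| ^+ p <= p`!%:R * (expR (1 * x) + expR (-1 * x)).
Proof.
have H : `|x| ^+ p <= p`!%:R * expR `|x|.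
  case: p => [|p]; first by rewrite expr0 fact0 mul1r -expR0 ler_expR.
  rewrite mulrC -ler_pdivrMr ?ltr0n ?fact_gt0//.
  by apply: le_trans (expR_ge1Dxn p (normr_ge0 x)); rewrite lerDr.
apply: le_trans H _; rewrite ler_wpM2l// mul1r mulN1r.
by case: (ger0P x) => _; rewrite ?lerDl ?lerDr expR_ge0.
Qed.

Let N : probability (measurableTypeR R) R := normal_prob 0 s.

Lemma all_moments_normal : all_moments N (fun x : R => x).
Proof.
exists (fun p => fine (\int[N]_x (`|x| ^+ p)%:E)%E); split=> [|p]; first exact: measurable_id.
have mabs : measurable_fun setT (fun x : R => `|x| ^+ p).
  by apply: measurable_abs_pow; exact: measurable_id.
have mexp (a : R) : measurable_fun setT (fun x : R => expR (a * x)).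
  by apply: measurableT_comp => //; exact: mulrl_measurable.
rewrite fineK// ge0_fin_numE; last by apply: integral_ge0 => x _; rewrite lee_fin exprn_ge0.
apply: (@le_lt_trans _ _ (\int[N]_x (p`!%:R%:E * ((expR (1 * x))%:E + (expR (-1 * x))%:E)))%E).
  apply: ge0_le_integral => //.
  - exact/measurable_EFinP.
  - apply/measurable_EFinP; apply: measurable_funM => //.
    by apply: measurable_funD; exact: mexp.
  - by move=> x _; rewrite -EFinD -EFinM lee_fin; exact: abs_pow_le_expR.
rewrite ge0_integralZl//; last 2 first.
- by apply: emeasurable_funD; apply/measurable_EFinP; exact: mexp.
- by move=> x _; rewrite -EFinD lee_fin addr_ge0 ?expR_ge0.
rewrite ge0_integralD//; try by apply/measurable_EFinP; exact: mexp.
by rewrite !normal_mgf -EFinD -EFinM ltry.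
Qed.

Lemma mean_normalE (h : R -> R) : all_moments N h ->
  mu.-integrable setT (fun x => (h x * normal_pdf 0 s x)%:E) /\
  mean N h = \int[mu]_x (h x * normal_pdf 0 s x).
Proof.
move=> ah; have mh := all_moments_measurable ah; have ih := all_moments_integrable ah.
have mp := measurable_normal_pdf (0 : R) s.
split.
  apply/integrableP; split; first by apply/measurable_EFinP; exact: measurable_funM.
  case/integrableP: ih => _; rewrite ge0_integral_normal_prob//; last first.
    by apply: measurableT_comp => //; apply/measurable_EFinP.
  apply: le_lt_trans; rewrite le_eqVlt; apply/orP; left; apply/eqP.
  by apply: eq_integral => x _ /=; rewrite normrM EFinM [`|normal_pdf _ _ _|]ger0_norm// normal_pdf_ge0.
rewrite /mean /Rintegral; congr fine.
rewrite integralE [RHS]integralE; congr (_ - _)%E.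
  rewrite ge0_integral_normal_prob//; last by apply: measurable_funepos; exact/measurable_EFinP.
  apply: eq_integral => x _; rewrite !funeposE /= -!EFin_max -EFinM; congr EFin.
  by rewrite maxr_pMl ?normal_pdf_ge0// mul0r.
rewrite ge0_integral_normal_prob//; last by apply: measurable_funeneg; exact/measurable_EFinP.
apply: eq_integral => x _; rewrite !funenegE /= -?EFinN -!EFin_max -EFinM; congr EFin.
by rewrite maxr_pMl ?normal_pdf_ge0// mul0r mulNr.
Qed.

End NormalMoments.

(** * Gaussian integration by parts *)

Section NormalRecursion.
Context {R : realType}.
Variable s : R.
Hypothesis s_gt0 : 0 < s.
Notation mu := (@lebesgue_measure R).
Let N : probability (measurableTypeR R) R := normal_prob 0 s.

(** [F p] is the boundary term of an integration by parts: its derivative is [h p * normal_pdf 0 s].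
    As it vanishes at both infinities, [h p] has mean 0, and this is the recursion on moments. *)
Let F (p : nat) (x : R) : R := x ^+ p.+1 * normal_pdf 0 s x.
Let h (p : nat) (x : R) : R := p.+1%:R * x ^+ p - x ^+ p.+2 / s ^+ 2.

Lemma is_derive_normal_pdf (x : R) :
  is_derive x 1 (normal_pdf 0 s) (- (x / s ^+ 2) * normal_pdf 0 s x).
Proof.
have sn0 : s != 0 by rewrite gt_eqF.
pose k := - (s ^+ 2 *+ 2)^-1.
have E : normal_pdf 0 s = normal_peak s *: (expR \o (k *: (id ^+ 2))).
  apply/funext => y; rewrite normal_pdfE//= /normal_fun subr0; congr (_ * expR _).
  by rewrite /k !fctE /GRing.scale /= mulNr [RHS]mulNr mulrC.
rewrite E; apply: is_derive_eq.
rewrite !fctE /= /GRing.scale /= /k.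
by field.
Qed.

Lemma is_derive_boundary p (x : R) : is_derive x 1 (F p) (h p x * normal_pdf 0 s x).
Proof.
have D := is_derive_normal_pdf x.
have -> : F p = (id ^+ p.+1) * normal_pdf 0 s by apply/funext => y; rewrite /F !fctE.
apply: is_derive_eq.
rewrite /h /GRing.scale /= !fctE /= !exprS; field.
by rewrite gt_eqF.
Qed.

Lemma boundary_le p : exists C : R, forall x, 1 <= `|x| -> `|F p x| <= C / `|x|.
Proof.
have sn0 : s != 0 by rewrite gt_eqF.
pose c : R := s ^+ 2 *+ 2.
have c0 : 0 < c by rewrite mulrn_wgt0// exprn_gt0.
(* The constant comes from [expR u >= u ^+ p.+2 / (p.+2)!] with [u = x ^ 2 / c]: the density then
   decays like [|x|] to the power [- (2 p + 4)], more than the [p + 2] powers required. *)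
exists (normal_peak s * (p.+2)`!%:R * c ^+ p.+2) => x x1.
have x0 : 0 < `|x| by exact: lt_le_trans ltr01 x1.
have pk0 := normal_peak_ge0 s.
rewrite /F normrM normrX [`|normal_pdf _ _ _|]ger0_norm ?normal_pdf_ge0//.
move KE : (c ^+ p.+2) => K.
rewrite normal_pdfE// /normal_fun subr0 -/c mulrCA -!mulrA ler_wpM2l//.
set u := `|x| ^+ 2 / c.
have u0 : 0 < u by rewrite divr_gt0// exprn_gt0.
have -> : - x ^+ 2 / c = - u by rewrite /u real_normK ?num_real// mulNr.
rewrite expRN.
have : u ^+ p.+2 / (p.+2)`!%:R <= expR u.
  by apply: le_trans (expR_ge1Dxn p.+1 (ltW u0)); rewrite lerDr.
rewrite ler_pdivrMr ?ltr0n ?fact_gt0// => H.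
rewrite ler_pdivrMr ?expR_gt0//.
have -> : K = (`|x| ^+ 2) ^+ p.+2 / u ^+ p.+2.
  by rewrite -KE /u expr_div_n invf_div mulrCA divff ?mulr1// expf_neq0// expf_neq0// gt_eqF.
rewrite [leRHS](_ : _ = (p.+2)`!%:R * expR u / u ^+ p.+2 * ((`|x| ^+ 2) ^+ p.+2 / `|x|)); last by ring.
apply: (@le_trans _ _ (1 * ((`|x| ^+ 2) ^+ p.+2 / `|x|))); last first.
  apply: ler_wpM2r; first by rewrite divr_ge0// !exprn_ge0.
  by rewrite ler_pdivlMr ?exprn_gt0// mul1r mulrC.
rewrite mul1r ler_pdivlMr// -exprSr -exprM.
by rewrite ler_weXn2l//; lia.
Qed.

Lemma continuous_boundary_derivative p : continuous (fun x => h p x * normal_pdf 0 s x).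
Proof.
move=> x; apply: cvgM; last by apply: continuous_normal_pdf; rewrite gt_eqF.
rewrite /h; apply: (@cvgB _ R^o).
  apply: cvgM; first exact: cvg_cst.
  exact: exprn_continuous.
by apply: cvgM; [exact: exprn_continuous|exact: cvg_cst].
Qed.

Lemma mean_normal_recursion p :
  mean N (fun x => x ^+ p.+2) = p.+1%:R * s ^+ 2 * mean N (fun x => x ^+ p).
Proof.
have ax : all_moments N (fun x : R => x) by exact: all_moments_normal.
have aX q : all_moments N (fun x : R => x ^+ q) by exact: all_momentsX.
have aV : all_moments N (fun x : R => x ^+ p.+2 / s ^+ 2).
  by apply: all_momentsM => //; exact: all_moments_cst.
have ah : all_moments N (h p) by apply: all_momentsB => //; exact: all_momentsZ.
suff : mean N (h p) = 0.
  rewrite /h meanB//; last exact: all_momentsZ.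
  rewrite meanZ// (_ : mean N (fun w => w ^+ p.+2 / s ^+ 2) = (s ^+ 2)^-1 * mean N (fun x => x ^+ p.+2)).
    move=> /eqP; rewrite subr_eq0 => /eqP H.
    by rewrite mulrAC H mulrAC mulVf ?mul1r// expf_neq0// gt_eqF.
  by rewrite -meanZ//; congr (mean N _); apply/funext => x; rewrite mulrC.
have [ig ->] := mean_normalE ah.
pose g x := h p x * normal_pdf 0 s x.
have mg : measurable_fun setT g by apply/measurable_EFinP; exact: (measurable_int mu).
pose A (n : nat) := `[- (n%:R : R), n%:R]%classic.
have cvgI : (\int[mu]_(x in A n) (g x)%:E)%E @[n --> \oo] --> (\int[mu]_x (g x)%:E)%E.
  have : (\int[mu]_x (EFin \o (g \_ (A n))) x)%E @[n --> \oo] --> (\int[mu]_x (g x)%:E)%E.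
    have m1 n : measurable_fun setT (EFin \o (g \_ (A n))).
      apply/measurable_EFinP; apply/(measurable_restrictT g); first exact: measurable_itv.
      exact: measurable_funTS.
    have m2 : measurable_fun setT (EFin \o g) by exact/measurable_EFinP.
    have m4 : mu.-integrable setT (EFin \o (fun x => `|g x|)) by exact: integrable_norm.
    have [||_ _ //] := @dominated_convergence _ (measurableTypeR R) R mu setT measurableT
      (fun n => EFin \o (g \_ (A n))) (EFin \o g) _ m1 m2 _ m4.
      apply: aeW => x _; apply: cvg_near_cst; near=> n.
      rewrite /= patchE ifT// inE /A /= in_itv /= -ler_norml.
      by near: n; exact: nbhs_infty_ger.
    apply: aeW => x n _ /=; rewrite lee_fin patchE.
    by case: ifP => // _; rewrite normr0.
  apply: cvg_trans; apply: near_eq_cvg; near=> n.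
  rewrite [RHS]integral_mkcond; apply: eq_integral => x _ /=.
  by rewrite !patchE; case: ifP.
have FTC n : (0 < n)%N -> (\int[mu]_(x in A n) (g x)%:E)%E = (F p n%:R - F p (- n%:R))%:E.
  move=> n0; rewrite EFinB; apply: continuous_FTC2.
  - by rewrite ltrNl gtrN ?ltr0n.
  - by apply: continuous_subspaceT => x; exact: continuous_boundary_derivative.
  - have dF x := is_derive_boundary p x.
    have cF : continuous (F p).
      move=> x; apply: differentiable_continuous; apply/derivable1_diffP.
      by have [] := dF x.
    split.
    + by move=> x _; have [] := dF x.
    + by apply: cvg_at_right_filter; exact: cF.
    + by apply: cvg_at_left_filter; exact: cF.
  - by move=> x _; rewrite derive1E; have [_ ->] := is_derive_boundary p x.
have F0 : (F p n%:R - F p (- n%:R)) @[n --> \oo] --> (0 : R).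
  have [C CP] := boundary_le p.
  have : (C *+ 2) * n%:R^-1 @[n --> \oo] --> (0 : R).
    rewrite -[X in _ --> X](mulr0 (C *+ 2)); apply: cvgM; first exact: cvg_cst.
    rewrite gtr0_cvgV0; first exact: cvgr_idn.
    by near=> n; rewrite ltr0n; near: n; exact: nbhs_infty_gt.
  move=> H; apply/norm_cvg0P; apply: (squeeze_cvgr _ (cvg_cst 0) H).
  near=> n; rewrite normr_ge0 /=.
  have n1 : 1 <= `|n%:R : R|.
    by rewrite normr_nat ler1n; near: n; exact: nbhs_infty_gt.
  apply: le_trans (ler_normB _ _) _; rewrite mulr2n mulrDl; apply: lerD.
    by apply: le_trans (CP _ n1) _; rewrite normr_nat.
  by apply: le_trans (CP _ _) _; rewrite normrN ?normr_nat// -(normr_nat R n).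
have : (F p n%:R - F p (- n%:R))%:E @[n --> \oo] --> (\int[mu]_x (g x)%:E)%E.
  apply: cvg_trans cvgI; apply: near_eq_cvg; near=> n; rewrite FTC//.
  by near: n; exact: nbhs_infty_gt.
move=> H; have H0 : (F p n%:R - F p (- n%:R))%:E @[n --> \oo] --> 0%:E.
  by apply: cvg_EFin => //; near=> n.
rewrite /Rintegral (_ : (\int[mu]_x (g x)%:E)%E = 0%:E)//.
exact: (cvg_unique _ H H0).
Unshelve. all: by end_near. Qed.

End NormalRecursion.

(** * Transfer of moments between variables of the same law *)

Section LawTransfer.
Context {R : realType} {d : measure_display} {T : measurableType d} {P : probability T R}.
Variables (Z : {RV P >-> R}) (nu : probability R R).
Hypothesis Z_law : forall A : set R, measurable A -> distribution P Z A = nu A.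

Lemma ge0_integral_law (f : R -> \bar R) : measurable_fun setT f -> (forall x, 0 <= f x)%E ->
  (\int[P]_w f (Z w) = \int[nu]_x f x)%E.
Proof.
move=> mf f0; rewrite -(ge0_integral_distribution Z mf f0).
by apply: eq_measure_integral => A mA _; exact: Z_law.
Qed.

Lemma all_moments_law (h : R -> R) : all_moments nu h -> all_moments P (h \o Z).
Proof.
move=> [B [mh Bh]]; exists B; split=> [|p]; first exact: measurableT_comp.
apply: le_trans (Bh p); rewrite le_eqVlt; apply/orP; left; apply/eqP.
apply: (ge0_integral_law (f := fun x => (`|h x| ^+ p)%:E)) => [|x].
  by apply/measurable_EFinP; exact: measurable_abs_pow.
by rewrite lee_fin exprn_ge0.
Qed.

Lemma mean_law (h : R -> R) : all_moments nu h -> mean P (h \o Z) = mean nu h.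
Proof.
move=> ah; have iZ := all_moments_integrable (all_moments_law ah).
have mh := all_moments_measurable ah.
rewrite /mean /Rintegral; congr fine.
rewrite -(@integral_distribution _ _ _ _ _ _ Z (EFin \o h))//; last exact/measurable_EFinP.
by apply: eq_measure_integral => A mA _; exact: Z_law.
Qed.

Lemma all_moments_unlaw (h : R -> R) : measurable_fun setT h ->
  all_moments P (h \o Z) -> all_moments nu h.
Proof.
move=> mh [B [_ Bh]]; exists B; split=> // p.
apply: le_trans (Bh p); rewrite le_eqVlt; apply/orP; left; apply/eqP/esym.
apply: (ge0_integral_law (f := fun x => (`|h x| ^+ p)%:E)) => [|x].
  by apply/measurable_EFinP; exact: measurable_abs_pow.
by rewrite lee_fin exprn_ge0.
Qed.

End LawTransfer.

Section EntryMoments.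
Context {R : realType} {d0 : measure_display} {T0 : measurableType d0}
  {P0 : probability T0 R} {X0 : {RV P0 >-> R}}.
Hypothesis X0_mean : ('E_P0[X0] = 0)%E.
Hypothesis X0_second_moment : ('E_P0[fun w => (X0 w ^+ 2)%R] = 1)%E.
Hypothesis X0_moments : forall n : nat, (3 <= n)%N ->
  ('E_P0[fun w => (`|X0 w| ^+ n)%R] < +oo)%E.

(** The moment hypothesis starts at exponent 3; lower powers of [|x|] are dominated by
    [1 + |x| ^ 3]. *)
Lemma all_moments_entry : all_moments P0 X0.
Proof.
have mX : measurable_fun setT X0 by exact: measurable_funP.
exists (fun p => fine (\int[P0]_w (`|X0 w| ^+ p)%:E)%E); split=> // p.
rewrite fineK// ge0_fin_numE; last by apply: integral_ge0 => x _; rewrite lee_fin exprn_ge0.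
have [p3|p3] := leqP 3 p; first by have := X0_moments p3; rewrite unlock.
have m3 := X0_moments (leqnn 3); rewrite unlock in m3.
apply: (@le_lt_trans _ _ (\int[P0]_w (1%:E + (`|X0 w| ^+ 3)%:E))%E).
  apply: ge0_le_integral => //.
  - by apply/measurable_EFinP; exact: measurable_abs_pow.
  - by apply/measurable_EFinP; apply: measurable_funD => //; exact: measurable_abs_pow.
  - move=> w _; rewrite -EFinD lee_fin.
    have [x1|x1] := leP 1 `|X0 w|.
      by rewrite (le_trans (ler_weXn2l x1 (ltnW p3)))// lerDr.
    by rewrite (le_trans (exprn_ile1 p (normr_ge0 (X0 w)) (ltW x1)))// lerDl exprn_ge0.
rewrite ge0_integralD//; last by apply/measurable_EFinP; exact: measurable_abs_pow.
have := integral_cst P0 (@measurableT _ T0) 1%:E.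
by rewrite /= probability_setT mule1 => ->; rewrite lte_add_pinfty// ltry.
Qed.

Context {d : measure_display} {T : measurableType d} {P : probability T R}.
Variable X : nat -> nat -> {RV P >-> R}.
Hypothesis X_law : forall i j : nat, same_law (X i j) X0.

Let nu : probability R R := distribution P0 X0.

Let all_moments_nu : all_moments nu (fun x => x).
Proof.
apply: (all_moments_unlaw (Z := X0)) => //.
exact: all_moments_entry.
Qed.

(** The bound is computed on the common law [nu], which makes it the same for all entries. *)
Lemma entries_moments : exists B, forall i j, moments_le P B (X i j).
Proof.
have [B [_ Bnu]] := all_moments_nu; exists B => i j; split=> [|p]; first exact: measurable_funP.
apply: le_trans (Bnu p); rewrite le_eqVlt; apply/orP; left; apply/eqP.
apply: (ge0_integral_law (X_law i j) (f := fun x => (`|x| ^+ p)%:E)) => [|x].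
  by apply/measurable_EFinP; apply: measurable_abs_pow; exact: measurable_id.
by rewrite lee_fin exprn_ge0.
Qed.

Lemma entries_mean i j : mean P (X i j) = 0.
Proof.
rewrite (mean_law (X_law i j) all_moments_nu) -(@mean_law _ _ _ _ X0 nu)//.
by rewrite -fine_expectation X0_mean.
Qed.

Lemma entries_variance i j : mean P (fun w => X i j w ^+ 2) = 1.
Proof.
have a2 := all_momentsX 2 all_moments_nu.
rewrite (mean_law (X_law i j) a2) -(@mean_law _ _ _ _ X0 nu _ _ a2)//.
by rewrite -fine_expectation X0_second_moment.
Qed.

End EntryMoments.

Section GaussianVariable.
Context {R : realType} {d : measure_display} {T : measurableType d} {Q : probability T R}.
Variables (v : nat) (Z : {RV Q >-> R}).
Hypothesis v_gt0 : (0 < v)%N.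
Hypothesis Z_gauss : centered_gaussian v%:R Z.

Let s := Num.sqrt (v%:R : R).
Let s_gt0 : 0 < s. Proof. by rewrite sqrtr_gt0 ltr0n. Qed.
Let idR : measurableTypeR R -> R := idfun.
#[local] HB.instance Definition _ :=
  @isMeasurableFun.Build _ _ _ _ idR (@measurable_id _ _ setT).
Let N0 : probability (measurableTypeR R) R := normal_prob 0 s.
(* The same measure, on the canonical Borel structure of [R]. *)
Let N : probability R R := distribution N0 (idR : {RV N0 >-> R}).

Let aid : all_moments N (fun x : R => x).
Proof.
apply: (all_moments_unlaw (Z := idR : {RV N0 >-> R})) => //.
exact: all_moments_normal.
Qed.

Let aN p : all_moments N (fun x : R => x ^+ p).
Proof. exact: all_momentsX aid. Qed.

Let mean_NE h : all_moments N h -> mean N h = mean N0 h.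
Proof. by move=> ah; rewrite -(mean_law (Z := idR : {RV N0 >-> R}) _ ah). Qed.

Lemma all_moments_gaussian : all_moments Q Z.
Proof.
exact: (all_moments_law (nu := N) Z_gauss aid).
Qed.

Lemma mean_gaussian_recursion p :
  mean Q (fun w => Z w ^+ p.+2) = (p.+1 * v)%:R * mean Q (fun w => Z w ^+ p).
Proof.
have : mean N0 (fun x => x ^+ p.+2) = p.+1%:R * s ^+ 2 * mean N0 (fun x => x ^+ p).
  exact: mean_normal_recursion.
rewrite -!mean_NE//.
rewrite -(mean_law (nu := N) Z_gauss (aN p.+2)) -(mean_law (nu := N) Z_gauss (aN p)).
by rewrite sqr_sqrtr ?ler0n// -natrM.
Qed.

(** The recursion steps by two and leaves the first moment undetermined. Integrating
    [1 + a x <= expR (a x)] gives [1 + a m <= expR (a ^ 2 s ^ 2 / 2)], and small [a] of both signs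
    force [m = 0]. *)
Lemma mean_gaussian : mean Q Z = 0.
Proof.
rewrite (mean_law (nu := N) Z_gauss aid) mean_NE//.
have aid0 : all_moments N0 (fun x : R => x) by exact: all_moments_normal.
set m := mean N0 _.
have mgf (a : R) : 1 + a * m <= expR (a ^+ 2 * s ^+ 2 / 2).
  have mex : measurable_fun setT (fun x : R => expR (a * x)).
    by apply: measurableT_comp => //; exact: mulrl_measurable.
  have iex : N0.-integrable setT (fun x : R => (expR (a * x))%:E).
    apply/integrableP; split; first exact/measurable_EFinP.
    under eq_integral => x _ do rewrite /= ger0_norm ?expR_ge0//.
    by rewrite normal_mgf// ltry.
  rewrite -lee_fin -normal_mgf//.
  have a1 : all_moments N0 (fun x : R => 1 + a * x).
    by apply: all_momentsD; [exact: all_moments_cst|exact: all_momentsZ].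
  have -> : (1 + a * m)%:E = (\int[N0]_x (1 + a * x)%:E)%E.
    have -> : 1 + a * m = mean N0 (fun x => 1 + a * x).
      rewrite (meanD (all_moments_cst N0 1) (all_momentsZ a aid0)).
      by rewrite (mean_cst N0 1) meanZ.
    by rewrite /mean /Rintegral fineK//; exact: integrable_fin_num (all_moments_integrable a1).
  apply: le_integral => //; first exact: all_moments_integrable a1.
  by move=> x _; rewrite lee_fin expR_ge1Dx.
have s2 : 0 < s ^+ 2 by rewrite exprn_gt0.
have small a : a ^+ 2 * s ^+ 2 <= 1 -> a * m <= a ^+ 2 * s ^+ 2.
  move=> a1; set u := a ^+ 2 * s ^+ 2 / 2.
  have u0 : 0 <= u by rewrite divr_ge0// mulr_ge0// sqr_ge0.
  have u12 : u <= 1 / 2 by rewrite ler_pM2r// invr_gt0.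
  have := mgf a; rewrite -/u => H.
  (* From [expR (- u) >= 1 - u] one gets [(1 - u) * expR u <= 1], and [1 <= (1 - u) * (1 + 2 u)] for
     [u] in [[0, 1/2]]. *)
  have eu : expR u <= 1 + 2 * u.
    have := expR_ge1Dx (- u); rewrite expRN => H2.
    have eu0 := expR_gt0 u.
    have : (1 - u) * expR u <= 1 by rewrite -ler_pdivlMr// mul1r.
    nra.
  have E : a ^+ 2 * s ^+ 2 = 2 * u by rewrite /u; field.
  rewrite E; lra.
apply/eqP; rewrite eq_le; apply/andP; split; rewrite leNgt; apply/negP => m0.
  (* The bound [1 / s] makes [small] applicable, and [m / (2 s ^ 2)] gives [a s ^ 2 <= m / 2], which
     contradicts its conclusion. *)
  pose a := Num.min (m / (2 * s ^+ 2)) (1 / s).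
  have a0 : 0 < a by rewrite lt_min !divr_gt0// mulr_gt0.
  have am : a <= m / (2 * s ^+ 2) by rewrite ge_min lexx.
  have as1 : a <= 1 / s by rewrite ge_min lexx orbT.
  have as' : a * s <= 1 by rewrite -ler_pdivlMr.
  have : a * m <= a ^+ 2 * s ^+ 2.
    by apply: small; rewrite -exprMn; apply: exprn_ile1 => //; rewrite mulr_ge0// ltW.
  rewrite expr2 -mulrA ler_pM2l// => H.
  move: am; rewrite ler_pdivlMr ?mulr_gt0// => am.
  nra.
pose a := Num.min (- m / (2 * s ^+ 2)) (1 / s).
have m0' : 0 < - m by rewrite oppr_gt0.
have a0 : 0 < a by rewrite lt_min !divr_gt0// mulr_gt0.
have am : a <= - m / (2 * s ^+ 2) by rewrite ge_min lexx.
have as1 : a <= 1 / s by rewrite ge_min lexx orbT.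
have as' : a * s <= 1 by rewrite -ler_pdivlMr.
have : - a * m <= a ^+ 2 * s ^+ 2.
  by have := small (- a); rewrite sqrrN; apply; rewrite -exprMn; apply: exprn_ile1 => //; rewrite mulr_ge0// ltW.
rewrite expr2 mulNr -mulrN -mulrA ler_pM2l// => H.
move: am; rewrite ler_pdivlMr ?mulr_gt0// => am.
nra.
Qed.

End GaussianVariable.

(** * Wick formula for independent Gaussian variables *)

Section GaussianVector.
Context {R : realType} {d : measure_display} {T : measurableType d} {Q : probability T R}.
Variables (m : nat) (k : 'I_m -> nat) (Z : 'I_m -> {RV Q >-> R}).
Hypothesis k_ge1 : forall j, (0 < k j)%N.
Hypothesis Z_indep : mutually_independent Z.
Hypothesis Z_gauss : forall j, centered_gaussian (k j)%:R (Z j).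

Definition gaussian_moment (s : seq 'I_m) : R := mean Q (fun w => \prod_(i <- s) Z i w).

Lemma all_moments_gaussian_vector i : all_moments Q (Z i).
Proof. exact: all_moments_gaussian (Z_gauss i). Qed.

Lemma gaussian_moment_perm s t : perm_eq s t -> gaussian_moment s = gaussian_moment t.
Proof.
by move=> st; congr (mean Q _); apply/funext => w; exact: perm_big.
Qed.

Lemma prod_count (F : 'I_m -> R) x s :
  \prod_(i <- s) F i = F x ^+ count_mem x s * \prod_(i <- s | i != x) F i.
Proof.
rewrite (bigID (pred1 x)) /=; congr (_ * _).
elim: s => [|y s IH]; first by rewrite big_nil expr0.
by rewrite big_cons /= IH; case: eqP => [->|_]; rewrite ?add0n// add1n exprS.
Qed.

Lemma gaussian_moment_split x s c :
  mean Q (fun w => Z x w ^+ c * \prod_(i <- s | i != x) Z i w) =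
  mean Q (fun w => Z x w ^+ c) * mean Q (fun w => \prod_(i <- s | i != x) Z i w).
Proof.
have aZ := all_moments_gaussian_vector.
apply: (mean_depends_on_M (E1 := [:: x]) (E2 := [seq i <- s | i != x]) Z_indep).
- by move=> j; rewrite inE => /eqP ->; rewrite mem_filter eqxx.
- apply: (@depends_on_comp _ _ _ _ _ _ _ (Z x) (fun y => y ^+ c)) => //.
  by apply: depends_on_X; rewrite inE.
- under [X in depends_on _ _ X]funext => w do rewrite -big_filter big_seq.
  by apply: depends_on_prod => j js; exact: depends_on_X.
- exact: all_momentsX.
- by apply: all_moments_prod.
Qed.

(** By independence the power of [Z x] separates from the other variables, and the one-variable
    recursion lowers it by two; each of the other occurrences of [x] is a possible partner. If there
    is none, the isolated factor has mean 0. *)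
Lemma gaussian_wick x s :
  gaussian_moment (x :: s) = (count_mem x s * k x)%:R * gaussian_moment (rem x s).
Proof.
have [xs|xs] := boolP (x \in s); last first.
  rewrite (count_memPn xs) mul0n mul0r /gaussian_moment.
  have -> : (fun w => \prod_(i <- x :: s) Z i w) =
      fun w => Z x w ^+ 1 * \prod_(i <- s | i != x) Z i w.
    by apply/funext => w; rewrite (prod_count _ x) /= eqxx (count_memPn xs) addn0 big_cons eqxx.
  rewrite gaussian_moment_split -[X in mean Q X * _]/(fun w => Z x w).
  by rewrite (mean_gaussian (v := k x))// mul0r.
have ps := perm_to_rem xs.
set r := rem x s in ps *; set c := count_mem x r.
have cs : count_mem x s = c.+1 by rewrite (permP ps) /= eqxx add1n.
rewrite cs.
have -> : gaussian_moment (x :: s) =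
    mean Q (fun w => Z x w ^+ c.+2 * \prod_(i <- r | i != x) Z i w).
  congr (mean Q _); apply/funext => w.
  by rewrite (prod_count _ x) /= eqxx cs add1n big_cons eqxx /= (perm_big _ ps) /= big_cons eqxx.
have -> : gaussian_moment r =
    mean Q (fun w => Z x w ^+ c * \prod_(i <- r | i != x) Z i w).
  by congr (mean Q _); apply/funext => w; rewrite (prod_count _ x).
by rewrite !gaussian_moment_split (mean_gaussian_recursion (v := k x))// mulrA.
Qed.

End GaussianVector.

(** * Convergence of moments *)

Section MomentConvergence.
Context {R : realType} {d : measure_display} {T : measurableType d} {P : probability T R}.
Variable X : nat -> nat -> {RV P >-> R}.
Variable B : nat -> R.
Hypothesis X_moments : forall i j, moments_le P B (X i j).
Hypothesis X_indep : mutually_independent (fun e : nat * nat => X e.1 e.2).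
Hypothesis X_mean : forall i j, mean P (X i j) = 0.
Hypothesis X_var : forall i j, mean P (fun w => X i j w ^+ 2) = 1.
Context {d' : measure_display} {T' : measurableType d'} {Q : probability T' R}.
Variables (m : nat) (k : 'I_m -> nat) (Z : 'I_m -> {RV Q >-> R}).
Hypothesis k_ge1 : forall j, (0 < k j)%N.
Hypothesis k_inj : injective k.
Hypothesis Z_indep : mutually_independent Z.
Hypothesis Z_gauss : forall j, centered_gaussian (k j)%:R (Z j).

Lemma cvg_div_sqrt (C : R) : C / Num.sqrt n%:R @[n --> \oo] --> (0 : R).
Proof.
rewrite -[X in _ --> X](mulr0 C); apply: cvgM; first exact: cvg_cst.
rewrite gtr0_cvgV0; last first.
  by near=> n; rewrite sqrtr_gt0 ltr0n; near: n; exact: nbhs_infty_gt.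
apply/cvgryPge => A; near=> n.
have An : A ^+ 2 <= n%:R by near: n; exact: nbhs_infty_ger.
apply: (@le_trans _ _ `|A|); first exact: ler_norm.
by rewrite -sqrtr_sqr ler_wsqrtr.
Unshelve. all: by end_near. Qed.

Lemma cvg_le_div_sqrt (u : nat -> R) (a C : R) :
  (forall n, (0 < n)%N -> `|u n - a| <= C / Num.sqrt n%:R) -> u n @[n --> \oo] --> a.
Proof.
move=> uC; apply/cvgrPdist_le => e e0; near=> n.
rewrite distrC; apply: le_trans (uC n _) _.
  by near: n; exact: nbhs_infty_gt.
apply: le_trans (ler_norm _) _; rewrite -normrN -sub0r.
by near: n; have /cvgrPdist_le := cvg_div_sqrt C; exact.
Unshelve. all: by end_near. Qed.

Lemma cvgn_sum (I : Type) (s : seq I) (S : pred I) (u : I -> nat -> R) (a : I -> R) :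
  (forall i, S i -> u i n @[n --> \oo] --> a i) ->
  \sum_(i <- s | S i) u i n @[n --> \oo] --> \sum_(i <- s | S i) a i.
Proof.
move=> ua; elim: s => [|i s IH].
  rewrite big_nil; under eq_fun do rewrite big_nil; exact: cvg_cst.
rewrite big_cons; under eq_fun do rewrite big_cons.
by case: ifPn => // Si; apply: (@cvgD _ R^o) => //; exact: ua.
Qed.

Definition trace_moment n (s : seq 'I_m) : R :=
  mean P (fun w => \prod_(i <- s) centered_tr_power X n (k i) w).

(** Strong induction on the number of factors, two of which are removed by [wick_recursion]. The
    factors are indexed by their positions [J] in the list, so that repetitions count with
    multiplicity. *)
Lemma trace_moment_cvg s : trace_moment n s @[n --> \oo] --> gaussian_moment Z s.
Proof.
have [p] := ubnP (size s); elim: p s => // p IH [_|x s].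
  have E n : trace_moment n [::] = 1.
    by rewrite -[RHS](mean_cst P 1); congr (mean P _); apply/funext => w; rewrite big_nil.
  have -> : gaussian_moment Z [::] = 1.
    by rewrite -[RHS](mean_cst Q 1); congr (mean Q _); apply/funext => w; rewrite big_nil.
  by under eq_fun do rewrite E; exact: cvg_cst.
rewrite /= ltnS => sp.
pose J : finType := 'I_(size s).+1.
pose a (j : J) := nth x (x :: s) j.
pose r (j : J) := [seq a i | i <- enum J & (i != ord0) && (i != j)].
have prodE (F : 'I_m -> R) : \prod_(j : J) F (a j) = \prod_(i <- x :: s) F i.
  by rewrite (big_nth x) big_mkord.
have prodr (F : 'I_m -> R) j : \prod_(i | (i != ord0) && (i != j)) F (a i) = \prod_(i <- r j) F i.
  by rewrite big_map big_filter big_enum_cond.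
have perm_r j : j != ord0 -> perm_eq (a j :: r j) s.
  move=> j0; rewrite -(perm_cons x).
  have -> : x :: s = [seq a i | i <- enum J].
    apply: (@eq_from_nth _ x); first by rewrite size_map size_enum_ord.
    by move=> i ilt; rewrite (nth_map ord0) ?size_enum_ord// /a nth_enum_ord.
  rewrite -[x :: _]/(map a (ord0 :: j :: [seq i <- enum J | (i != ord0) && (i != j)])).
  apply: perm_map; apply: uniq_perm; last 1 first.
  - move=> i; rewrite !inE mem_filter mem_enum andbT.
    by case: eqVneq => //= _; case: eqVneq.
  - rewrite /= !inE !mem_filter !eqxx andbF filter_uniq ?enum_uniq// !andbT orbF.
    by rewrite eq_sym j0.
  - exact: enum_uniq.
have [C wick] := wick_recursion X_moments X_indep X_mean (l := fun j : J => k (a j))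
  (fun j => k_ge1 (a j)) ord0.
pose S n := \sum_(j : J | j != ord0)
  mean P (fun w => centered_tr_power X n (k x) w * centered_tr_power X n (k (a j)) w) *
  trace_moment n (r j).
have dS : (trace_moment n (x :: s) - S n) @[n --> \oo] --> (0 : R).
  apply: (@cvg_le_div_sqrt _ _ C) => n n0; rewrite subr0.
  apply: le_trans (wick n n0); rewrite le_eqVlt; apply/orP; left; apply/eqP.
  congr `|_ - _|.
    congr (mean P _); apply/funext => w.
    by rewrite (prodE (fun i => centered_tr_power X n (k i) w)).
  apply: eq_bigr => j _; congr (_ * _); congr (mean P _); apply/funext => w.
  by rewrite (prodr (fun i => centered_tr_power X n (k i) w)).
have cS : S n @[n --> \oo] --> gaussian_moment Z (x :: s).
  rewrite (gaussian_wick k_ge1 Z_indep Z_gauss).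
  (* Injectivity of [k] turns equal lengths into equal indices. Summing over positions counts the
     occurrences of [x], and removing one of them leaves a permutation of [rem x s]. *)
  have -> : (count_mem x s * k x)%:R * gaussian_moment Z (rem x s) =
      \sum_(j : J | j != ord0) (k x * (k x == k (a j)))%:R * gaussian_moment Z (r j).
    transitivity (\sum_(j : J | j != ord0) (a j == x)%:R *
        ((k x)%:R * gaussian_moment Z (rem x s))).
      rewrite -mulr_suml mulrA natrM; congr (_ * _ * _).
      rewrite -sum1_count natr_sum big_mkcond [RHS]big_mkcond big_ord_recl /= add0r.
      rewrite (big_nth x) big_mkord; apply: eq_bigr => i _.
      by rewrite /a /=; case: eqP.
    apply: eq_bigr => j j0; rewrite (inj_eq k_inj) eq_sym.
    have [E|_] := eqVneq (a j) x; last by rewrite muln0 !mul0r.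
    rewrite muln1 mul1r; congr (_ * _); apply: gaussian_moment_perm.
    have := perm_r j j0; rewrite E => pr.
    have xs : x \in s by rewrite -(perm_mem pr) inE eqxx.
    rewrite -(perm_cons x) perm_sym; apply: perm_trans pr _; exact: perm_to_rem.
  apply: cvgn_sum => j j0; apply: cvgM.
    have [C' C'P] := covariance_tr_power X_moments X_indep X_mean X_var (k_ge1 x) (k_ge1 (a j)).
    exact: cvg_le_div_sqrt C'P.
  apply: IH; apply: leq_trans _ sp; have /perm_size := perm_r j j0.
  by move=> /= ->.
rewrite -[gaussian_moment Z _]add0r.
rewrite (_ : trace_moment^~ (x :: s) = fun n => (trace_moment n (x :: s) - S n) + S n).
  exact: (@cvgD _ R^o).
by apply/funext => n; rewrite subrK.
Unshelve. all: by end_near. Qed.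

End MomentConvergence.

(** * Trigonometric test functions *)

Section CosineTaylor.
Context {R : realType}.
Implicit Types (y th : R).

(** The successive derivatives of the cosine are its translates by multiples of [pi / 2]. With the
    phase [th] free, differentiating the remainder lowers [p] by one and shifts [th], so the
    induction never separates sines from cosines. *)
Definition cos_remainder p th y : R :=
  cos (y + th) - \sum_(i < p) cos (th + i%:R * (pi / 2)) * (y ^+ i / i`!%:R).

Lemma is_derive_cos_remainder p th y :
  is_derive y 1 (cos_remainder p.+1 th) (cos_remainder p (th + pi / 2) y).
Proof.
pose h (i : 'I_p.+1) : R -> R := (cos (th + i%:R * (pi / 2)) / i`!%:R) *: (id ^+ i).
have -> : cos_remainder p.+1 th = (cos \o (id + cst th)) - \sum_(i < p.+1) h i.
  apply/funext => z; rewrite /cos_remainder !fctE fct_sumE /=; congr (_ - _).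
  by apply: eq_bigr => i _; rewrite /h !fctE /GRing.scale /= mulrCA mulrC mulrA mulrC -mulrA.
apply: is_derive_eq.
rewrite /GRing.scale /= !fctE /cos_remainder addr0 mulr1; congr (_ - _).
  by rewrite addrA cosDpihalf.
rewrite big_ord_recl /= !mul0r ?mulr0 ?mul0r add0r; apply: eq_bigr => i _.
rewrite /bump /= add1n ?fctE mulr1 factS natrM -[i.+1%:R in X in cos (_ + X)]natr1.
rewrite (_ : th + (i%:R + 1) * (pi / 2) = th + pi / 2 + i%:R * (pi / 2)); last by ring.
have i1 : i.+1%:R != 0 :> R by rewrite pnatr_eq0.
have fi : i`!%:R != 0 :> R by rewrite pnatr_eq0 -lt0n fact_gt0.
move: i1 fi; move: (i.+1%:R : R) (i`!%:R : R) => a b a0 b0.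
by field; rewrite a0 b0.
Qed.

Lemma le_of_derive_le (f f' : R -> R) p : f 0 = 0 ->
  (forall y, is_derive y 1 f (f' y)) ->
  (forall y, 0 <= y -> f' y <= y ^+ p / p`!%:R) ->
  forall y, 0 <= y -> f y <= y ^+ p.+1 / (p.+1)`!%:R.
Proof.
move=> f0 df f'p y; rewrite le_eqVlt => /predU1P[<-|y0].
  by rewrite f0 exprS !mul0r.
pose g : R -> R := ((p.+1)`!%:R^-1 : R) *: (id ^+ p.+1) - f.
have dg (z : R) : is_derive z 1 g (z ^+ p / p`!%:R - f' z).
  rewrite /g; apply: is_derive_eq; congr (_ - _).
  rewrite /GRing.scale /= ?fctE mulr1 factS natrM.
  have i1 : p.+1%:R != 0 :> R by rewrite pnatr_eq0.
  have fi : p`!%:R != 0 :> R by rewrite pnatr_eq0 -lt0n fact_gt0.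
  move: i1 fi; move: (p.+1%:R : R) (p`!%:R : R) => a b a0 b0.
  by field; rewrite a0 b0.
have cg : {within `[0, y], continuous g}.
  apply: continuous_subspaceT => z; apply: differentiable_continuous.
  by apply/derivable1_diffP; have [] := dg z.
have [c + gE] := MVT y0 (fun z _ => dg z) cg.
rewrite in_itv /= => /andP[c0 _].
have : 0 <= g y - g 0.
  by rewrite gE mulr_ge0 ?subr0 ?(ltW y0)// subr_ge0 f'p// ltW.
by rewrite /g !fctE f0 /GRing.scale /= !exprS mul0r mulr0 !subr0 subr_ge0 mulrC.
Qed.

Lemma cos_remainder0 p th : (0 < p)%N -> cos_remainder p th 0 = 0.
Proof.
case: p => // p _; rewrite /cos_remainder add0r big_ord_recl /= mul0r addr0 expr0.
rewrite fact0 divr1 mulr1 big1 ?addr0 ?subrr// => i _.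
by rewrite /bump /= exprS !mul0r mulr0.
Qed.

Lemma cos_remainder_le_pos p th y : 0 <= y ->
  `|cos_remainder p th y| <= y ^+ p / p`!%:R.
Proof.
elim: p th y => [|p IH] th y y0.
  by rewrite /cos_remainder big_ord0 subr0 expr0 divr1 cos_max.
rewrite ler_norml lerNl; apply/andP; split.
  apply: (@le_of_derive_le (fun y => - cos_remainder p.+1 th y)
    (fun y => - cos_remainder p (th + pi / 2) y)) => //.
  - by rewrite cos_remainder0// oppr0.
  - by move=> z; have := is_derive_cos_remainder p th z; exact: is_deriveN.
  - by move=> z z0; apply: le_trans (IH (th + pi / 2) z z0); rewrite -normrN ler_norm.
apply: (@le_of_derive_le _ (cos_remainder p (th + pi / 2))) => //.
- by rewrite cos_remainder0.
- exact: is_derive_cos_remainder.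
- by move=> z z0; apply: le_trans (IH (th + pi / 2) z z0); exact: ler_norm.
Qed.

Lemma cos_shift_pihalf th i : cos (- th + i%:R * (pi / 2)) = (-1) ^+ i * cos (th + i%:R * (pi / 2)) :> R.
Proof.
elim: i th => [|i IH] th; first by rewrite mul0r !addr0 cosN expr0 mul1r.
have E t : t + i.+1%:R * (pi / 2) = t + pi / 2 + i%:R * (pi / 2) :> R.
  by rewrite -natr1; ring.
rewrite !E (_ : - th + pi / 2 = - (th + pi / 2) + pi) /=; last by field.
by rewrite addrAC cosDpi IH exprS mulN1r mulNr.
Qed.

Lemma cos_remainder_le p th y : `|cos_remainder p th y| <= `|y| ^+ p / p`!%:R.
Proof.
have [y0|y0] := leP 0 y; first by rewrite [`|y|]ger0_norm//; exact: cos_remainder_le_pos.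
rewrite [`|y|]ltr0_norm//.
have -> : cos_remainder p th y = cos_remainder p (- th) (- y).
  rewrite /cos_remainder -opprD cosN; congr (_ - _); apply: eq_bigr => i _.
  rewrite cos_shift_pihalf [(- y) ^+ i]exprNn.
  have : (-1) ^+ i * (-1) ^+ i = 1 :> R by rewrite -expr2 sqrr_sign.
  move: ((-1) ^+ i : R) (y ^+ i) (i`!%:R^-1 : R) (cos _) => e z b c ee.
  by rewrite -[e * z * b]mulrA mulrACA ee mul1r.
by apply: cos_remainder_le_pos; rewrite oppr_ge0 ltW.
Qed.

End CosineTaylor.

Section CosineMoments.
Context {R : realType}.

Lemma measurable_cos_shift {d : measure_display} {T : measurableType d} (U : T -> R) (th : R) :
  measurable_fun setT U -> measurable_fun setT (fun w => cos (U w + th)).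
Proof.
move=> mU; apply: (measurableT_comp (f := cos)).
  by apply: continuous_measurable_fun; exact: continuous_cos.
exact: measurable_funD.
Qed.

Lemma all_moments_cos_shift {d : measure_display} {T : measurableType d}
    (P : probability T R) (U : T -> R) (th : R) :
  measurable_fun setT U -> all_moments P (fun w => cos (U w + th)).
Proof.
move=> mU; apply: (@all_moments_bounded _ _ _ _ _ 1); first exact: measurable_cos_shift.
by move=> w; exact: cos_max.
Qed.

(** The order is even so that the remainder is bounded by [U w ^+ (q + q)], an ordinary moment
    without absolute value. *)
Lemma mean_cos_taylor {d : measure_display} {T : measurableType d}
    (P : probability T R) (U : T -> R) (th : R) q :
  all_moments P U ->
  `|mean P (fun w => cos (U w + th)) -
    \sum_(i < q + q) cos (th + i%:R * (pi / 2)) / i`!%:R * mean P (fun w => U w ^+ i)|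
  <= mean P (fun w => U w ^+ (q + q)) / (q + q)`!%:R.
Proof.
move=> aU; have mU := all_moments_measurable aU.
have aX i := all_momentsX i aU.
have ac := all_moments_cos_shift P th mU.
have aS : all_moments P (fun w => \sum_(i < q + q) cos (th + i%:R * (pi / 2)) / i`!%:R * U w ^+ i).
  by apply: all_moments_sum => i _; exact: all_momentsZ.
have -> : \sum_(i < q + q) cos (th + i%:R * (pi / 2)) / i`!%:R * mean P (fun w => U w ^+ i) =
    mean P (fun w => \sum_(i < q + q) cos (th + i%:R * (pi / 2)) / i`!%:R * U w ^+ i).
  rewrite mean_sum; last by move=> i _; exact: all_momentsZ.
  by apply: eq_bigr => i _; rewrite meanZ.
rewrite -meanB//; apply: le_trans (normr_mean _) _; first exact: all_momentsB.
rewrite [leRHS]mulrC -meanZ//; apply: le_mean.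
- by apply: all_moments_abs; exact: all_momentsB.
- exact: all_momentsZ.
- move=> w; rewrite [leRHS]mulrC.
  have -> : U w ^+ (q + q) = `|U w| ^+ (q + q).
    by rewrite addnn -mul2n exprM [RHS]exprM real_normK ?num_real.
  apply: le_trans (cos_remainder_le (q + q) th (U w)).
  rewrite le_eqVlt; apply/orP; left; apply/eqP; congr `|_ - _|.
  by apply: eq_bigr => i _; rewrite [RHS]mulrA mulrAC.
Qed.

(** The last hypothesis makes the Taylor remainder for [Y] small at some order [q]; since the moment
    of order [q + q] converges, the same [q] eventually works for [U n], and the Taylor sums
    converge term by term. *)
Lemma mean_cos_cvg {d : measure_display} {T : measurableType d} (P : probability T R)
    {d' : measure_display} {T' : measurableType d'} (Q : probability T' R)
    (U : nat -> T -> R) (Y : T' -> R) (th : R) :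
  (forall n, all_moments P (U n)) -> all_moments Q Y ->
  (forall p, mean P (fun w => U n w ^+ p) @[n --> \oo] --> mean Q (fun w => Y w ^+ p)) ->
  (forall e : R, 0 < e -> exists q, mean Q (fun w => Y w ^+ (q + q)) / (q + q)`!%:R <= e) ->
  mean P (fun w => cos (U n w + th)) @[n --> \oo] --> mean Q (fun w => cos (Y w + th)).
Proof.
move=> aU aY UY small; apply/cvgrPdist_le => e e0.
(* The remainder for [U n] costs two quarters, the remainder for [Y] one, and the difference of the
   Taylor sums one. *)
have e4 : 0 < e / 4 by rewrite divr_gt0.
have [q qe] := small _ e4.
pose c i : R := cos (th + i%:R * (pi / 2)) / i`!%:R.
pose SU n := \sum_(i < q + q) c i * mean P (fun w => U n w ^+ i).
pose SY := \sum_(i < q + q) c i * mean Q (fun w => Y w ^+ i).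
have cS : SU n @[n --> \oo] --> SY.
  by apply: cvgn_sum => i _; apply: cvgM; [exact: cvg_cst|exact: UY].
near=> n.
have H1 := mean_cos_taylor th q (aU n).
have H2 := mean_cos_taylor th q aY.
rewrite -/(SU n) in H1; rewrite -/SY in H2.
have H3 : `|SY - SU n| <= e / 4 by near: n; move/cvgrPdist_le : cS; exact.
have H4 : mean P (fun w => U n w ^+ (q + q)) / (q + q)`!%:R <= e / 4 + e / 4.
  have H5 : `|mean Q (fun w => Y w ^+ (q + q)) / (q + q)`!%:R - mean P (fun w => U n w ^+ (q + q)) / (q + q)`!%:R| <= e / 4.
    near: n; have : mean P (fun w => U n w ^+ (q + q)) / (q + q)`!%:R @[n --> \oo] -->
      mean Q (fun w => Y w ^+ (q + q)) / (q + q)`!%:R.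
      by apply: cvgM; [exact: UY|exact: cvg_cst].
    by move/cvgrPdist_le; exact.
  move: H5; rewrite ler_norml => /andP[H5 _]; lra.
move: H1 H2 H3; rewrite !ler_norml => /andP[? ?] /andP[? ?] /andP[? ?].
apply/andP; split; lra.
Unshelve. all: by end_near. Qed.

End CosineMoments.

(** * Algebra and regularity of trigonometric polynomials *)

Section TrigonometricPolynomials.
Context {R : realType} {m : nat}.
Notation E := 'rV[R]_m.

(** The phase [th] brings in the sines and, through the product-to-sum formula, stability under
    products. Every generator is the cosine of a linear form, so one-dimensional moments suffice for
    its mean. *)
Inductive trig_poly : (E -> R) -> Prop :=
| TrigCos t th : trig_poly (fun x => cos (\sum_j t j * x ord0 j + th))
| TrigD f g : trig_poly f -> trig_poly g -> trig_poly (fun x => f x + g x)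
| TrigZ c f : trig_poly f -> trig_poly (fun x => c * f x).

Lemma trig_poly_ext f g : trig_poly f -> f =1 g -> trig_poly g.
Proof. by move=> tf /funext <-. Qed.

Lemma trig_poly_cst c : trig_poly (fun=> c).
Proof.
apply: (trig_poly_ext (TrigZ c (TrigCos (fun=> 0) 0))) => x.
by rewrite big1 ?add0r ?cos0 ?mulr1// => j _; rewrite mul0r.
Qed.

Lemma trig_polyM f g : trig_poly f -> trig_poly g -> trig_poly (fun x => f x * g x).
Proof.
elim=> [t th|f1 f2 _ IH1 _ IH2|c f1 _ IH1] tg; last 2 first.
- by apply: (trig_poly_ext (TrigD (IH1 tg) (IH2 tg))) => x; rewrite mulrDl.
- by apply: (trig_poly_ext (TrigZ c (IH1 tg))) => x; rewrite mulrA.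
elim: tg => [t' th'|g1 g2 _ IH1 _ IH2|c g1 _ IH1]; last 2 first.
- by apply: (trig_poly_ext (TrigD IH1 IH2)) => x; rewrite mulrDr.
- by apply: (trig_poly_ext (TrigZ c IH1)) => x; rewrite mulrCA.
have H := TrigZ 2^-1 (TrigD (TrigCos (fun j => t j + t' j) (th + th'))
  (TrigCos (fun j => t j - t' j) (th - th'))).
apply: (trig_poly_ext H) => x /=.
set a := \sum_j t j * _ + th; set b := \sum_j t' j * _ + th'.
have -> : \sum_j (t j + t' j) * x ord0 j + (th + th') = a + b.
  by under eq_bigr do rewrite mulrDl; rewrite big_split /= /a /b; ring.
have -> : \sum_j (t j - t' j) * x ord0 j + (th - th') = a - b.
  by under eq_bigr do rewrite mulrBl; rewrite sumrB /= /a /b; ring.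
by rewrite cosD cosB; field.
Qed.

Lemma trig_poly_prod (I : Type) (s : seq I) (f : I -> E -> R) :
  (forall i, trig_poly (f i)) -> trig_poly (fun x => \prod_(i <- s) f i x).
Proof.
move=> tf; elim: s => [|i s IH].
  by apply: (trig_poly_ext (trig_poly_cst 1)) => x; rewrite big_nil.
by apply: (trig_poly_ext (trig_polyM (tf i) IH)) => x; rewrite big_cons.
Qed.

Lemma trig_poly_sin j (a : R) : trig_poly (fun x => sin (a * x ord0 j)).
Proof.
apply: (trig_poly_ext (TrigCos (fun i => if i == j then a else 0) (- (pi / 2)))) => x.
rewrite (bigD1 j)//= eqxx big1 ?addr0 ?cosBpihalf// => i /negbTE ->.
by rewrite mul0r.
Qed.

Lemma cos_lipschitz (a b : R) : `|cos a - cos b| <= `|a - b|.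
Proof.
have [->|ab] := eqVneq a b; first by rewrite !subrr normr0.
wlog lab : a b ab / a < b.
  move=> H; move: (ab); rewrite neq_lt => /orP[|ba]; first exact: H.
  by rewrite distrC [leRHS]distrC; apply: H => //; rewrite eq_sym.
have cc : {within `[a, b], continuous (@cos R)}.
  by apply: continuous_subspaceT; exact: continuous_cos.
have [c _ E1] := MVT lab (fun x _ => is_derive_cos x) cc.
rewrite distrC E1 normrM [leRHS]distrC normrN ler_piMl//; exact: sin_max.
Qed.

Definition bounded_lipschitz (g : E -> R) := exists C : R,
  (forall x, `|g x| <= C) /\
  forall x y, `|g x - g y| <= C * \sum_j `|x ord0 j - y ord0 j|.

Lemma trig_poly_lipschitz g : trig_poly g -> bounded_lipschitz g.
Proof.
elim=> [t th|f1 f2 _ [C1 [B1 L1]] _ [C2 [B2 L2]]|c f1 _ [C1 [B1 L1]]].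
- pose C : R := 1 + \sum_j `|t j|.
  have S0 : 0 <= \sum_j `|t j| by exact: sumr_ge0.
  have C1 : 1 <= C by rewrite lerDl.
  exists C; split=> [x|x y]; first by rewrite (le_trans (cos_max _)).
  apply: le_trans (cos_lipschitz _ _) _.
  rewrite opprD addrACA subrr addr0 -sumrB; apply: le_trans (ler_norm_sum _ _ _) _.
  rewrite mulr_sumr; apply: ler_sum => j _; rewrite -mulrBr normrM ler_wpM2r//.
  by rewrite /C (bigD1 j)//= addrCA lerDl addr_ge0// sumr_ge0.
- exists (C1 + C2); split=> [x|x y].
    by rewrite (le_trans (ler_normD _ _))// lerD.
  rewrite opprD addrACA (le_trans (ler_normD _ _))// mulrDl lerD//.
- exists (`|c| * C1); split=> [x|x y]; first by rewrite normrM ler_wpM2l.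
  by rewrite -mulrBr normrM -mulrA ler_wpM2l.
Qed.

Lemma trig_poly_measurable {d : measure_display} {T : measurableType d}
    (g : E -> R) (Y : 'I_m -> T -> R) : trig_poly g ->
  (forall j, measurable_fun setT (Y j)) ->
  measurable_fun setT (fun w => g (\row_j Y j w)).
Proof.
move=> tg mY; elim: tg => [t th|f1 f2 _ IH1 _ IH2|c f1 _ IH1].
- under eq_fun do under eq_bigr do rewrite mxE.
  apply: measurable_cos_shift; apply: measurable_sum => j.
  exact: measurable_funM.
- exact: measurable_funD.
- exact: measurable_funM.
Qed.

Lemma trig_poly_all_moments {d : measure_display} {T : measurableType d}
    (P : probability T R) (g : E -> R) (Y : 'I_m -> T -> R) : trig_poly g ->
  (forall j, measurable_fun setT (Y j)) ->
  all_moments P (fun w => g (\row_j Y j w)).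
Proof.
move=> tg mY; have [C [Bg _]] := trig_poly_lipschitz tg.
by apply: (@all_moments_bounded _ _ _ _ _ C) => //; exact: trig_poly_measurable.
Qed.

End TrigonometricPolynomials.

(** * Convergence of means of trigonometric test functions *)

Section TrigonometricConvergence.
Context {R : realType} {d : measure_display} {T : measurableType d} {P : probability T R}.
Variable X : nat -> nat -> {RV P >-> R}.
Variable B : nat -> R.
Hypothesis X_moments : forall i j, moments_le P B (X i j).
Hypothesis X_indep : mutually_independent (fun e : nat * nat => X e.1 e.2).
Hypothesis X_mean : forall i j, mean P (X i j) = 0.
Hypothesis X_var : forall i j, mean P (fun w => X i j w ^+ 2) = 1.
Context {d' : measure_display} {T' : measurableType d'} {Q : probability T' R}.
Variables (m : nat) (k : 'I_m -> nat) (Z : 'I_m -> {RV Q >-> R}).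
Hypothesis m_gt0 : (0 < m)%N.
Hypothesis k_ge1 : forall j, (0 < k j)%N.
Hypothesis k_inj : injective k.
Hypothesis Z_indep : mutually_independent Z.
Hypothesis Z_gauss : forall j, centered_gaussian (k j)%:R (Z j).

Let aZ j : all_moments Q (Z j) := all_moments_gaussian (k_ge1 j) (Z_gauss j).
Let aW n j : all_moments P (centered_tr_power X n (k j)).
Proof. exact: (all_moments_centered_tr_power X_moments). Qed.

Lemma mean_linear_pow {d1 : measure_display} {T1 : measurableType d1} (P1 : probability T1 R)
    (U : 'I_m -> T1 -> R) (t : 'I_m -> R) p : (forall j, all_moments P1 (U j)) ->
  mean P1 (fun w => (\sum_j t j * U j w) ^+ p) =
  \sum_(a : {ffun 'I_p -> 'I_m}) (\prod_i t (a i)) *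
     mean P1 (fun w => \prod_(j <- [seq a i | i <- enum 'I_p]) U j w).
Proof.
move=> aU.
have ap (s : seq 'I_m) : all_moments P1 (fun w => \prod_(j <- s) U j w).
  exact: all_moments_prod.
have -> : (fun w => (\sum_j t j * U j w) ^+ p) = fun w => \sum_(a : {ffun 'I_p -> 'I_m})
    (\prod_i t (a i)) * \prod_(j <- [seq a i | i <- enum 'I_p]) U j w.
  apply/funext => w.
  rewrite -[p in LHS]card_ord -prodr_const bigA_distr_bigA; apply: eq_bigr => a _.
  by rewrite big_split /= big_map big_enum.
rewrite mean_sum; last by move=> a _; exact: all_momentsZ.
by apply: eq_bigr => a _; rewrite meanZ.
Qed.

Lemma linear_moment_cvg (t : 'I_m -> R) p :
  mean P (fun w => (\sum_j t j * centered_tr_power X n (k j) w) ^+ p) @[n --> \oo] -->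
  mean Q (fun w => (\sum_j t j * Z j w) ^+ p).
Proof.
rewrite mean_linear_pow//; under eq_fun do rewrite mean_linear_pow//.
apply: cvgn_sum => a _; apply: cvgM; first exact: cvg_cst.
exact: (trace_moment_cvg X_moments X_indep X_mean X_var k_ge1 k_inj Z_indep Z_gauss).
Qed.

(** The right-hand side is a coefficient of the exponential series; hence it tends to 0, as
    [mean_cos_cvg] requires. *)
Lemma gaussian_even_moment j q :
  mean Q (fun w => Z j w ^+ (q + q)) / (q + q)`!%:R = ((k j)%:R / 2) ^+ q / q`!%:R.
Proof.
elim: q => [|q IH].
  rewrite !expr0 !fact0 !divr1.
  by under [X in mean Q X]funext => w do rewrite expr0; exact: mean_cst.
rewrite addSn addnS (mean_gaussian_recursion (v := k j))// !factS exprS.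
have f0 p : p`!%:R != 0 :> R by rewrite pnatr_eq0 -lt0n fact_gt0.
have s0 p : p.+1%:R != 0 :> R by rewrite pnatr_eq0.
have -> : mean Q (fun w => Z j w ^+ (q + q)) = ((k j)%:R / 2) ^+ q / q`!%:R * (q + q)`!%:R.
  by rewrite -IH divfK.
rewrite !natrM.
have -> : (q + q).+2%:R = 2 * q.+1%:R :> R.
  by rewrite -natrM; congr (_%:R); lia.
move: (f0 q) (f0 (q + q)%N) (s0 q) (s0 (q + q)%N).
move: (q`!%:R : R) ((q + q)`!%:R : R) (q.+1%:R : R) ((q + q).+1%:R : R) => a b c e a0 b0 c0 e0.
by field; rewrite a0 b0 c0 e0.
Qed.

Lemma sum_pow_le (I : finType) (i0 : I) (u : I -> R) q :
  (\sum_i u i) ^+ (q + q) <= #|I|%:R ^+ (q + q) * \sum_i u i ^+ (q + q).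
Proof.
have ev (x : R) : x ^+ (q + q) = `|x| ^+ (q + q).
  by rewrite addnn -mul2n exprM [RHS]exprM real_normK ?num_real.
pose i1 := [arg max_(i > i0) `|u i|]%O.
have i1P i : `|u i| <= `|u i1|.
  by rewrite /i1; case: arg_maxP => // i' _; apply.
rewrite ev; apply: (@le_trans _ _ ((#|I|%:R * `|u i1|) ^+ (q + q))).
  rewrite lerXn2r ?nnegrE ?mulr_ge0//; apply: le_trans (ler_norm_sum _ _ _) _.
  rewrite mulr_natl -sumr_const; apply: ler_sum => i _; exact: i1P.
rewrite exprMn ler_wpM2l ?exprn_ge0// (bigD1 i1)//= [u i1 ^+ _]ev lerDl.
by apply: sumr_ge0 => i _; rewrite ev exprn_ge0.
Qed.

Lemma gaussian_linear_small (t : 'I_m -> R) (e : R) : 0 < e ->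
  exists q, mean Q (fun w => (\sum_j t j * Z j w) ^+ (q + q)) / (q + q)`!%:R <= e.
Proof.
move=> e0.
(* The factor [m] comes from [sum_pow_le], which bounds a sum of [m] terms by [m] times the largest,
   and [(k j)%:R / 2] from [gaussian_even_moment]. *)
pose c j : R := (m%:R * t j) ^+ 2 * ((k j)%:R / 2).
have le q : mean Q (fun w => (\sum_j t j * Z j w) ^+ (q + q)) / (q + q)`!%:R <=
    \sum_j exp_coeff (c j) q.
  have aU : all_moments Q (fun w => \sum_j t j * Z j w).
    by apply: all_moments_sum => j _; exact: all_momentsZ.
  have aV j : all_moments Q (fun w => t j ^+ (q + q) * Z j w ^+ (q + q)).
    by apply: all_momentsZ; exact: all_momentsX.
  apply: (@le_trans _ _ (mean Q (fun w => m%:R ^+ (q + q) *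
      \sum_j t j ^+ (q + q) * Z j w ^+ (q + q)) / (q + q)`!%:R)).
    rewrite ler_wpM2r// ?invr_ge0//; apply: le_mean.
    - exact: all_momentsX.
    - by apply: all_momentsZ; exact: all_moments_sum.
    - move=> w; have := sum_pow_le (Ordinal m_gt0) (fun j => t j * Z j w) q; rewrite card_ord.
      by under [X in _ <= _ * X -> _]eq_bigr do rewrite exprMn.
  rewrite meanZ; last exact: all_moments_sum.
  rewrite mean_sum// mulr_sumr mulr_suml; apply: ler_sum => j _.
  rewrite meanZ; last exact: all_momentsX.
  rewrite mulrA -exprMn -mulrA gaussian_even_moment /exp_coeff /= mulrA /c exprMn.
  by rewrite -exprMn [leRHS](_ : _ = (m%:R * t j) ^+ (q + q) * ((k j)%:R / 2) ^+ q / q`!%:R)// exprMn -exprM addnn mul2n.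
have cvg0 : \sum_j exp_coeff (c j) q @[q --> \oo] --> \sum_(j < m) (0 : R).
  by apply: cvgn_sum => j _; exact: cvg_exp_coeff.
rewrite big1// in cvg0.
have [q _ qP] : \forall q \near \oo, `|0 - \sum_j exp_coeff (c j) q| <= e.
  by move/cvgrPdist_le : cvg0; exact.
exists q; apply: le_trans (le q) _; apply: le_trans (ler_norm _) _.
by rewrite -normrN -sub0r; apply: qP => /=.
Qed.

Lemma trig_mean_cvg (g : 'rV[R]_m -> R) : trig_poly g ->
  mean P (fun w => g (\row_j centered_tr_power X n (k j) w)) @[n --> \oo] -->
  mean Q (fun w => g (\row_j Z j w)).
Proof.
have mW n j : measurable_fun setT (centered_tr_power X n (k j)).
  exact: all_moments_measurable (aW n j).
have mZ j : measurable_fun setT (Z j) by exact: measurable_funP.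
elim=> [t th|f1 f2 t1 IH1 t2 IH2|c f1 t1 IH1].
- have rowE (U : 'I_m -> R) : \sum_j t j * (\row_j U j : 'rV[R]_m) ord0 j = \sum_j t j * U j.
    by apply: eq_bigr => j _; rewrite mxE.
  have EP n : mean P (fun w => cos (\sum_j t j *
      (\row_j centered_tr_power X n (k j) w : 'rV[R]_m) ord0 j + th)) =
      mean P (fun w => cos (\sum_j t j * centered_tr_power X n (k j) w + th)).
    by congr (mean P _); apply/funext => w; rewrite rowE.
  have -> : mean Q (fun w => cos (\sum_j t j * (\row_j Z j w : 'rV[R]_m) ord0 j + th)) =
      mean Q (fun w => cos (\sum_j t j * Z j w + th)).
    by congr (mean Q _); apply/funext => w; rewrite rowE.
  under eq_fun do rewrite EP.
  apply: (@mean_cos_cvg _ _ _ P _ _ Q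
    (fun n w => \sum_j t j * centered_tr_power X n (k j) w)
    (fun w => \sum_j t j * Z j w)).
  + by move=> n; apply: all_moments_sum => j _; exact: all_momentsZ.
  + by apply: all_moments_sum => j _; exact: all_momentsZ.
  + exact: linear_moment_cvg.
  + exact: gaussian_linear_small.
- rewrite (meanD (trig_poly_all_moments Q t1 mZ) (trig_poly_all_moments Q t2 mZ)).
  under eq_fun => n do rewrite (meanD (trig_poly_all_moments P t1 (mW n))
    (trig_poly_all_moments P t2 (mW n))).
  exact: (@cvgD _ R^o).
- rewrite (meanZ c (trig_poly_all_moments Q t1 mZ)).
  under eq_fun => n do rewrite (meanZ c (trig_poly_all_moments P t1 (mW n))).
  by apply: cvgM; [exact: cvg_cst|].
Qed.

End TrigonometricConvergence.

(** * Almost sure convergence of logarithmic averages *)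

Section LogarithmicAverages.
Context {R : realType}.

Definition harm (N : nat) : R := \sum_(1 <= n < N.+1) n%:R^-1.

Lemma harmS N : harm N.+1 = harm N + N.+1%:R^-1.
Proof. by rewrite /harm big_nat_recr. Qed.

Lemma harm0 : harm 0 = 0. Proof. by rewrite /harm big_geq. Qed.

Lemma ln_natS_ge N : (0 < N)%N -> N.+1%:R^-1 <= ln (N.+1%:R : R) - ln (N%:R : R).
Proof.
move=> N0; have n0 : (0 : R) < N%:R by rewrite ltr0n.
have s0 : (0 : R) < N.+1%:R by rewrite ltr0n.
rewrite -lerN2 opprB -ln_div ?posrE//.
have -> : N%:R / N.+1%:R = 1 + - (N.+1%:R^-1) :> R.
  by apply/eqP; rewrite eq_sym -subr_eq0 -natr1 eq_sym; apply/eqP; field; rewrite natr1 gt_eqF.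
apply: le_ln1Dx; rewrite ltrN2 invf_lt1// ltr1n; lia.
Qed.

Lemma ln_natS_le N : (0 < N)%N -> ln (N.+1%:R : R) - ln (N%:R : R) <= N%:R^-1.
Proof.
move=> N0; have n0 : (0 : R) < N%:R by rewrite ltr0n.
have s0 : (0 : R) < N.+1%:R by rewrite ltr0n.
rewrite -ln_div ?posrE//.
have -> : N.+1%:R / N%:R = 1 + N%:R^-1 :> R.
  by rewrite -natr1 mulrDl divff ?gt_eqF// mul1r.
by apply: le_ln1Dx; apply: lt_trans (_ : 0 < _); rewrite ?ltrN10// invr_gt0.
Qed.

Lemma harm_le N : (0 < N)%N -> harm N <= 1 + ln (N%:R : R).
Proof.
elim: N => // -[_ _|N IH _]; first by rewrite harmS harm0 add0r invr1 ln1 addr0.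
rewrite harmS; have := IH isT; have := ln_natS_ge (ltn0Sn N).
move: (ln _) (ln _) (_^-1) (harm _) => a b c h; lra.
Qed.

Lemma harm_sub M N : (0 < M <= N)%N -> harm N - harm M <= ln (N%:R : R) - ln (M%:R : R).
Proof.
move=> /andP[M0]; elim: N => [|N IH]; first by case: M M0.
rewrite leq_eqVlt => /predU1P[->|]; first by rewrite !subrr.
rewrite ltnS => MN; have N0 : (0 < N)%N by exact: leq_trans MN.
rewrite harmS; have := IH MN; have := ln_natS_ge N0.
move: (ln _) (ln _) (ln _) (_^-1) (harm _) (harm _) => a b c i h h'; lra.
Qed.

Lemma harm_ge N : (0 < N)%N -> ln (N%:R : R) <= harm N.
Proof.
suff H : ln (N.+1%:R : R) <= harm N.
  move=> N0; apply: le_trans H; rewrite ler_ln ?posrE ?ltr0n ?ler_nat//.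
elim: N => [|N IH]; first by rewrite harm0 ln1.
rewrite harmS; move: IH (ln_natS_le (ltn0Sn N)).
move: (ln _) (ln _) (_^-1) (harm _) => a b c h; lra.
Qed.

Lemma sum_inv_sqrt_le N : \sum_(1 <= n < N.+1) (Num.sqrt n%:R)^-1 <= 2 * Num.sqrt N%:R :> R.
Proof.
elim: N => [|N IH]; first by rewrite big_geq// mulr_ge0.
rewrite big_nat_recr//=; apply: le_trans (lerD IH (lexx _)) _.
set a : R := Num.sqrt N%:R; set b : R := Num.sqrt N.+1%:R.
have a0 : 0 <= a by exact: sqrtr_ge0.
have b0 : 0 < b by rewrite sqrtr_gt0 ltr0n.
have a2 : a * a = N%:R by rewrite -expr2 sqr_sqrtr.
have b2 : b * b = N%:R + 1 by rewrite -expr2 sqr_sqrtr// natr1.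
rewrite -lerBrDl -[X in X <= _]mul1r ler_pdivrMr//.
have := sqr_ge0 (b - a); rewrite sqrrB !expr2 a2 b2; lra.
Qed.

Section SecondMoment.
Context {d : measure_display} {T : measurableType d} {P : probability T R}.
Variables (xi : nat -> T -> R) (C0 C1 : R).
Hypothesis xi_measurable : forall n, measurable_fun setT (xi n).
Hypothesis xi_bounded : forall n w, `|xi n w| <= C0.
Hypothesis xi_cov : forall n l, (0 < n <= l)%N ->
  `|mean P (fun w => xi n w * xi l w)| <= C1 * (Num.sqrt n%:R / Num.sqrt l%:R).

Definition weighted_sum N w : R := \sum_(1 <= n < N.+1) n%:R^-1 * xi n w.

Let a_xi n : all_moments P (xi n).
Proof. exact: all_moments_bounded (xi_measurable n) (xi_bounded n). Qed.

Let C1_ge0 : 0 <= C1.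
Proof.
have := @xi_cov 1 1 isT; rewrite divff ?sqrtr1 ?oner_eq0// mulr1.
by apply: le_trans.
Qed.

Lemma all_moments_weighted_sum N : all_moments P (weighted_sum N).
Proof. by apply: all_moments_sum => n _; exact: all_momentsZ. Qed.

(** Adding the term of index [n] costs at most [5 * C1 / n]: the cross term is [2 / n] times at most
    [2 * C1], because the sum of [1 / sqrt (i * n)] over [i < n] is at most 2, and the square is at
    most [C1 / n ^ 2]. *)
Lemma mean_weighted_sum_sq N : mean P (fun w => weighted_sum N w ^+ 2) <= 5 * C1 * harm N.
Proof.
elim: N => [|N IH].
  rewrite harm0 mulr0; under [X in mean P X]funext => w do rewrite /weighted_sum big_geq// expr0n.
  by rewrite (mean_cst P 0).
set n := N.+1; set S := weighted_sum N in IH *.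
have n0 : (0 : R) < n%:R by rewrite ltr0n.
have aS : all_moments P S := all_moments_weighted_sum N.
have -> : mean P (fun w => weighted_sum n w ^+ 2) =
    mean P (fun w => S w ^+ 2) + 2 * n%:R^-1 * mean P (fun w => S w * xi n w) +
    n%:R^-1 ^+ 2 * mean P (fun w => xi n w * xi n w).
  have aSx : all_moments P (fun w => S w * xi n w) by exact: all_momentsM.
  have axx : all_moments P (fun w => xi n w * xi n w) by exact: all_momentsM.
  rewrite -meanZ// -meanZ// -meanD; [|exact: all_momentsX|exact: all_momentsZ].
  rewrite -meanD; [|by apply: all_momentsD; [exact: all_momentsX|exact: all_momentsZ]|exact: all_momentsZ].
  congr (mean P _); apply/funext => w; rewrite /weighted_sum big_nat_recr//= -/(weighted_sum N w) -/S -/n.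
  by ring.
have H1 : `|mean P (fun w => S w * xi n w)| <= C1 * 2.
  have -> : mean P (fun w => S w * xi n w) =
      \sum_(1 <= i < N.+1) i%:R^-1 * mean P (fun w => xi i w * xi n w).
    transitivity (mean P (fun w => \sum_(1 <= i < N.+1) i%:R^-1 * (xi i w * xi n w))).
      congr (mean P _); apply/funext => w; rewrite /S /weighted_sum mulr_suml.
      by apply: eq_bigr => i _; rewrite mulrA.
    rewrite mean_sum => [|i _]; last by apply: all_momentsZ; exact: all_momentsM.
    by apply: eq_bigr => i _; rewrite meanZ//; exact: all_momentsM.
  apply: le_trans (ler_norm_sum _ _ _) _.
  have sn0 : 0 < Num.sqrt (n%:R : R) by rewrite sqrtr_gt0.
  apply: (@le_trans _ _ (C1 / Num.sqrt n%:R * \sum_(1 <= i < N.+1) (Num.sqrt i%:R)^-1)).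
    rewrite mulr_sumr; apply: ler_sum_nat => i /andP[i1 iN].
    have i0 : (0 : R) < i%:R by rewrite ltr0n.
    have si0 : 0 < Num.sqrt (i%:R : R) by rewrite sqrtr_gt0.
    rewrite normrM ger0_norm ?invr_ge0//.
    have := xi_cov (n := i) (l := n); rewrite i1 /n ltnW// => /(_ isT) H.
    apply: le_trans (ler_wpM2l _ H) _; first by rewrite invr_ge0.
    have {1}-> : i%:R = Num.sqrt i%:R * Num.sqrt i%:R :> R by rewrite -expr2 sqr_sqrtr// ltW.
    rewrite le_eqVlt; apply/orP; left; apply/eqP.
    by field; rewrite !gt_eqF.
  apply: le_trans (ler_wpM2l _ (sum_inv_sqrt_le N)) _.
    by rewrite divr_ge0// ltW.
  have sNn : Num.sqrt N%:R <= Num.sqrt n%:R :> R by rewrite ler_wsqrtr// ler_nat.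
  rewrite [leLHS](_ : _ = C1 * 2 * (Num.sqrt N%:R / Num.sqrt n%:R)); last by ring.
  by rewrite ler_piMr ?mulr_ge0// ler_pdivrMr// mul1r.
have H2 : `|mean P (fun w => xi n w * xi n w)| <= C1.
  have := xi_cov (n := n) (l := n); rewrite /= leqnn => /(_ isT).
  by rewrite divff ?mulr1// gt_eqF// sqrtr_gt0.
rewrite harmS -/n mulrDr.
have in1 : n%:R^-1 <= 1 :> R by rewrite invf_le1// ler1n.
have in0 : 0 <= n%:R^-1 :> R by rewrite invr_ge0 ltW.
move: H1 H2 in1 in0 IH; rewrite !ler_norml.
set u := mean P _; set v := mean P _; move: (n%:R^-1 : R) (mean P _) => c z.
move=> /andP[_ H1] /andP[_ H2] in1 in0 IH.
have : c * u <= c * (C1 * 2) by rewrite ler_wpM2l.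
have : c ^+ 2 * v <= c * C1.
  apply: (@le_trans _ _ (c ^+ 2 * C1)); first by rewrite ler_wpM2l ?sqr_ge0.
  by rewrite expr2 ler_wpM2r// ler_piMl.
lra.
Qed.

End SecondMoment.
End LogarithmicAverages.

(** * Almost sure convergence along a sparse subsequence, and the gaps *)

Section AlmostSureAverages.
Context {R : realType} {d : measure_display} {T : measurableType d} {P : probability T R}.

Lemma sum_inv_sq_le J : \sum_(j < J) (j.+1%:R ^+ 2)^-1 <= 2 :> R.
Proof.
case: J => [|J]; first by rewrite big_ord0.
suff : \sum_(j < J.+1) (j.+1%:R ^+ 2)^-1 <= 2 - J.+1%:R^-1 :> R.
  by move=> H; apply: le_trans H _; rewrite lerBlDr lerDl invr_ge0.
elim: J => [|J IH]; first by rewrite big_ord1 expr1n invr1; lra.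
rewrite big_ord_recr /=; apply: le_trans (lerD IH (lexx _)) _.
have a0 : (0 : R) < J.+1%:R by rewrite ltr0n.
have -> : J.+2%:R = J.+1%:R + 1 :> R by rewrite natr1.
move: (J.+1%:R : R) a0 => a a0.
have b0 : 0 < a + 1 by rewrite addr_gt0.
have : ((a + 1) ^+ 2)^-1 <= a^-1 - (a + 1)^-1.
  have -> : a^-1 - (a + 1)^-1 = (a * (a + 1))^-1 by field; rewrite !gt_eqF.
  by rewrite lef_pV2 ?posrE ?mulr_gt0 ?exprn_gt0// expr2 ler_wpM2r ?ltW// ltrDl.
move: (_^-1) (_^-1) (_^-1) => x y z; lra.
Qed.

(** The series of squares has finite expectation, so it is finite almost everywhere and its terms
    tend to 0. *)
Lemma ae_cvg0_of_summable (L : nat -> T -> R) (C : R) :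
  (forall n, all_moments P (L n)) ->
  (forall J, \sum_(j < J) mean P (fun w => L j w ^+ 2) <= C) ->
  {ae P, forall w, L n w @[n --> \oo] --> (0 : R)}.
Proof.
move=> aL LC.
pose F w := (\sum_(n <oo) (L n w ^+ 2)%:E)%E.
have mL2 n : measurable_fun setT (fun w => (L n w ^+ 2)%:E).
  by apply/measurable_EFinP; apply: measurable_funX; exact: all_moments_measurable.
have L20 n w : (0 <= (L n w ^+ 2)%:E)%E by rewrite lee_fin sqr_ge0.
have intF : (\int[P]_w F w <= C%:E)%E.
  rewrite integral_nneseries//.
  have E n : (\int[P]_x (L n x ^+ 2)%:E = (mean P (fun w => L n w ^+ 2))%:E)%E.
    rewrite /mean /Rintegral fineK//.
    exact: integrable_fin_num (all_moments_integrable (all_momentsX 2 (aL n))).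
  under eq_eseriesr do rewrite E.
  apply: lime_le.
    by apply: is_cvg_nneseries => n _ _; rewrite lee_fin mean_ge0// => w; exact: sqr_ge0.
  by apply: nearW => J; rewrite sumEFin lee_fin big_mkord; exact: LC.
have iF : P.-integrable setT F.
  apply/integrableP; split.
    apply: ge0_emeasurable_sum => // n w _ _; exact: L20.
  under eq_integral => w _ do rewrite gee0_abs ?nneseries_ge0//.
  exact: le_lt_trans intF (ltry _).
have := integrable_ae measurableT iF; apply: filterS => w /(_ I) Fw.
have Foo : (F w < +oo)%E by rewrite ltey_eq Fw.
have tail := nneseries_tail_cvg Foo (fun n _ => L20 n w).
have L2 : (L n w ^+ 2)%:E @[n --> \oo] --> 0%E.
  apply: (squeeze_cvge _ (cvg_cst 0%E) tail).
  near=> n; rewrite L20 /=.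
  rewrite (@nneseries_split _ _ n 1)//.
  by rewrite addn1 big_nat1 leeDl// nneseries_ge0.
have L2' : L n w ^+ 2 @[n --> \oo] --> (0 : R) by move/fine_cvg : L2.
apply/cvgrPdist_le => e e0.
have e2 : 0 < e ^+ 2 by rewrite exprn_gt0.
move/cvgrPdist_le : L2' => /(_ _ e2); apply: filterS => n.
rewrite !sub0r !normrN normrX => H.
by rewrite -(@ler_pXn2r _ 2)// ?nnegrE// ltW.
Unshelve. all: by end_near. Qed.

Variables (xi : nat -> T -> R) (C0 C1 : R).
Hypothesis xi_measurable : forall n, measurable_fun setT (xi n).
Hypothesis xi_bounded : forall n w, `|xi n w| <= C0.
Hypothesis xi_cov : forall n l, (0 < n <= l)%N ->
  `|mean P (fun w => xi n w * xi l w)| <= C1 * (Num.sqrt n%:R / Num.sqrt l%:R).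

(** Only these three properties of the lengths [2 ^ (j ^ 2)] are used below. *)
Let block_ex : exists block : nat -> nat,
  [/\ forall j, (0 < block j)%N, forall j, (j <= block j)%N &
      forall j, ln ((block j)%:R : R) = j%:R ^+ 2 * ln 2].
Proof.
exists (fun j => (2 ^ (j ^ 2))%N); split=> j; first by rewrite expn_gt0.
  apply: leq_trans (ltnW (ltn_expl j (ltnSn 1))) _.
  by rewrite leq_exp2l// -mulnn; case: j => // j; rewrite leq_pmulr.
by rewrite natrX lnXn// -[_ *+ (j ^ 2)%N]mulr_natl natrX.
Qed.

Let ln2_gt0 : 0 < ln (2 : R). Proof. by rewrite ln_gt0// ltr1n. Qed.

Let C0_ge0 : 0 <= C0.
Proof.
have [[w _]|T0] := pselect (exists w : T, True).
  exact: le_trans (normr_ge0 _) (xi_bounded 0 w).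
have : P setT = 0%E.
  by rewrite (_ : setT = set0) ?measure0//; apply/seteqP; split=> // w; case: T0; exists w.
by rewrite probability_setT => /eqP; rewrite onee_eq0.
Qed.

Lemma weighted_sum_sub M N w : (0 < M <= N)%N ->
  `|weighted_sum xi N w - weighted_sum xi M w| <= C0 * (ln (N%:R : R) - ln (M%:R : R)).
Proof.
move=> MN; apply: (@le_trans _ _ (C0 * (harm N - harm M))); last first.
  by rewrite ler_wpM2l//; exact: harm_sub.
case/andP: MN => M0 MN.
have cut (F : nat -> R) : \sum_(1 <= n < N.+1) F n =
    \sum_(1 <= n < M.+1) F n + \sum_(M.+1 <= n < N.+1) F n.
  by rewrite -big_cat_nat.
rewrite /weighted_sum /harm !cut ![_ + _ - _]addrAC !subrr !add0r.
rewrite mulr_sumr; apply: le_trans (ler_norm_sum _ _ _) _.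
apply: ler_sum => n _; rewrite normrM ger0_norm ?invr_ge0// mulrC.
by rewrite ler_wpM2r ?invr_ge0.
Qed.

Lemma ae_log_average_cvg0 :
  {ae P, forall w, (ln (N%:R : R))^-1 * weighted_sum xi N w @[N --> \oo] --> (0 : R)}.
Proof.
have [block [b0 jb ln_block]] := block_ex.
(* The index is shifted because [ln (block 0)] is 0. *)
pose L j w := (ln ((block j.+1)%:R : R))^-1 * weighted_sum xi (block j.+1) w.
have aS N : all_moments P (weighted_sum xi N).
  exact: all_moments_weighted_sum xi_measurable xi_bounded N.
have C10 : 0 <= C1.
  have := @xi_cov 1 1 isT; rewrite divff ?sqrtr1 ?oner_eq0// mulr1.
  by apply: le_trans.
(* With [ln (block j.+1) = x ^ 2 y], where [x = j + 1] and [y = ln 2], the ratio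
   [(1 + x ^ 2 y) / (x ^ 2 y) ^ 2] is at most [(y ^ -2 + y ^ -1) / x ^ 2]. *)
pose K : R := 5 * C1 * ((ln 2)^-1 ^+ 2 + (ln 2)^-1).
have LK j : mean P (fun w => L j w ^+ 2) <= K * (j.+1%:R ^+ 2)^-1.
  have -> : (fun w => L j w ^+ 2) = fun w => (ln ((block j.+1)%:R : R))^-1 ^+ 2 *
      weighted_sum xi (block j.+1) w ^+ 2.
    by apply/funext => w; rewrite /L exprMn.
  rewrite meanZ; last exact: all_momentsX.
  apply: (@le_trans _ _ ((ln ((block j.+1)%:R : R))^-1 ^+ 2 *
      (5 * C1 * (1 + ln ((block j.+1)%:R : R))))).
    rewrite ler_wpM2l ?sqr_ge0//.
    apply: le_trans (mean_weighted_sum_sq xi_measurable xi_bounded xi_cov _) _.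
    by rewrite ler_wpM2l ?mulr_ge0//; exact: harm_le.
  rewrite ln_block /K.
  have j1 : (1 : R) <= j.+1%:R by rewrite ler1n.
  move: (j.+1%:R : R) j1 => x x1; set y := ln 2.
  have y0 : 0 < y by exact: ln2_gt0.
  have x0 : 0 < x by lra.
  have -> : (x ^+ 2 * y)^-1 ^+ 2 * (5 * C1 * (1 + x ^+ 2 * y)) =
      5 * C1 * (y^-1 ^+ 2 * (x ^+ 2)^-1 * (x ^+ 2)^-1 + y^-1 * (x ^+ 2)^-1).
    by field; rewrite !gt_eqF.
  rewrite -[leRHS]mulrA ler_wpM2l ?mulr_ge0// mulrDl lerD2r.
  rewrite -[leLHS]mulrA ler_wpM2l ?sqr_ge0// ler_piMr ?invr_ge0 ?sqr_ge0//.
  by rewrite invf_le1 ?exprn_gt0// exprn_ege1.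
have aeL : {ae P, forall w, L n w @[n --> \oo] --> (0 : R)}.
  apply: (@ae_cvg0_of_summable _ (K * 2)).
    by move=> n; apply: all_momentsZ.
  move=> J; apply: (@le_trans _ _ (\sum_(j < J) K * (j.+1%:R ^+ 2)^-1)).
    by apply: ler_sum => j _; exact: LK.
  rewrite -mulr_sumr ler_wpM2l ?sum_inv_sq_le//.
  by rewrite !mulr_ge0// addr_ge0 ?sqr_ge0// invr_ge0 ltW.
apply: filterS aeL => w Lw.
(* For [j >= 1] one has [(j + 1) ^ 2 - j ^ 2 = 2 j + 1 <= 3 j], so [ln] grows over one block by at
   most [3 / j] times its value. *)
pose gap j : R := C0 * (3 / j%:R).
have gap0 : gap n.+1 @[n --> \oo] --> (0 : R).
  have -> : (0 : R) = C0 * (3 * 0) by rewrite !mulr0.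
  apply: cvgM; first exact: cvg_cst.
  by apply: cvgM; [exact: cvg_cst|exact: cvg_harmonic].
apply/cvgrPdist_le => e e0; have e2 : 0 < e / 2 by rewrite divr_gt0.
have /cvgrPdist_le/(_ _ e2)[J1 _ HJ1] := Lw.
have /cvgrPdist_le/(_ _ e2)[J2 _ HJ2] := gap0.
pose J := maxn J1 J2.
exists (block J.+1) => // N /= JN.
have [j [Jj jN Nj]] : exists j, [/\ (J <= j)%N, (block j.+1 <= N)%N & (N < block j.+2)%N].
  have ex : exists j, (block j.+1 <= N)%N by exists J.
  have bd j : (block j.+1 <= N)%N -> (j <= N)%N.
    by apply: leq_trans; exact: leq_trans (leqnSn j) (jb j.+1).
  case: (ex_maxnP ex bd) => j jN jmax; exists j; split=> //; first exact: jmax.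
  by rewrite ltnNge; apply/negP => /jmax; rewrite ltnn.
have lnpos i : 0 < ln ((block i.+1)%:R : R).
  by rewrite ln_block mulr_gt0// exprn_gt0// ltr0n.
have bN : ln ((block j.+1)%:R : R) <= ln (N%:R : R).
  by rewrite ler_ln ?posrE ?ltr0n ?ler_nat// (leq_trans (b0 j.+1)).
have Nb : ln (N%:R : R) <= ln ((block j.+2)%:R : R).
  by rewrite ler_ln ?posrE ?ltr0n ?ler_nat ?(ltnW Nj)// (leq_trans (b0 j.+1)).
have lnN0 : 0 < ln (N%:R : R) by exact: lt_le_trans bN.
have D : `|weighted_sum xi N w - weighted_sum xi (block j.+1) w| <=
    C0 * (ln (N%:R : R) - ln ((block j.+1)%:R : R)).
  by apply: weighted_sum_sub; rewrite b0.
have Lj : `|L j w| <= e / 2.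
  by rewrite -normrN -sub0r; apply: HJ1 => /=; exact: leq_trans (leq_maxl _ _) Jj.
have Gj : gap j.+1 <= e / 2.
  apply: le_trans (ler_norm _) _; rewrite -normrN -sub0r.
  by apply: HJ2 => /=; exact: leq_trans (leq_maxr _ _) Jj.
rewrite sub0r normrN normrM ger0_norm ?invr_ge0 ?(ltW lnN0)// mulrC ler_pdivrMr//.
have S1 : `|weighted_sum xi (block j.+1) w| <= e / 2 * ln (N%:R : R).
  apply: (@le_trans _ _ (e / 2 * ln ((block j.+1)%:R : R))); last by rewrite ler_wpM2l// ltW.
  rewrite -ler_pdivrMr//; apply: (le_trans _ Lj).
  by rewrite /L normrM ger0_norm ?invr_ge0 ?(ltW (lnpos _))// mulrC.
have S2 : C0 * (ln (N%:R : R) - ln ((block j.+1)%:R : R)) <= e / 2 * ln (N%:R : R).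
  apply: (@le_trans _ _ (gap j.+1 * ln ((block j.+1)%:R : R))); last first.
    apply: (@le_trans _ _ (e / 2 * ln ((block j.+1)%:R : R))).
      by rewrite ler_wpM2r// ltW.
    by rewrite ler_wpM2l// ltW.
  rewrite /gap -mulrA ler_wpM2l//.
  apply: (@le_trans _ _ (ln ((block j.+2)%:R : R) - ln ((block j.+1)%:R : R))).
    by rewrite lerD2r.
  rewrite !ln_block -mulrBl mulrA ler_wpM2r ?(ltW ln2_gt0)//.
  have j0 : (0 : R) < j.+1%:R by rewrite ltr0n.
  have j1 : (1 : R) <= j.+1%:R by rewrite ler1n.
  have -> : j.+2%:R = j.+1%:R + 1 :> R by rewrite natr1.
  move: (j.+1%:R : R) j0 j1 => x x0 x1.
  have -> : 3 / x * x ^+ 2 = 3 * x by field; rewrite gt_eqF.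
  by rewrite !expr2; lra.
move: S1 S2 D; rewrite !ler_norml.
move: (weighted_sum _ N _) (weighted_sum _ (block _) _) (C0 * _) => a b c.
move=> /andP[? ?] ? /andP[? ?]; apply/andP; split; lra.
Qed.

End AlmostSureAverages.

(** * Decoupling of traces *)

Section Decoupling.
Context {R : realType} {d : measure_display} {T : measurableType d} {P : probability T R}.
Variable X : nat -> nat -> {RV P >-> R}.
Variable B : nat -> R.
Hypothesis X_moments : forall i j, moments_le P B (X i j).
Hypothesis X_indep : mutually_independent (fun e : nat * nat => X e.1 e.2).
Hypothesis X_mean : forall i j, mean P (X i j) = 0.

Section OneTrace.
Variable k : nat.
Hypothesis k_gt0 : (0 < k)%N.

Definition low_walk n l (g : {ffun 'I_k -> 'I_l}) : bool :=
  [exists u, (g u < n)%N && (g (ordS u) < n)%N].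

Definition low_part n l w : R :=
  Num.sqrt l%:R ^- k * \sum_(g : {ffun 'I_k -> 'I_l} | low_walk n g) centered_weight X g w.

Definition high_part n l w : R :=
  Num.sqrt l%:R ^- k * \sum_(g : {ffun 'I_k -> 'I_l} | ~~ low_walk n g) centered_weight X g w.

Lemma low_high_split n l w :
  centered_tr_power X l k w = high_part n l w + low_part n l w.
Proof.
rewrite (centered_tr_powerE X_moments)// /low_part /high_part -mulrDr.
by rewrite (bigID (@low_walk n l)) /= addrC.
Qed.

Lemma all_moments_low_part n l : all_moments P (low_part n l).
Proof.
by apply: all_momentsZ; apply: all_moments_sum => g _; exact: all_moments_centered_weight.
Qed.

Lemma all_moments_high_part n l : all_moments P (high_part n l).
Proof.
by apply: all_momentsZ; apply: all_moments_sum => g _; exact: all_moments_centered_weight.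
Qed.

Definition high_edges n l : seq (nat * nat) :=
  [seq (i, j) | i <- iota 0 l, j <- [seq j <- iota 0 l | ~~ ((i < n)%N && (j < n)%N)]].

Lemma depends_on_high_part n l :
  depends_on (fun e : nat * nat => X e.1 e.2) (high_edges n l) (high_part n l).
Proof.
apply: depends_onM; first exact: depends_on_cst.
apply: depends_on_sum => g gh; apply: depends_on_centered_weight => u.
apply/allpairsPdep; exists (g u : nat), (g (ordS u) : nat).
split=> //; first by rewrite mem_iota /= add0n ltn_ord.
rewrite mem_filter mem_iota /= add0n ltn_ord andbT.
by apply: contra gh => H; apply/existsP; exists u.
Qed.

Let l2 (b : bool) := k.

(** In the sum over pairs of low walks, a lonely edge kills the expectation. Otherwise at most [k]
    labels occur, one of them below [n], which leaves [O(n * l ^ k.-1)] pairs against the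
    normalization [l ^ k]. *)
Lemma mean_low_part_sq : exists C : R, 0 <= C /\ forall n l, (0 < n <= l)%N ->
  mean P (fun w => low_part n l w ^+ 2) <= C * (n%:R / l%:R).
Proof.
pose b := family_bound B l2 1.
have b0 : 0 <= b.
  exact: moments_le_ge0 (family_weight_moments X_moments predT ([ffun=> ord0] : {ffun vertex l2 -> 'I_1})).
exists (b * (k ^ (k + k) * k)%:R); split; first exact: mulr_ge0.
move=> n l /andP[n0 nl].
have l0 : (0 < l)%N by exact: leq_trans nl.
have l0R : (0 : R) < l%:R by rewrite ltr0n.
pose low (f : {ffun vertex l2 -> 'I_l}) := low_walk n (walk_of f true) && low_walk n (walk_of f false).
have -> : (fun w => low_part n l w ^+ 2) = fun w => (l%:R ^+ k)^-1 *
    \sum_(f : {ffun vertex l2 -> 'I_l} | low f) family_weight X predT f w.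
  apply/funext => w; rewrite /low_part exprMn exprVn -exprM mulnC exprM sqr_sqrtr ?ltW//.
  congr (_ * _).
  (* Extending the weight by 0 outside low walks turns the square into a product of two full sums,
     to which [big_distr_walks] applies. *)
  pose F (b : bool) (g : {ffun 'I_k -> 'I_l}) := if low_walk n g then centered_weight X g w else 0.
  transitivity (\prod_(b : bool) \sum_(g : {ffun 'I_(l2 b) -> 'I_l}) F b g).
    by rewrite big_bool /= -expr2 /F -big_mkcond.
  rewrite (@big_distr_walks _ l2) [RHS]big_mkcond; apply: eq_bigr => f _.
  rewrite big_bool /F /family_weight big_bool /low.
  by case: (low_walk n (walk_of f true)); case: (low_walk n (walk_of f false));
    rewrite /= ?mulr0 ?mul0r.
rewrite meanZ; last first.
  by apply: all_moments_sum => f _; exact: all_moments_family_weight.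
rewrite mean_sum; last by move=> f _; exact: all_moments_family_weight.
pose S := finset (fun f : {ffun vertex l2 -> 'I_l} =>
  (#|codom f| <= k)%N && [exists u, f u < n]%N).
have sumS : \sum_(f : {ffun vertex l2 -> 'I_l} | low f) mean P (family_weight X predT f) <=
    b * #|S|%:R.
  apply: (@le_trans _ _ (\sum_(f in S) b)); last by rewrite sumr_const mulr_natr.
  rewrite big_mkcond [leRHS]big_mkcond; apply: ler_sum => f _.
  case: ifPn => lf; last by case: ifP.
  have [[v lonely]|twice] := edge_dichotomy f.
    rewrite (mean_family_weight_lonely_edge X_moments X_indep X_mean (v := v))//.
    by case: ifP.
  rewrite ifT; first by apply: le_trans (ler_norm _) _; exact: mean_family_weight_le.
  rewrite inE; apply/andP; split.
    have := codom_half (vertex_twice twice).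
    by rewrite card_vertex big_bool /= /l2 addnn mul2n leq_double.
  move: lf => /andP[/existsP[u /andP[un _]] _]; apply/existsP.
  by exists (@Tagged bool true (fun j => 'I_(l2 j)) u); move: un; rewrite ffunE.
rewrite mulrC ler_pdivrMr ?exprn_gt0//; apply: le_trans sumS _.
rewrite -!mulrA ler_wpM2l//.
have -> : n%:R * (l%:R^-1 * l%:R ^+ k) = (n * l ^ k.-1)%:R :> R.
  by rewrite -(prednK k_gt0) exprS mulKf ?gt_eqF// natrM natrX.
rewrite -natrM ler_nat; apply: leq_trans (card_ffun_small_image _ _ _ _) _.
by rewrite card_vertex big_bool /l2 -mulnA.
Qed.

(** The bound [|x| <= a + x ^ 2 / a], with [a = sqrt (n / l)], replaces the Cauchy-Schwarz
    inequality; its two terms give the constant [1 + C]. *)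
Lemma mean_abs_low_part : exists C : R, 0 <= C /\ forall n l, (0 < n <= l)%N ->
  mean P (fun w => `|low_part n l w|) <= C * (Num.sqrt n%:R / Num.sqrt l%:R).
Proof.
have [C [C0 CP]] := mean_low_part_sq.
exists (1 + C); split=> [|n l nl]; first by rewrite addr_ge0.
have /andP[n0 nl'] := nl; have l0 : (0 < l)%N by exact: leq_trans nl'.
set a : R := Num.sqrt n%:R / Num.sqrt l%:R.
have a0 : 0 < a by rewrite divr_gt0// sqrtr_gt0 ltr0n.
have a2 : n%:R / l%:R = a ^+ 2 :> R by rewrite expr_div_n !sqr_sqrtr.
have aL := all_moments_low_part n l.
apply: (@le_trans _ _ (mean P (fun w => a + a^-1 * low_part n l w ^+ 2))).
  apply: le_mean.
  - exact: all_moments_abs.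
  - apply: all_momentsD; first exact: all_moments_cst.
    by apply: all_momentsZ; exact: all_momentsX.
  - move=> w; rewrite -(real_normK (num_real (low_part n l w))).
    have x0 := normr_ge0 (low_part n l w); move: (`|_|) x0 => x x0.
    rewrite -(@ler_pM2l _ a)//.
    have -> : a * (a + a^-1 * x ^+ 2) = a ^+ 2 + x ^+ 2 by field; rewrite gt_eqF.
    nra.
rewrite (meanD (all_moments_cst P a)); last by apply: all_momentsZ; exact: all_momentsX.
rewrite mean_cst meanZ; last exact: all_momentsX.
rewrite mulrDl mul1r lerD2l mulrC ler_pdivrMr//.
by apply: le_trans (CP n l nl) _; rewrite a2 expr2 mulrA.
Qed.

End OneTrace.

(** In the application [A] is the centered test at [n], [G] the test function of the traces at [l],
    and [H] the same function of their high parts, which are independent of [A]. Only [G - H]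
    contributes, and the Lipschitz bound controls it. *)
Lemma mean_decouple (A G H S : T -> R) (D C mu : R) :
  all_moments P A -> all_moments P G -> all_moments P H -> all_moments P S ->
  mean P (fun w => A w * (H w - mu)) = 0 ->
  (forall w, `|A w| <= D) -> (forall w, `|G w - H w| <= C * S w) ->
  `|mean P (fun w => A w * (G w - mu))| <= D * (C * mean P S).
Proof.
move=> aA aG aH aS H0 AD GH.
have ac (F : T -> R) : all_moments P F -> all_moments P (fun w => F w - mu).
  by move=> aF; apply: all_momentsB => //; exact: all_moments_cst.
have aGH : all_moments P (fun w => G w - H w) by exact: all_momentsB.
have -> : mean P (fun w => A w * (G w - mu)) = mean P (fun w => A w * (G w - H w)).
  rewrite -[LHS]subr0 -H0 -(meanB (all_momentsM aA (ac _ aG)) (all_momentsM aA (ac _ aH))).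
  by congr (mean P _); apply/funext => w; ring.
apply: le_trans (normr_mean (all_momentsM aA aGH)) _.
rewrite -(meanZ C aS) -(meanZ D (all_momentsZ C aS)); apply: le_mean.
- exact: all_moments_abs (all_momentsM aA aGH).
- exact: all_momentsZ (all_momentsZ C aS).
- by move=> w; rewrite normrM ler_pM.
Qed.

Section TestFunctions.
Variables (m : nat) (k : 'I_m -> nat).
Hypothesis k_gt0 : forall j, (0 < k j)%N.

(** The measurability clause ranges over all measurable spaces because it is used both on the
    probability space and, for [depends_on], on the sub-sigma-algebras generated by some of the
    entries. *)
Definition test_function (g : 'rV[R]_m -> R) : Prop := bounded_lipschitz g /\
  forall (d' : measure_display) (S : measurableType d') (Y : 'I_m -> S -> R),
    (forall j, measurable_fun setT (Y j)) -> measurable_fun setT (fun w => g (\row_j Y j w)).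

Variable g : 'rV[R]_m -> R.
Hypothesis g_test : test_function g.

Definition trace_vector n w : 'rV[R]_m := \row_j centered_tr_power X n (k j) w.

Let G n w := g (trace_vector n w).

Let aG n : all_moments P (G n).
Proof.
have [[C [gC _]] mg] := g_test.
apply: (@all_moments_bounded _ _ _ _ _ C); last by move=> w; exact: gC.
by apply: mg => j; apply: all_moments_measurable; exact: (all_moments_centered_tr_power X_moments).
Qed.

Definition centered_test n w : R := g (trace_vector n w) - mean P (fun w => g (trace_vector n w)).

Lemma measurable_centered_test n : measurable_fun setT (centered_test n).
Proof. by apply: measurable_funB => //; exact: all_moments_measurable (aG n). Qed.

Lemma centered_test_bounded : exists C, forall n w, `|centered_test n w| <= C.
Proof.
have [[C [gC _]] _] := g_test.
exists (C + C) => n w; apply: le_trans (ler_normB _ _) _; rewrite lerD//.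
apply: le_trans (normr_mean (aG n)) _.
rewrite -[leRHS](mean_cst P C); apply: le_mean.
- exact: all_moments_abs.
- exact: all_moments_cst.
- by move=> w1; exact: gC.
Qed.

Lemma depends_on_trace n j :
  depends_on (fun e : nat * nat => X e.1 e.2)
    [seq (i, j) | i <- iota 0 n, j <- iota 0 n] (centered_tr_power X n (k j)).
Proof.
rewrite (_ : centered_tr_power X n (k j) = fun w => Num.sqrt n%:R ^- k j *
    \sum_(g : {ffun 'I_(k j) -> 'I_n}) centered_weight X g w); last first.
  by apply/funext => w; rewrite (centered_tr_powerE X_moments).
apply: depends_onM; first exact: depends_on_cst.
apply: depends_on_sum => h _; apply: depends_on_centered_weight => u.
by apply/allpairsP; exists (h u : nat, h (ordS u) : nat); rewrite !mem_iota /= !add0n !ltn_ord.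
Qed.

Lemma centered_test_cov : exists C : R, forall n l, (0 < n <= l)%N ->
  `|mean P (fun w => centered_test n w * centered_test l w)| <=
  C * (Num.sqrt n%:R / Num.sqrt l%:R).
Proof.
have [[C [gC gL]] mg] := g_test.
have [D0 D0P] := centered_test_bounded.
have low j : {c : R | 0 <= c /\ forall n l, (0 < n <= l)%N ->
    mean P (fun w => `|low_part (k j) n l w|) <= c * (Num.sqrt n%:R / Num.sqrt l%:R)}.
  exact: cid (mean_abs_low_part (k_gt0 j)).
pose c j := sval (low j).
have cP j : 0 <= c j /\ forall n l, (0 < n <= l)%N ->
    mean P (fun w => `|low_part (k j) n l w|) <= c j * (Num.sqrt n%:R / Num.sqrt l%:R).
  exact: svalP (low j).
exists (`|D0| * (`|C| * \sum_j c j)) => n l nl.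
pose H w := g (\row_j high_part (k j) n l w).
have aH : all_moments P H.
  apply: (@all_moments_bounded _ _ _ _ _ C); last by move=> w; exact: gC.
  by apply: mg => j; apply: all_moments_measurable; exact: all_moments_high_part.
have axi i : all_moments P (centered_test i).
  exact: all_moments_bounded (measurable_centered_test i) (D0P i).
have xi0 : mean P (centered_test n) = 0.
  by rewrite /centered_test (meanB (aG n)) ?mean_cst ?subrr//; exact: all_moments_cst.
(* This is not the mean of [H], which does not matter: [centered_test n] has mean 0 and is
   independent of [H], so any constant disappears. *)
pose mul := mean P (fun w => g (trace_vector l w)).
have aHc : all_moments P (fun w => H w - mul).
  by apply: all_momentsB => //; exact: all_moments_cst.
have dn : depends_on (fun e : nat * nat => X e.1 e.2)
    [seq (i, j) | i <- iota 0 n, j <- iota 0 n] (centered_test n).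
  apply: depends_onD; last exact: depends_on_cst.
  by apply: mg => j; exact: depends_on_trace.
have dh : depends_on (fun e : nat * nat => X e.1 e.2) (high_edges n l) (fun w => H w - mul).
  apply: depends_onD; last exact: depends_on_cst.
  by apply: mg => j; apply: depends_on_high_part.
have disj e : e \in [seq (i, j) | i <- iota 0 n, j <- iota 0 n] -> e \notin high_edges n l.
  move=> /allpairsP[[i j] [/= + + ->]]; rewrite !mem_iota /= !add0n => iN jN.
  apply/negP => /allpairsPdep[i' [j' [_ + [ii' jj']]]].
  by rewrite mem_filter -ii' -jj' iN jN.
have indep : mean P (fun w => centered_test n w * (H w - mul)) = 0.
  by rewrite (mean_depends_on_M X_indep disj dn dh (axi n) aHc) xi0 mul0r.
have alow j : all_moments P (fun w => `|low_part (k j) n l w|).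
  by apply: all_moments_abs; exact: all_moments_low_part.
have aS : all_moments P (fun w => \sum_j `|low_part (k j) n l w|) by exact: all_moments_sum.
have D w : `|centered_test n w| <= `|D0| by apply: le_trans (D0P n w) _; exact: ler_norm.
have GH w : `|G l w - H w| <= `|C| * \sum_j `|low_part (k j) n l w|.
  apply: le_trans (gL _ _) _.
  have -> : \sum_j `|trace_vector l w ord0 j - (\row_j high_part (k j) n l w) ord0 j| =
      \sum_j `|low_part (k j) n l w|.
    by apply: eq_bigr => j _; rewrite !mxE (low_high_split (k_gt0 j) n) addrAC subrr add0r.
  by rewrite ler_wpM2r ?sumr_ge0// ler_norm.
apply: le_trans (mean_decouple (axi n) (aG l) aH aS indep D GH) _.
rewrite -mulrA ler_wpM2l// -mulrA ler_wpM2l//.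
rewrite mean_sum// mulr_suml; apply: ler_sum => j _.
by have [_] := cP j; apply.
Qed.

Lemma ae_test_average :
  {ae P, forall w, (ln (N%:R : R))^-1 * weighted_sum centered_test N w @[N --> \oo] --> (0 : R)}.
Proof.
have [C0 C0P] := centered_test_bounded; have [C1 C1P] := centered_test_cov.
exact: (ae_log_average_cvg0 measurable_centered_test C0P C1P).
Qed.

End TestFunctions.
End Decoupling.

(** * Trigonometric Bernstein approximation *)

Section Bernstein.
Context {R : realType}.

(** The binomial probability of [i] successes in [r] trials, obtained by conditioning on one trial.
    Its moments follow by induction on [r], without binomial coefficients. *)
Fixpoint bernstein (p : R) (r i : nat) : R :=
  if r is r'.+1 then
    (1 - p) * bernstein p r' i + (if i is i'.+1 then p * bernstein p r' i' else 0)
  else (i == 0%N)%:R.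

Lemma bernstein_ge0 p r i : 0 <= p <= 1 -> 0 <= bernstein p r i.
Proof.
move=> /andP[p0 p1]; elim: r i => [|r IH] i /=; first exact: ler0n.
by rewrite addr_ge0 ?mulr_ge0 ?subr_ge0//; case: i => // i; rewrite mulr_ge0.
Qed.

Lemma sum_bernstein0 p n (f : nat -> R) : \sum_(i < n.+1) bernstein p 0 i * f i = f 0%N.
Proof. by rewrite big_ord_recl /= mul1r big1 ?addr0// => i _; rewrite mul0r. Qed.

Lemma sum_bernsteinS p r n (f : nat -> R) :
  \sum_(i < n.+2) bernstein p r.+1 i * f i =
  (1 - p) * (\sum_(i < n.+2) bernstein p r i * f i) +
  p * \sum_(i < n.+1) bernstein p r i * f i.+1.
Proof.
under eq_bigr => i _ do rewrite /= mulrDl -mulrA.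
rewrite big_split /= -mulr_sumr; congr (_ + _).
rewrite big_ord_recl mul0r add0r mulr_sumr; apply: eq_bigr => i _.
by rewrite /= mulrA.
Qed.

(** The weights beyond [r] are 0; a range allowed to exceed [r] survives the two different ranges of
    [sum_bernsteinS]. *)
Lemma sum_bernstein p r n : (r <= n)%N -> \sum_(i < n.+1) bernstein p r i = 1.
Proof.
move=> rn; suff : \sum_(i < n.+1) bernstein p r i * 1 = 1.
  by under eq_bigr do rewrite mulr1.
elim: r n rn => [|r IH] n rn; first exact: (@sum_bernstein0 p n (fun=> 1)).
case: n rn => // n rn; rewrite (@sum_bernsteinS p r n (fun=> 1)).
by rewrite (IH n)// IH ?(ltnW rn)//; ring.
Qed.

(** The free offset [a] absorbs the shift of [i] after a success, which makes the induction close.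
    The value [a = - r p] gives the variance. *)
Lemma bernstein_variance p r n a : (r <= n)%N ->
  \sum_(i < n.+1) bernstein p r i * (i%:R + a) ^+ 2 =
  (r%:R * p + a) ^+ 2 + r%:R * p * (1 - p).
Proof.
elim: r n a => [|r IH] n a rn.
  by rewrite (@sum_bernstein0 p n (fun i => (i%:R + a) ^+ 2)); ring.
case: n rn => // n rn; rewrite (@sum_bernsteinS p r n (fun i => (i%:R + a) ^+ 2)).
rewrite IH ?(ltnW rn)//.
have -> : \sum_(i < n.+1) bernstein p r i * (i.+1%:R + a) ^+ 2 =
    \sum_(i < n.+1) bernstein p r i * (i%:R + (1 + a)) ^+ 2.
  by apply: eq_bigr => i _; rewrite -natr1 -addrA.
rewrite (IH n (1 + a))// -natr1; ring.
Qed.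

Section Grid.
Variable m : nat.

Definition grid_weight (p : 'I_m -> R) r (s : {ffun 'I_m -> 'I_r.+1}) : R :=
  \prod_j bernstein (p j) r (s j).

Lemma grid_weight_ge0 p r (s : {ffun 'I_m -> 'I_r.+1}) :
  (forall j, 0 <= p j <= 1) -> 0 <= grid_weight p s.
Proof. by move=> p01; apply: prodr_ge0 => j _; exact: bernstein_ge0. Qed.

Lemma sum_grid_weight p r : \sum_(s : {ffun 'I_m -> 'I_r.+1}) grid_weight p s = 1.
Proof.
rewrite -(bigA_distr_bigA (fun j (i : 'I_r.+1) => bernstein (p j) r i)) big1// => j _.
exact: sum_bernstein.
Qed.

Lemma sum_grid_weight_coord p r j (h : nat -> R) :
  \sum_(s : {ffun 'I_m -> 'I_r.+1}) grid_weight p s * h (s j) =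
  \sum_(i < r.+1) bernstein (p j) r i * h i.
Proof.
pose F l (i : 'I_r.+1) := bernstein (p l) r i * (if l == j then h i else 1).
transitivity (\sum_(s : {ffun 'I_m -> 'I_r.+1}) \prod_l F l (s l)).
  apply: eq_bigr => s _; rewrite big_split /=; congr (_ * _).
  by rewrite (bigD1 j)//= eqxx big1 ?mulr1// => l /negbTE ->.
rewrite -(bigA_distr_bigA F) (bigD1 j)//= [X in _ * X]big1 ?mulr1.
  by apply: eq_bigr => i _; rewrite /F eqxx.
move=> l /negbTE lj; rewrite -[RHS](sum_bernstein (p l) (leqnn r)).
by apply: eq_bigr => i _; rewrite /F lj mulr1.
Qed.

(** Chebyshev's inequality: nodes within [eta] in every coordinate cost [e]; the others cost [2 * b]
    times their weight, at most the total variance, bounded by [m * r], divided by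
    [(r * eta) ^ 2]. *)
Lemma grid_approx (psi : 'rV[R]_m -> R) (b e eta : R) (p : 'I_m -> R) r :
  0 < eta -> (0 < r)%N -> (forall j, 0 <= p j <= 1) ->
  (forall u, `|psi u| <= b) -> 0 <= e ->
  (forall v : 'rV[R]_m, (forall j, `|p j - v ord0 j| < eta) -> `|psi (\row_j p j) - psi v| <= e) ->
  `|psi (\row_j p j) - \sum_(s : {ffun 'I_m -> 'I_r.+1})
     psi (\row_j ((s j)%:R / r%:R)) * grid_weight p s| <= e + 2 * b * (m%:R / (r%:R * eta ^+ 2)).
Proof.
move=> eta0 r0 p01 psib e0 unif.
have r0R : (0 : R) < r%:R by rewrite ltr0n.
have b0 : 0 <= b by exact: le_trans (psib 0).
pose node (s : {ffun 'I_m -> 'I_r.+1}) : 'rV[R]_m := \row_j ((s j)%:R / r%:R).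
pose c := (r%:R * eta) ^+ 2.
have c0 : 0 < c by rewrite exprn_gt0// mulr_gt0.
have w0 s := grid_weight_ge0 s p01.
have -> : psi (\row_j p j) - \sum_s psi (node s) * grid_weight p s =
    \sum_s (psi (\row_j p j) - psi (node s)) * grid_weight p s.
  under [RHS]eq_bigr do rewrite mulrBl.
  by rewrite sumrB -mulr_sumr sum_grid_weight mulr1.
apply: le_trans (ler_norm_sum _ _ _) _.
pose dev (s : {ffun 'I_m -> 'I_r.+1}) : R := \sum_j ((s j)%:R + - (r%:R * p j)) ^+ 2.
have pt s : `|(psi (\row_j p j) - psi (node s)) * grid_weight p s| <=
    e * grid_weight p s + 2 * b / c * (grid_weight p s * dev s).
  have -> : e * grid_weight p s + 2 * b / c * (grid_weight p s * dev s) =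
    (e + 2 * b / c * dev s) * grid_weight p s by ring.
  rewrite normrM [X in _ * X]ger0_norm// ler_wpM2r//.
  have dev0 : 0 <= dev s by apply: sumr_ge0 => j _; exact: sqr_ge0.
  have [close|] := pselect (forall j, `|p j - node s ord0 j| < eta).
    by apply: le_trans (unif _ close) _; rewrite lerDl !mulr_ge0// invr_ge0 ltW.
  move=> /existsNP[j /negP]; rewrite -leNgt mxE => far.
  have cdev : c <= dev s.
    apply: (@le_trans _ _ (((s j)%:R + - (r%:R * p j)) ^+ 2)); last first.
      by rewrite /dev (bigD1 j)//= lerDl sumr_ge0// => l _; exact: sqr_ge0.
    have -> : (s j)%:R + - (r%:R * p j) = - (r%:R * (p j - (s j)%:R / r%:R)).
      by field; rewrite gt_eqF.
    rewrite sqrrN /c -[leRHS]real_normK ?num_real// ler_pXn2r ?nnegrE ?mulr_ge0 ?(ltW r0R) ?(ltW eta0)//.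
    by rewrite normrM ger0_norm ?(ltW r0R)// ler_pM2l.
  apply: (@le_trans _ _ (2 * b)).
    by apply: le_trans (ler_normB _ _) _; have := psib (\row_j p j); have := psib (node s); lra.
  apply: (@le_trans _ _ (2 * b / c * dev s)); last by rewrite lerDr.
  by rewrite -mulrA ler_peMr ?mulr_ge0// mulrC ler_pdivlMr// mul1r.
apply: le_trans (ler_sum _ (fun s _ => pt s)) _.
rewrite big_split /= -!mulr_sumr sum_grid_weight mulr1 lerD2l.
have -> : \sum_s grid_weight p s * dev s = \sum_j r%:R * p j * (1 - p j).
  under eq_bigr => s _ do rewrite /dev mulr_sumr.
  rewrite exchange_big /=; apply: eq_bigr => j _.
  rewrite (@sum_grid_weight_coord p r j (fun i => (i%:R + - (r%:R * p j)) ^+ 2)).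
  by rewrite bernstein_variance//; ring.
have S : \sum_j r%:R * p j * (1 - p j) <= m%:R * r%:R.
  rewrite mulr_natl -[m in leRHS]card_ord -sumr_const; apply: ler_sum => j _.
  have /andP[p0 p1] := p01 j; rewrite -mulrA ler_piMr ?ltW//; nra.
rewrite -mulrA ler_wpM2l ?mulr_ge0// mulrC ler_pdivrMr//.
apply: le_trans S _; rewrite /c le_eqVlt; apply/orP; left; apply/eqP.
by field; rewrite !gt_eqF.
Qed.

End Grid.
End Bernstein.

(** * Uniform trigonometric approximation on a box *)

Section TrigonometricApproximation.
Context {R : realType} {m : nat}.
Local Notation E := 'rV[R]_m.

Definition sine_coord (A y : R) : R := (1 + sin (A^-1 * y)) / 2.

Lemma sine_coord_itv A y : 0 <= sine_coord A y <= 1.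
Proof.
have := sin_max (A^-1 * y); rewrite ler_norml /sine_coord => /andP[a b].
by apply/andP; split; lra.
Qed.

Definition trig_weight (A : R) r (s : {ffun 'I_m -> 'I_r.+1}) (x : E) : R :=
  grid_weight (fun j => sine_coord A (x ord0 j)) s.

Lemma trig_poly_weight A r (s : {ffun 'I_m -> 'I_r.+1}) : trig_poly (trig_weight A s).
Proof.
have tp j : trig_poly (fun x : E => sine_coord A (x ord0 j)).
  apply: (trig_poly_ext (TrigZ 2^-1 (TrigD (trig_poly_cst 1) (trig_poly_sin j A^-1)))) => x.
  by rewrite mulrC.
apply: trig_poly_prod => j; move: (nat_of_ord (s j)) => i; elim: r i {s} => [|r IH] i /=.
  exact: trig_poly_cst.
apply: TrigD.
  apply: trig_polyM (IH i); have H := TrigD (trig_poly_cst 1) (TrigZ (-1) (tp j)).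
  by apply: (trig_poly_ext H) => x; rewrite mulN1r.
by case: i => [|i]; [exact: trig_poly_cst|exact: trig_polyM].
Qed.

(* The clamping keeps the argument of [asin] inside ]-1, 1[, where it is continuous. *)
Definition sine_node (A u : R) : R :=
  A * asin (Num.min (Num.max (2 * u - 1) (- sin 1)) (sin 1)).

Let sin1_gt0 : 0 < sin (1 : R).
Proof. by apply: sin_gt0_pi => //; have := pi_ge2 R; lra. Qed.

Let sin1_lt1 : sin (1 : R) < 1.
Proof.
have p2 := pi_ge2 R.
(* Only [2 <= pi] is at hand, so the equality [pi / 2 = 1] has to be ruled out, by [cos 1 > 0]. *)
have [lt1|] := ltP (1 : R) (pi / 2); last first.
  move=> h; have e1 : (1 : R) = pi / 2 by lra.
  have := sin2cos2 (R := R) 1.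
  have c1 := cos1_gt0 R.
  by move: c1; rewrite e1 cos_pihalf ltxx.
rewrite -[ltRHS]sin_pihalf ltr_sin// in_itv/=; apply/andP; split; lra.
Qed.

Lemma sine_nodeK A y : 0 < A -> `|y| <= A -> sine_node A (sine_coord A y) = y.
Proof.
move=> A0 yA; rewrite /sine_node /sine_coord.
have -> : 2 * ((1 + sin (A^-1 * y)) / 2) - 1 = sin (A^-1 * y) by field.
have p2 := pi_ge2 R.
have : `|A^-1 * y| <= 1 by rewrite normrM gtr0_norm ?invr_gt0// mulrC ler_pdivrMr// mul1r.
rewrite ler_norml => /andP[y1 y2].
have itv (z : R) : -1 <= z <= 1 -> z \in `[- (pi / 2), pi / 2].
  by move=> /andP[z1 z2]; rewrite in_itv/=; apply/andP; split; lra.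
have le_s (z t : R) : -1 <= z <= 1 -> -1 <= t <= 1 -> z <= t -> sin z <= sin t.
  move=> zi ti; rewrite le_eqVlt => /predU1P[->//|zt].
  by rewrite ltW// ltr_sin ?itv.
have s1 : sin (A^-1 * y) <= sin 1 by apply: le_s => //; lra.
have s2 : - sin 1 <= sin (A^-1 * y) by rewrite -sinN; apply: le_s => //; lra.
rewrite (max_idPl s2) (min_idPl s1) sinK; last by apply: itv; rewrite y1.
by rewrite mulrA divff ?gt_eqF// mul1r.
Qed.

Lemma continuous_sine_node A : continuous (sine_node A).
Proof.
move=> u; apply: cvgM; first exact: cvg_cst.
pose c (v : R) := Num.min (Num.max (2 * v - 1) (- sin 1)) (sin 1).
have cc : {for u, continuous c}.
  change {for u, continuous (((fun v => 2 * v - 1) \max cst (- sin 1)) \min cst (sin 1) : R -> R^o)}.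
  apply: continuous_min; last exact: cvg_cst.
  apply: continuous_max; last exact: cvg_cst.
  apply: (@cvgB _ R^o); last exact: cvg_cst.
  by apply: (@cvgM R); [exact: cvg_cst|exact: cvg_id].
apply: (continuous_comp cc); apply: continuous_asin.
rewrite /c lt_min gt_min lt_max; apply/andP; split.
  by rewrite ltrN2 sin1_lt1 orbT (lt_trans _ sin1_gt0)// ltrN10.
by rewrite sin1_lt1 orbT.
Qed.

Lemma continuous_row (h : R -> R) : continuous h ->
  continuous (fun u : E => (\row_j h (u ord0 j) : E)).
Proof.
move=> ch u.
apply: (iffRL (@cvg_ballP _ _ _ _ (nbhs_filter u) _ _)) => e e0.
have H (j : 'I_m) : \forall v \near u, ball (h (u ord0 j)) e (h ((v : E) ord0 j)).
  have /cvg_ballP := continuous_comp (@coord_continuous _ _ _ ord0 j u) (@ch (u ord0 j)).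
  exact.
have FF : Filter (nbhs u) := nbhs_filter u.
have := filter_forall FF H; apply: filterS => v Hv; split=> // i j.
by rewrite !mxE.
Qed.

Lemma uniform_on_cube (psi : E -> R) (e : R) : continuous psi -> 0 < e ->
  exists2 eta : R, 0 < eta & forall u v : E, (forall j, 0 <= u ord0 j <= 1) ->
    (forall j, `|u ord0 j - v ord0 j| < eta) -> `|psi u - psi v| <= e.
Proof.
move=> cpsi e0.
have K : compact [set u : E | forall j, [set` `[(0 : R), 1]] (u ord0 j)].
  by apply: (@rV_compact R m (fun=> [set` `[(0 : R), 1]])) => j; exact: segment_compact.
have near : forall x : E, [set u : E | forall j, [set` `[(0 : R), 1]] (u ord0 j)] x ->
    \forall x' \near x & eta \near (0 : R)^'+,
      forall v : E, ball (x' : E) eta v -> `|psi x' - psi v| <= e.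
  move=> x _; have /cvgrPdist_le/(_ _ (divr_gt0 e0 (ltr0n R 2))) := cpsi x.
  move=> /nbhs_ballP[d d0 dx]; have d2 : 0 < d / 2 by rewrite divr_gt0.
  exists (ball x (d / 2), [set eta | 0 < eta < d / 2]) => /=.
    split; first exact: nbhsx_ballx.
    near=> eta; apply/andP; split=> //; near: eta; exact: nbhs_right_lt.
  move=> [x' eta] /= [xx' /andP[eta0 etad]] v x'v.
  have h1 : `|psi x - psi x'| <= e / 2.
    by apply: dx; apply: le_ball xx'; lra.
  have h2 : `|psi x - psi v| <= e / 2.
    apply: dx; rewrite [d]splitr; apply: ball_triangle xx' _.
    by apply: le_ball x'v; exact: ltW.
  rewrite -(subrK (psi x) (psi x')) -addrA; apply: le_trans (ler_normD _ _) _.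
  by rewrite distrC; lra.
have := (iffLR (compact_near_coveringP _) K) _ _ _ _ near.
move=> H; have [eta [eta0 Heta]] : exists eta : R, 0 < eta /\
    [set u : E | forall j, [set` `[(0 : R), 1]] (u ord0 j)] `<=`
    (fun x' => forall v : E, ball (x' : E) eta v -> `|psi x' - psi v| <= e).
  near (0 : R)^'+ => eta; exists eta; split=> //; near: eta; exact: H.
exists eta => // u v u01 uv; apply: Heta => //.
by split=> // i j; rewrite (ord1 i); exact: uv.
Unshelve. all: by end_near. Qed.

Definition tail (A : R) (x : E) : R := Num.min 1 (\sum_j `|x ord0 j| / A).

Lemma tail_ge0 A x : 0 < A -> 0 <= tail A x.
Proof.
move=> A0; rewrite /tail le_min ler01 sumr_ge0// => j _.
by rewrite divr_ge0// ltW.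
Qed.

(** On the box the sine coordinates are inverted by [sine_node], so [phi] becomes a continuous
    function on the unit cube and [grid_approx] applies. Outside, [tail A x] is 1, and both
    functions are bounded by [b], the weights having sum 1. *)
Lemma trig_approx (phi : E -> R) (b A e : R) : continuous phi -> (forall x, `|phi x| <= b) ->
  0 < A -> 0 < e ->
  exists (r : nat) (c : {ffun 'I_m -> 'I_r.+1} -> R),
    forall x, `|phi x - \sum_s c s * trig_weight A s x| <= e + 2 * b * tail A x.
Proof.
move=> cphi phib A0 e0.
have b0 : 0 <= b by exact: le_trans (phib 0).
pose psi (u : E) := phi (\row_j sine_node A (u ord0 j)).
have cpsi : continuous psi.
  move=> u; have c1 := continuous_row (@continuous_sine_node A) (x := u).
  exact: (@continuous_comp E E R _ phi u c1 (@cphi _)).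
have e2 : 0 < e / 2 by rewrite divr_gt0.
have [eta eta0 unif] := uniform_on_cube cpsi e2.
have [r r0 rP] : exists2 r, (0 < r)%N & 2 * b * (m%:R / (r%:R * eta ^+ 2)) <= e / 2.
  (* The Bernstein error is [K * (e / 2) / r], so any [r] above [K] is suitable. *)
  pose K := 2 * b * m%:R / eta ^+ 2 / (e / 2).
  exists (Num.truncn K).+1 => //.
  have H : K < (Num.truncn K).+1%:R by exact: truncnS_gt.
  move: ((Num.truncn K).+1%:R : R) H (ltr0Sn R (Num.truncn K)) => r Kr r0.
  have -> : 2 * b * (m%:R / (r * eta ^+ 2)) = K * (e / 2) / r.
    by rewrite /K; field; rewrite !gt_eqF.
  by rewrite ler_pdivrMr// mulrC ler_pM2l// ltW.
exists r, (fun s : {ffun 'I_m -> 'I_r.+1} => psi (\row_j ((s j)%:R / r%:R))) => x.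
have p01 j := sine_coord_itv A (x ord0 j).
have [box|] := pselect (forall j, `|x ord0 j| <= A).
  have <- : psi (\row_j sine_coord A (x ord0 j)) = phi x.
    by congr phi; apply/rowP => j; rewrite !mxE sine_nodeK.
  apply: le_trans (grid_approx (b := b) (e := e / 2) eta0 r0 p01 _ _ _) _.
  - by move=> u; exact: phib.
  - exact: ltW.
  - by move=> v uv; apply: unif => j; rewrite !mxE.
  - apply: (@le_trans _ _ e); first by move: rP; lra.
    by rewrite lerDl !mulr_ge0// tail_ge0.
move=> /existsNP[j /negP]; rewrite -ltNge => out.
have -> : tail A x = 1.
  apply/min_idPl; apply: (@le_trans _ _ (`|x ord0 j| / A)).
    by rewrite ler_pdivlMr// mul1r ltW.
  by rewrite (bigD1 j)//= lerDl sumr_ge0// => l _; rewrite divr_ge0// ltW.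
apply: (@le_trans _ _ (b + b)); last by lra.
apply: le_trans (ler_normB _ _) _; rewrite lerD//.
apply: le_trans (ler_norm_sum _ _ _) _.
rewrite -[leRHS]mulr1 -(sum_grid_weight (fun j => sine_coord A (x ord0 j)) r) mulr_sumr.
apply: ler_sum => s _; rewrite normrM [X in _ * X]ger0_norm; last exact: grid_weight_ge0.
by apply: ler_wpM2r; [exact: grid_weight_ge0|exact: phib].
Qed.

End TrigonometricApproximation.

(** * Logarithmic averages of numerical sequences *)

Section LogarithmicAverage.
Context {R : realType}.
Implicit Types a b c : nat -> R.

Definition log_average a (N : nat) : R :=
  (ln N%:R)^-1 * \sum_(1 <= n < N.+1) n%:R^-1 * a n.

Lemma log_averageD a b N :
  log_average (fun n => a n + b n) N = log_average a N + log_average b N.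
Proof.
rewrite /log_average -mulrDr -big_split; congr (_ * _).
by apply: eq_bigr => n _; rewrite mulrDr.
Qed.

Lemma log_averageZ (x : R) a N : log_average (fun n => x * a n) N = x * log_average a N.
Proof.
rewrite /log_average [RHS]mulrCA; congr (_ * _); rewrite mulr_sumr.
by apply: eq_bigr => n _; rewrite mulrCA.
Qed.

Lemma log_average_sum (I : finType) (a : I -> nat -> R) N :
  log_average (fun n => \sum_i a i n) N = \sum_i log_average (a i) N.
Proof.
transitivity ((ln N%:R)^-1 * \sum_i \sum_(1 <= n < N.+1) n%:R^-1 * a i n); last first.
  by rewrite mulr_sumr.
rewrite exchange_big; congr (_ * _).
by apply: eq_bigr => n _; rewrite mulr_sumr.
Qed.

Lemma log_average_cst (x : R) N : log_average (fun=> x) N = x * ((ln N%:R)^-1 * harm N).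
Proof. by rewrite /log_average -mulr_suml mulrA mulrC. Qed.

Lemma ln_nat_ge0 N : 0 <= ln (N%:R : R).
Proof.
case: N => [|N]; first by rewrite ln0.
by rewrite ln_ge0// ler1n.
Qed.

Lemma ler_log_average a b N : (forall n, a n <= b n) -> log_average a N <= log_average b N.
Proof.
move=> ab; rewrite ler_wpM2l ?invr_ge0 ?ln_nat_ge0//; apply: ler_sum => n _.
by rewrite ler_wpM2l ?invr_ge0.
Qed.

Lemma log_average_dist a b c N : (forall n, `|a n - b n| <= c n) ->
  `|log_average a N - log_average b N| <= log_average c N.
Proof.
move=> abc; rewrite -mulN1r -log_averageZ -log_averageD.
rewrite /log_average normrM ger0_norm ?invr_ge0 ?ln_nat_ge0// ler_wpM2l ?invr_ge0 ?ln_nat_ge0//.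
apply: le_trans (ler_norm_sum _ _ _) _; apply: ler_sum => n _.
by rewrite normrM ger0_norm ?invr_ge0// ler_wpM2l ?invr_ge0// mulN1r.
Qed.

Lemma near_ln_ge (x : R) : \forall N \near \oo, x <= ln (N%:R : R).
Proof.
exists (Num.truncn (expR x)).+1 => // N /= xN.
have H : expR x <= N%:R.
  by apply: le_trans (ltW (truncnS_gt _)) _; rewrite ler_nat.
rewrite -[leLHS]expRK ler_ln ?posrE ?expR_gt0//.
exact: lt_le_trans (expR_gt0 x) H.
Qed.

(** Once [ln N >= 1], the normalization satisfies [harm N <= 1 + ln N <= 2 * ln N]; this is the
    factor 2 of the later tail bounds. *)
Lemma near_log_average_cst_le (x : R) : 0 <= x ->
  \forall N \near \oo, log_average (fun=> x) N <= 2 * x.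
Proof.
move=> x0; near=> N; rewrite log_average_cst mulrC ler_wpM2r//.
have l1 : 1 <= ln (N%:R : R) by near: N; exact: near_ln_ge.
have N0 : (0 < N)%N by near: N; exists 1%N.
rewrite mulrC ler_pdivrMr; last exact: lt_le_trans l1.
by apply: le_trans (harm_le N0) _; move: (ln _) l1 => l; lra.
Unshelve. all: by end_near. Qed.

Lemma log_average_cvg a (l : R) : a n @[n --> \oo] --> l ->
  log_average a N @[N --> \oo] --> l.
Proof.
move=> al; apply/cvgrPdist_le => e e0; have e3 : 0 < e / 3 by rewrite divr_gt0.
have /cvgrPdist_le/(_ _ e3)[M0 _ HM] := al.
pose M := M0.+1; pose D := \sum_(1 <= n < M) n%:R^-1 * `|a n - l|.
have D0 : 0 <= D by apply: sumr_ge0 => n _; rewrite mulr_ge0 ?invr_ge0.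
near=> N.
have l1 : 1 <= ln (N%:R : R) by near: N; exact: near_ln_ge.
(* The terms before [M] and the difference [harm N - ln N], which lies in [[0, 1]], together cost
   [e / 3 * ln N]; the terms close to the limit cost [e / 3 * harm N], at most twice as much. *)
have lD : (D + `|l|) / (e / 3) <= ln (N%:R : R) by near: N; exact: near_ln_ge.
have MN : (M <= N)%N by near: N; exists M.
have N0 : (0 < N)%N by exact: leq_trans MN.
have l0 : 0 < ln (N%:R : R) by exact: lt_le_trans l1.
have S : \sum_(1 <= n < N.+1) n%:R^-1 * `|a n - l| <= D + e / 3 * harm N.
  rewrite (big_cat_nat (n := M)) ?(leqW MN)//= lerD2l.
  apply: (@le_trans _ _ (\sum_(M <= n < N.+1) n%:R^-1 * (e / 3))).
    apply: ler_sum_nat => n /andP[Mn _]; rewrite ler_wpM2l ?invr_ge0// distrC.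
    by apply: HM => /=; exact: ltnW Mn.
  rewrite -mulr_suml mulrC ler_wpM2l ?(ltW e3)// /harm [leRHS](big_cat_nat (n := M)) ?(leqW MN)//=.
  by rewrite lerDr sumr_ge0// => n _; rewrite invr_ge0.
have hle := harm_le (R := R) N0; have hge := harm_ge (R := R) N0.
have S' : `|\sum_(1 <= n < N.+1) n%:R^-1 * (a n - l)| <= D + e / 3 * harm N.
  apply: le_trans (ler_norm_sum _ _ _) _; apply: le_trans S; apply: ler_sum => n _.
  by rewrite normrM ger0_norm ?invr_ge0.
have E : log_average a N - l =
    (ln N%:R)^-1 * (\sum_(1 <= n < N.+1) n%:R^-1 * (a n - l) + l * (harm N - ln N%:R)).
  under eq_bigr do rewrite mulrBr.
  rewrite sumrB -mulr_suml -/(harm N) /log_average.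
  move: (ln _) l0 => L L0; move: (harm N) => h; field; exact: lt0r_neq0.
rewrite distrC E normrM ger0_norm ?invr_ge0 ?(ltW l0)// mulrC ler_pdivrMr//.
apply: le_trans (ler_normD _ _) _.
have T2 : `|l * (harm N - ln N%:R)| <= `|l|.
  rewrite normrM ler_piMr// ger0_norm ?subr_ge0//; move: hle; move: (ln _) => L; lra.
apply: le_trans (lerD S' T2) _.
move: lD; rewrite ler_pdivrMr// => lD.
have : e / 3 * harm N <= e / 3 * (ln N%:R + ln N%:R).
  by rewrite ler_wpM2l ?(ltW e3)//; move: hle l1; move: (ln _) => L; lra.
move: lD; move: (ln _) (harm _) => L h; lra.
Unshelve. all: by end_near. Qed.

End LogarithmicAverage.

(** * The almost sure event *)

Section Tails.
Context {R : realType} {m : nat}.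
Local Notation E := 'rV[R]_m.

Lemma measurable_tail {d : measure_display} {S : measurableType d} (A : R) (Y : 'I_m -> S -> R) :
  (forall j, measurable_fun setT (Y j)) -> measurable_fun setT (fun w => tail A (\row_j Y j w)).
Proof.
move=> mY; apply: measurable_minr; first exact: measurable_cst.
under eq_fun do under eq_bigr do rewrite mxE.
apply: measurable_sum => j; apply: measurable_funM => //.
exact: measurableT_comp.
Qed.

Lemma tail_le1 A (x : E) : tail A x <= 1.
Proof. by rewrite /tail ge_min lexx. Qed.

Lemma test_function_tail A : 0 < A -> test_function (tail A : E -> R).
Proof.
move=> A0; split; last by move=> d S Y; exact: measurable_tail.
have Ai : 0 < A^-1 by rewrite invr_gt0.
exists (1 + A^-1); split=> [x|x y].
  by rewrite ger0_norm ?tail_ge0// (le_trans (tail_le1 _ _))// lerDl ltW.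
have minL (a b : R) : `|Num.min 1 a - Num.min 1 b| <= `|a - b|.
  wlog ab : a b / a <= b.
    by move=> H; case: (leP a b) => [|/ltW] ab; [|rewrite distrC [leRHS]distrC]; exact: H.
  rewrite distrC [leRHS]distrC [leRHS]ger0_norm ?subr_ge0//.
  by rewrite ger0_norm ?subr_ge0; case: (leP 1 a) => ?; case: (leP 1 b) => ?; lra.
apply: le_trans (minL _ _) _.
rewrite -sumrB mulr_sumr; apply: le_trans (ler_norm_sum _ _ _) _; apply: ler_sum => j _.
rewrite -mulrBl normrM [X in _ * X]gtr0_norm// mulrC; apply: ler_pM => //; first exact: ltW.
  by rewrite lerDr.
exact: ler_dist_dist.
Qed.

(** Markov's inequality, through [|y| <= 1 + y ^ 2] in each coordinate. *)
Lemma mean_tail_le {d : measure_display} {S : measurableType d} (P : probability S R) (A K : R)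
    (Y : 'I_m -> S -> R) : 0 < A -> (forall j, all_moments P (Y j)) ->
  (forall j, mean P (fun w => Y j w ^+ 2) <= K) ->
  mean P (fun w => tail A (\row_j Y j w)) <= m%:R * (1 + K) / A.
Proof.
move=> A0 aY YK; have Ai : 0 <= A^-1 by rewrite invr_ge0 ltW.
have mY j : measurable_fun setT (Y j) by exact: all_moments_measurable (aY j).
have aS : all_moments P (fun w => \sum_j (1 + Y j w ^+ 2)).
  by apply: all_moments_sum => j _; apply: all_momentsD; [exact: all_moments_cst|exact: all_momentsX].
apply: (@le_trans _ _ (mean P (fun w => A^-1 * \sum_j (1 + Y j w ^+ 2)))).
  apply: le_mean.
  - apply: (@all_moments_bounded _ _ _ P _ 1); first exact: measurable_tail.
    by move=> w; rewrite ger0_norm ?tail_ge0// tail_le1.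
  - exact: all_momentsZ.
  - move=> w; rewrite /tail ge_min mulr_sumr; apply/orP; right; apply: ler_sum => j _.
    rewrite mxE mulrC ler_wpM2l// -(real_normK (num_real (Y j w))).
    by move: (`|_|) (normr_ge0 (Y j w)) => y y0; nra.
rewrite meanZ// mulrC ler_wpM2r// mean_sum; last first.
  by move=> j _; apply: all_momentsD; [exact: all_moments_cst|exact: all_momentsX].
apply: (@le_trans _ _ (\sum_(j < m) (1 + K))); last by rewrite sumr_const card_ord mulr_natl.
apply: ler_sum => j _; rewrite (meanD (all_moments_cst P 1)); last exact: all_momentsX.
by rewrite mean_cst lerD2l.
Qed.

End Tails.

(** * From trigonometric and tail test functions to continuous bounded ones *)

Section Reduction.
Context {R : realType} {m : nat}.
Local Notation E := 'rV[R]_m.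
Context {d : measure_display} {S : measurableType d} (Q : probability S R).
Variable Z : 'I_m -> S -> R.
Hypothesis Z_moments : forall j, all_moments Q (Z j).
Variables (phi : E -> R) (b : R).
Hypothesis phi_continuous : continuous phi.
Hypothesis phi_bounded : forall x, `|phi x| <= b.

Let mZ j : measurable_fun setT (Z j) := all_moments_measurable (Z_moments j).

Let b_ge0 : 0 <= b. Proof. exact: le_trans (phi_bounded 0). Qed.

Let measurable_combination A r (c : {ffun 'I_m -> 'I_r.+1} -> R) :
  measurable_fun setT (fun w => \sum_s c s * trig_weight A s (\row_j Z j w)).
Proof.
apply: measurable_sum => s; apply: measurable_funM => //.
exact: (trig_poly_measurable (trig_poly_weight A s)).
Qed.

(** A pointwise limit of trigonometric combinations, with box size [n + 1] and precision
    [1 / (n + 1)]: at a fixed point the tail term tends to 0. *)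
Lemma measurable_continuous_row : measurable_fun setT (fun w => phi (\row_j Z j w)).
Proof.
have ap (n : nat) : {f : S -> R | measurable_fun setT f /\ forall w,
    `|phi (\row_j Z j w) - f w| <= n.+1%:R^-1 + 2 * b * tail n.+1%:R (\row_j Z j w)}.
  apply: cid; have n0 : (0 : R) < n.+1%:R by rewrite ltr0n.
  have ni : (0 : R) < n.+1%:R^-1 by rewrite invr_gt0.
  have [r [c H]] := trig_approx phi_continuous phi_bounded n0 ni.
  exists (fun w => \sum_s c s * trig_weight n.+1%:R s (\row_j Z j w)); split=> [|w]; last exact: H.
  exact: measurable_combination.
apply: (@measurable_fun_cvg _ _ _ _ (fun n => sval (ap n))).
  by move=> n; have [] := svalP (ap n).
move=> w _; set x : E := \row_j Z j w.
have c0 : (n.+1%:R^-1 + 2 * b * (\sum_j `|x ord0 j| * n.+1%:R^-1)) @[n --> \oo] --> (0 : R).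
  rewrite [X in _ --> X](_ : _ = 0 + 2 * b * (\sum_j `|x ord0 j| * 0)); last first.
    by rewrite big1 ?mulr0 ?addr0// => j _; rewrite mulr0.
  apply: (@cvgD _ R^o); first exact: cvg_harmonic.
  apply: cvgM; first exact: cvg_cst.
  apply: (cvgn_sum (u := fun j n => `|x ord0 j| * n.+1%:R^-1)
    (a := fun j => `|x ord0 j| * 0)) => j _.
  apply: cvgM; first exact: cvg_cst.
  exact: cvg_harmonic.
apply/cvgrPdist_le => e e0; move/cvgrPdist_le : c0 => /(_ _ e0); apply: filterS => n.
rewrite sub0r normrN => H; apply: le_trans H; apply: le_trans (ler_norm _).
have [_ Hn] := svalP (ap n); apply: le_trans (Hn w) _.
by rewrite lerD2l ler_wpM2l ?mulr_ge0// /tail ge_min lexx orbT.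
Qed.

Variables (x : nat -> E) (K : R).
Hypothesis Z_second : forall j, mean Q (fun w => Z j w ^+ 2) <= K.
Hypothesis weights_cvg : forall A r (s : {ffun 'I_m -> 'I_r.+1}),
  log_average (fun n => trig_weight A.+1%:R s (x n)) N @[N --> \oo] -->
  mean Q (fun w => trig_weight A.+1%:R s (\row_j Z j w)).
Hypothesis tail_small : forall A e, 0 < e ->
  \forall N \near \oo, log_average (fun n => tail A.+1%:R (x n)) N <= 2 * (m%:R * (1 + K) / A.+1%:R) + e.

Lemma log_average_continuous_cvg :
  log_average (fun n => phi (x n)) N @[N --> \oo] --> mean Q (fun w => phi (\row_j Z j w)).
Proof.
apply/cvgrPdist_le => e e0.
have b1 : 0 < 1 + b by rewrite ltr_pwDl.
(* The errors [T1], [T2] and [T3] are [2 q + 6 b q], [q] and [q + 2 b q], whose sum is below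
   [20 q (1 + b) = e]. *)
pose q := e / (1 + b) / 20; have q0 : 0 < q by rewrite !divr_gt0.
have eE : e = 20 * q * (1 + b) by rewrite /q; field; rewrite gt_eqF.
have [A AP] : exists A : nat, m%:R * (1 + K) / A.+1%:R <= q.
  exists (Num.truncn (m%:R * (1 + K) / q)).
  rewrite ler_pdivrMr ?ltr0n// [leRHS]mulrC -ler_pdivrMr//.
  by apply: ltW; exact: truncnS_gt.
have A0 : (0 : R) < A.+1%:R by rewrite ltr0n.
have [r [c H]] := trig_approx phi_continuous phi_bounded A0 q0.
pose G (y : E) := \sum_s c s * trig_weight A.+1%:R s y.
have aw s : all_moments Q (fun w => trig_weight A.+1%:R s (\row_j Z j w)).
  exact: (trig_poly_all_moments Q (trig_poly_weight A.+1%:R s)).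
have aG : all_moments Q (fun w => G (\row_j Z j w)).
  by apply: all_moments_sum => s _; exact: all_momentsZ.
have aphi : all_moments Q (fun w => phi (\row_j Z j w)).
  by apply: (all_moments_bounded Q measurable_continuous_row) => w; exact: phi_bounded.
have at_ : all_moments Q (fun w => tail A.+1%:R (\row_j Z j w)).
  apply: (@all_moments_bounded _ _ _ Q _ 1); first exact: measurable_tail.
  by move=> w; rewrite ger0_norm ?tail_ge0// tail_le1.
have G_cvg : log_average (fun n => G (x n)) N @[N --> \oo] --> mean Q (fun w => G (\row_j Z j w)).
  rewrite mean_sum; last by move=> s _; exact: all_momentsZ.
  under eq_fun do rewrite log_average_sum.
  apply: cvgn_sum => s _; rewrite meanZ//.
  under eq_fun do rewrite log_averageZ.
  by apply: cvgM; [exact: cvg_cst|exact: weights_cvg].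
have T3 : `|mean Q (fun w => phi (\row_j Z j w)) - mean Q (fun w => G (\row_j Z j w))| <=
    q + 2 * b * q.
  rewrite -(meanB aphi aG); apply: le_trans (normr_mean (all_momentsB aphi aG)) _.
  apply: (@le_trans _ _ (mean Q (fun w => q + 2 * b * tail A.+1%:R (\row_j Z j w)))).
    apply: le_mean.
    - exact: all_moments_abs (all_momentsB aphi aG).
    - by apply: all_momentsD; [exact: all_moments_cst|exact: all_momentsZ].
    - by move=> w; exact: H.
  rewrite (meanD (all_moments_cst Q q) (all_momentsZ _ at_)) mean_cst meanZ// lerD2l.
  rewrite ler_wpM2l ?mulr_ge0//.
  exact: le_trans (mean_tail_le A0 Z_moments Z_second) AP.
near=> N.
have T2 : `|mean Q (fun w => G (\row_j Z j w)) - log_average (fun n => G (x n)) N| <= q.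
  by near: N; move/cvgrPdist_le : G_cvg; exact.
have Tt : log_average (fun n => tail A.+1%:R (x n)) N <= 3 * q.
  apply: (@le_trans _ _ (2 * (m%:R * (1 + K) / A.+1%:R) + q)); last first.
    by move: AP; move: (_ / _) => y; lra.
  by near: N; exact: tail_small.
have Tc : log_average (fun=> q) N <= 2 * q.
  by near: N; apply: near_log_average_cst_le; exact: ltW.
have T1 : `|log_average (fun n => phi (x n)) N - log_average (fun n => G (x n)) N| <=
    2 * q + 2 * b * (3 * q).
  apply: le_trans (log_average_dist _ (fun n => H (x n))) _.
  rewrite log_averageD log_averageZ lerD// ler_wpM2l// mulr_ge0//.
have bq : 0 <= b * q by rewrite mulr_ge0// ltW.
have -> : e = 20 * q + 20 * (b * q) by rewrite eE; ring.
have E1 : 2 * q + 2 * b * (3 * q) = 2 * q + 6 * (b * q) by ring.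
have E3 : q + 2 * b * q = q + 2 * (b * q) by ring.
rewrite E1 in T1; rewrite E3 in T3; rewrite distrC in T1.
move: T1 T2 T3; rewrite !ler_norml.
move: (b * q) bq (mean _ _) (mean _ _) (log_average _ _) (log_average _ _) => v v0 x1 x2 x3 x4.
by move=> /andP[? ?] /andP[? ?] /andP[? ?]; apply/andP; split; lra.
Unshelve. all: by end_near. Qed.

End Reduction.

Section AlmostSureEvent.
Context {R : realType} {d : measure_display} {T : measurableType d} {P : probability T R}.
Variable X : nat -> nat -> {RV P >-> R}.
Variable B : nat -> R.
Hypothesis X_moments : forall i j, moments_le P B (X i j).
Hypothesis X_indep : mutually_independent (fun e : nat * nat => X e.1 e.2).
Hypothesis X_mean : forall i j, mean P (X i j) = 0.
Hypothesis X_var : forall i j, mean P (fun w => X i j w ^+ 2) = 1.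
Context {d' : measure_display} {T' : measurableType d'} {Q : probability T' R}.
Variables (m : nat) (k : 'I_m -> nat) (Z : 'I_m -> {RV Q >-> R}).
Hypothesis m_gt0 : (0 < m)%N.
Hypothesis k_ge1 : forall j, (0 < k j)%N.
Hypothesis k_inj : injective k.
Hypothesis Z_indep : mutually_independent Z.
Hypothesis Z_gauss : forall j, centered_gaussian (k j)%:R (Z j).

Lemma ae_log_average_test (g : 'rV[R]_m -> R) : test_function g ->
  {ae P, forall w, log_average (fun n => g (trace_vector X k n w)) N -
    log_average (fun n => mean P (fun w' => g (trace_vector X k n w'))) N @[N --> \oo] --> (0 : R)}.
Proof.
move=> tg; have := ae_test_average X_moments X_indep X_mean k_ge1 tg.
apply: filterS => w; apply: cvg_trans; apply: near_eq_cvg; near=> N.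
rewrite -mulN1r -log_averageZ -log_averageD /log_average /weighted_sum; congr (_ * _).
by apply: eq_bigr => n _; rewrite /centered_test mulN1r.
Unshelve. all: by end_near. Qed.

Lemma ae_trig_average (g : 'rV[R]_m -> R) : trig_poly g ->
  {ae P, forall w, log_average (fun n => g (trace_vector X k n w)) N @[N --> \oo] -->
    mean Q (fun w' => g (\row_j Z j w'))}.
Proof.
move=> tg; have test : test_function g.
  split; first exact: trig_poly_lipschitz.
  by move=> d1 S Y; exact: trig_poly_measurable.
have := ae_log_average_test test; apply: filterS => w H.
have H2 := log_average_cvg (trig_mean_cvg X_moments X_indep X_mean X_var m_gt0 k_ge1 k_inj
  Z_indep Z_gauss tg).
rewrite -[mean Q _]add0r.
rewrite (_ : log_average _ = fun N => (log_average (fun n => g (trace_vector X k n w)) N -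
    log_average (fun n => mean P (fun w' => g (trace_vector X k n w'))) N) +
    log_average (fun n => mean P (fun w' => g (trace_vector X k n w'))) N); last first.
  by apply/funext => N; rewrite subrK.
exact: (@cvgD _ R^o).
Qed.

(** The second moments converge, by [trace_moment_cvg] for the list [[:: j; j]], hence are bounded
    in [n]; summing over [j] gives one bound. *)
Lemma trace_second_moment_bounded : exists2 K : R, 0 <= K & forall n j,
  mean P (fun w => centered_tr_power X n (k j) w ^+ 2) <= K.
Proof.
have bd j : {C : R | forall n, mean P (fun w => centered_tr_power X n (k j) w ^+ 2) <= C}.
  apply: cid.
  have := trace_moment_cvg X_moments X_indep X_mean X_var k_ge1 k_inj Z_indep Z_gauss
    (s := [:: j; j]).
  move=> H; have : cvgn (fun n => trace_moment X k n [:: j; j]) by apply/cvg_ex; eexists; exact: H.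
  move=> /(@cvg_seq_bounded R R)[C [_ HC]]; exists (C + 1) => n.
  have := HC (C + 1); rewrite ltrDl ltr01 => /(_ isT n I) Hn.
  apply: le_trans Hn; apply: le_trans (ler_norm _); rewrite /trace_moment le_eqVlt; apply/orP; left.
  apply/eqP; congr (mean P _); apply/funext => w.
  by rewrite big_cons big_seq1 expr2.
exists (\sum_j `|sval (bd j)|) => [|n j]; first exact: sumr_ge0.
apply: le_trans (svalP (bd j) n) _; apply: le_trans (ler_norm _) _.
by rewrite (bigD1 j)//= lerDl sumr_ge0.
Qed.

Lemma ae_log_average_continuous :
  {ae P, forall w, forall phi : 'rV[R]_m -> R, continuous phi -> bounded_fun phi ->
    log_average (fun n => phi (trace_vector X k n w)) N @[N --> \oo] -->
    mean Q (fun w' => phi (\row_j Z j w'))}.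
Proof.
have aZ j : all_moments Q (Z j) := all_moments_gaussian (k_ge1 j) (Z_gauss j).
have aW n j : all_moments P (centered_tr_power X n (k j)).
  exact: (all_moments_centered_tr_power X_moments).
have [K1 K10 K1P] := trace_second_moment_bounded.
pose K := K1 + \sum_j mean Q (fun w => Z j w ^+ 2).
have Z2 j : 0 <= mean Q (fun w => Z j w ^+ 2) by apply: mean_ge0 => w; exact: sqr_ge0.
have KZ j : mean Q (fun w => Z j w ^+ 2) <= K.
  by rewrite /K (bigD1 j)//= addrCA lerDl addr_ge0// sumr_ge0.
have KW n j : mean P (fun w => centered_tr_power X n (k j) w ^+ 2) <= K.
  by apply: le_trans (K1P n j) _; rewrite lerDl sumr_ge0.
have K0 : 0 <= K by rewrite addr_ge0// sumr_ge0.
have weights : {ae P, forall w, forall A r (s : {ffun 'I_m -> 'I_r.+1}),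
    log_average (fun n => trig_weight A.+1%:R s (trace_vector X k n w)) N @[N --> \oo] -->
    mean Q (fun w' => trig_weight A.+1%:R s (\row_j Z j w'))}.
  apply: ae_foralln => A; apply: ae_foralln => r.
  by apply: filter_forall => s; apply: ae_trig_average; exact: trig_poly_weight.
have tails : {ae P, forall w, forall A : nat,
    log_average (fun n => tail A.+1%:R (trace_vector X k n w)) N -
    log_average (fun n => mean P (fun w' => tail A.+1%:R (trace_vector X k n w'))) N
      @[N --> \oo] --> (0 : R)}.
  apply: ae_foralln => A; apply: ae_log_average_test; apply: test_function_tail.
  by rewrite ltr0n.
move: weights tails; apply: filterS2 => w weights tails phi cphi [b [_ bP]].
have phib x : `|phi x| <= b + 1 by apply: (bP (b + 1)) => //; rewrite ltrDl.
apply: (log_average_continuous_cvg aZ cphi phib KZ weights) => A e e0.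
have A0 : (0 : R) < A.+1%:R by rewrite ltr0n.
have c0 : 0 <= m%:R * (1 + K) / A.+1%:R :> R.
  exact: divr_ge0 (mulr_ge0 (ler0n _ _) (addr_ge0 ler01 K0)) (ltW A0).
near=> N.
have h1 : log_average (fun n => mean P (fun w' => tail A.+1%:R (trace_vector X k n w'))) N <=
    2 * (m%:R * (1 + K) / A.+1%:R).
  apply: le_trans (ler_log_average N (b := fun=> m%:R * (1 + K) / A.+1%:R) _) _.
    by move=> n; apply: mean_tail_le.
  by near: N; exact: near_log_average_cst_le.
have h2 : `|0 - (log_average (fun n => tail A.+1%:R (trace_vector X k n w)) N -
    log_average (fun n => mean P (fun w' => tail A.+1%:R (trace_vector X k n w'))) N)| <= e.
  by near: N; move/cvgrPdist_le : (tails A) => /(_ _ e0).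
move: h1 h2; rewrite sub0r normrN ler_norml => h1 /andP[_ h2].
by rewrite -lerBlDl; apply: le_trans h2; rewrite lerB.
Unshelve. all: by end_near. Qed.

End AlmostSureEvent.

Theorem theorem1p5 (R : realType)
    (d0 : measure_display) (T0 : measurableType d0) (P0 : probability T0 R)
    (X0 : {RV P0 >-> R})
    (X0_mean : ('E_P0[X0] = 0)%E)
    (X0_second_moment : ('E_P0[fun w => (X0 w ^+ 2)%R] = 1)%E)
    (X0_moments : forall n : nat, (3 <= n)%N ->
       ('E_P0[fun w => (`|X0 w| ^+ n)%R] < +oo)%E)
    (d : measure_display) (T : measurableType d) (P : probability T R)
    (X : nat -> nat -> {RV P >-> R})
    (X_indep : mutually_independent (fun ij : nat * nat => X ij.1 ij.2))
    (X_law : forall i j : nat, same_law (X i j) X0)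
    (m : nat) (m_ge1 : (1 <= m)%N)
    (k : 'I_m -> nat) (k_ge1 : forall j : 'I_m, (1 <= k j)%N)
    (k_incr : forall i j : 'I_m, (i < j)%N -> (k i < k j)%N)
    (d' : measure_display) (T' : measurableType d') (Q : probability T' R)
    (Z : 'I_m -> {RV Q >-> R})
    (Z_indep : mutually_independent Z)
    (Z_gauss : forall j : 'I_m, centered_gaussian (k j)%:R (Z j)) :
  {ae P, forall w, forall phi : 'rV[R]_m -> R,
     continuous phi -> bounded_fun phi ->
     (ln N%:R)^-1 *
       (\sum_(1 <= n < N.+1)
          n%:R^-1 * phi (\row_(j < m) centered_tr_power X n (k j) w))
       @[N --> \oo]
     --> fine 'E_Q[fun w' => phi (\row_(j < m) Z j w')]}.
Proof.
have [B X_B] := entries_moments X0_moments X_law.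
have k_inj : injective k.
  move=> i j kij; apply/val_inj/eqP; case: ltngtP => // /k_incr; by rewrite kij ltnn.
have := ae_log_average_continuous X_B X_indep (entries_mean X0_mean X0_moments X_law)
  (entries_variance X0_second_moment X0_moments X_law) m_ge1 k_ge1 k_inj Z_indep Z_gauss.
by apply: filterS => w H phi cphi bphi; rewrite fine_expectation; exact: H.
Qed.
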